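(* Let $S^1\to R\to\Gamma\rightrightarrows M$ be an $S^1$-central extension of Lie groupoids. For a positive integer $n$, consider the following properties: (i) there exists a rank $n$ twisted vector bundle; (ii) there exists an $S^1$-equivariant generalized homomorphism $R\to GL_n(\mathbb C)$, where $GL_n(\mathbb C)$ is naturally considered as an $S^1$-central extension of $PGL_n(\mathbb C)$: $S^1\to GL_n(\mathbb C)\to PGL_n(\mathbb C)$; (ii)' there exists a generalized homomorphism $\Gamma\to PGL_n(\mathbb C)$ such that $R$ is the pull-back of $GL_n(\mathbb C)\to PGL_n(\mathbb C)$; (iii) there exist an open cover $(U_i)$ of $M$ and a groupoid homomorphism $\psi:R[U_i]\to\mathbb C^*$ such that $\psi(\lambda r)=\lambda^n\psi(r)$ for all $\lambda\in S^1$ and $r\in R[U_i]$; (iv) $R^n=R\otimes\cdots\otimes R$ ($n$ factors) is a trivial extension; (v) there exist an open cover $(U_i)$ of $M$ and a $\mathbb Z_n$-central extension $\mathbb Z_n\to R'\to\Gamma[U_i]\rightrightarrows\coprod U_i$ such that $R[U_i]=R'\times_{\mathbb Z_n}S^1$, where $\mathbb Z_n$ is identified with the group of $n$-th roots of unity in $S^1\subset\mathbb C$. Then (i)$\iff$(ii)$\implies$(iii)$\iff$(iv)$\iff$(v).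
   Context: An $S^1$-central extension of a Lie groupoid $\Gamma\rightrightarrows M$ is a Lie groupoid $R\rightrightarrows M$ with a groupoid morphism $\pi:R\to\Gamma$ that is the identity on $M$ and a left $S^1$-action on $R$ making $\pi$ a principal $S^1$-bundle, with $(\lambda x)(\mu y)=\lambda\mu\,(xy)$ for composable $x,y$; $\mathbb Z_n$-central extensions are defined in the same way with $\mathbb Z_n$ in place of $S^1$. For an open cover $(U_i)$ of $M$, $\Gamma[U_i]\rightrightarrows\coprod U_i$ is the pull-back groupoid $\{(y_1,y_2,\gamma):\ t(\gamma)=\text{image of }y_1,\ s(\gamma)=\text{image of }y_2\}$, $y_1,y_2\in\coprod U_i$ ($s,t$ source and target). The tensor product of extensions is $R\otimes R'=(R\times_\Gamma R')/S^1$ with $(r,r')\sim(\lambda r,\lambda^{-1}r')$. An extension $R$ is trivial if there is an open cover $(U_i)$ of $M$ such that $R[U_i]\to\Gamma[U_i]$ is strictly trivial, i.e. isomorphic to $\Gamma[U_i]\times S^1$ (equivalently, its class in the group of Morita equivalence classes of extensions is $0$). A twisted vector bundle (more precisely a $(\Gamma,R)$-twisted vector bundle) is a complex vector bundle $E\to M$ with a fibrewise linear action of the groupoid $R$ such that $(\lambda r)\cdot x=\lambda(r\cdot x)$ for $\lambda\in S^1\subset\mathbb C$. A generalized homomorphism from $\Gamma_1\rightrightarrows M_1$ to $\Gamma_2\rightrightarrows M_2$ is a manifold $Z$ with smooth maps $M_1\leftarrow Z\to M_2$, a left $\Gamma_1$-action and a right $\Gamma_2$-action which commute, such that $Z\to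 M_1$ is a locally trivial principal $\Gamma_2$-bundle. Every generalized homomorphism is the composition of the canonical Morita equivalence between $\Gamma_1$ and $\Gamma_1[U_i]$, for some open cover $(U_i)$ of $M_1$, with a strict homomorphism $\Gamma_1[U_i]\to\Gamma_2$, and central extensions are pulled back along it accordingly. A generalized homomorphism from $R$ to $R'$, where $R$ and $R'$ are $S^1$-central extensions, is $S^1$-equivariant if $Z$ carries an $S^1$-action with $(\lambda r)\cdot z\cdot r'=r\cdot(\lambda z)\cdot r'=r\cdot z\cdot(\lambda r')$ whenever the products make sense. Groups are regarded as groupoids over a point. *)

(* Defs.v *)
From HB Require Import structures.
From mathcomp Require Import all_boot all_order all_algebra.
From mathcomp Require Import complex.
From mathcomp Require Import all_classical all_reals topology normedtype landau.
From mathcomp Require Import derive.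
Import numFieldNormedType.Exports.
Import Order.TTheory GRing.Theory Num.Theory.
Set Implicit Arguments.
Unset Strict Implicit.
Unset Printing Implicit Defensive.
Local Open Scope classical_set_scope.
Local Open Scope ring_scope.

(* Smooth spaces are diffeological spaces: a set together with its smooth
   parametrisations ("plots") by open subsets of the spaces R^d.  Manifolds are
   the diffeological spaces that are Hausdorff, second countable and locally
   diffeomorphic to R^d; they form a full subcategory, and inside it a fibre
   product along a submersion carries the subset diffeology, a disjoint union the
   sum diffeology, and the base of a principal bundle the quotient diffeology.
   Fibre products, pull-back groupoids, and quotients by principal actions are
   therefore formed in diffeological spaces, without constructing charts. *)

Section Smooth.
Variable K : realType.
Implicit Types (k d e : nat).

(* C^k in the Fréchet sense on an open set [U]. *)
Fixpoint Ck k d (U : set 'rV[K]_d) (f : 'rV[K]_d -> K) : Prop :=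
  if k is k'.+1 then
    (forall x, U x -> differentiable f x) /\
    (forall v : 'rV[K]_d, Ck k' U (fun x => 'd f x v))
  else forall x, U x -> {for x, continuous f}.

Definition Cinfty d (U : set 'rV[K]_d) (f : 'rV[K]_d -> K) := forall k, Ck k U f.

Definition Cinfty_map d e (U : set 'rV[K]_d) (g : 'rV[K]_d -> 'rV[K]_e) :=
  forall i, Cinfty U (fun x => g x 0 i).

Lemma near_eq_diff d (f g : 'rV[K]_d -> K) x : (\near x, f x = g x) ->
  differentiable f x -> differentiable g x /\ forall v, 'd g x v = 'd f x v.
Proof.
move=> fg df.
have e0 : f x = g x by exact: nbhs_singleton fg.
have H : g \o shift x = cst (g x) + 'd f x +o_ 0 id.
  have fg0 : \forall y \near (0 : 'rV[K]_d), f (y + x) = g (y + x).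
    by move: fg; rewrite (near_shift 0 x); apply: filterS => y /=; rewrite subr0.
  have eqaddo_littleo := (eqaddoP _ _ _ _).1 (diff_locally df).
  apply/eqaddoP => eps eps0.
  have := eqaddo_littleo eps eps0; move: fg0; apply: filterS2 => y E /=.
  by rewrite !fctE /= E e0.
have ext : 'd g x = 'd f x :> (_ -> _).
  by apply: diff_unique => //; exact: diff_continuous.
split; last by move=> v; rewrite ext.
by apply/diff_locallyP; split; [rewrite ext; exact: diff_continuous|rewrite ext].
Qed.

Lemma Ck_local k d (U : set 'rV[K]_d) f :
  (forall x, U x -> exists V g, [/\ open V, V x, Ck k V g &
     forall y, V y -> f y = g y]) -> Ck k U f.
Proof.
elim: k U f => [|k IH] U f H /=.
  move=> x /H [V [g [oV Vx /(_ x Vx) cg fg]]].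
  have fgn : \near x, g x = f x.
    by have := open_nbhs_nbhs (conj oV Vx); apply: filterS => y /fg.
  rewrite /continuous_at; apply: cvg_trans; first exact: near_eq_cvg fgn.
  by rewrite fg.
have H' x : U x -> exists V g, [/\ open V, V x, Ck k.+1 V g &
     forall y, V y -> differentiable f y /\ forall v, 'd f y v = 'd g y v].
  move=> /H [V [g [oV Vx Cg fg]]]; exists V, g; split => // y Vy.
  apply: near_eq_diff (Cg.1 _ Vy).
  by have := open_nbhs_nbhs (conj oV Vy); apply: filterS => z /fg.
split=> [x /H' [V [g [_ Vx _]]] /(_ _ Vx) []//|v].
apply: IH => x /H' [V [g [oV Vx [_ Cg] E]]].
exists V, (fun y => 'd g y v); split => //; [exact: Cg|by move=> y /E[]].
Qed.

Lemma Ck_sub k d (U V : set 'rV[K]_d) f : V `<=` U -> Ck k U f -> Ck k V f.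
Proof.
move=> VU; elim: k f => /= [|k IH] f; first by move=> + x /VU => /[apply].
by move=> [a b]; split => [x /VU/a|v]//; exact: IH.
Qed.

Lemma Ck_eq k d (U : set 'rV[K]_d) f g : open U ->
  (forall y, U y -> f y = g y) -> Ck k U g -> Ck k U f.
Proof. by move=> oU fg Cg; apply: Ck_local => x Ux; exists U, g. Qed.

Lemma Ck_W k d (U : set 'rV[K]_d) f : Ck k.+1 U f -> Ck k U f.
Proof.
elim: k f => /= [|k IH] f [a b].
  by move=> x /a; exact: differentiable_continuous.
by split => // v; exact/IH/b.
Qed.

Lemma Ck_cst k d (U : set 'rV[K]_d) c : Ck k U (fun=> c).
Proof.
elim: k c => /= [|k IH] c; first by move=> x _; exact: cst_continuous.
split=> [x _|v]; first exact: differentiable_cst.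
rewrite (_ : (fun _ => _) = fun=> 0); first exact: IH.
by apply/funext => x; rewrite diff_cst.
Qed.

Lemma diff_coord d i (x v : 'rV[K]_d) :
  'd (fun N : 'rV[K]_d => N 0 i : K) x v = v 0 i.
Proof.
have @f : {linear 'rV[K]_d -> K}.
  by exists (fun N : 'rV[K]_d => N 0 i); do 2![eexists]; do ?[constructor];
     rewrite ?mxE// => ? *; rewrite ?mxE//; move=> ?; rewrite !mxE.
by rewrite -[LHS]/('d f x v) diff_lin //; exact: coord_continuous.
Qed.

Lemma Ck_coord k d (U : set 'rV[K]_d) i : Ck k U (fun x => x 0 i).
Proof.
case: k => [|k] /=; first by move=> x _; exact: coord_continuous.
split=> [x _|v]; first exact: (@differentiable_coord K 1 d x 0 i).
rewrite (_ : (fun _ => _) = fun=> v 0 i); first exact: Ck_cst.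
by apply/funext => x; rewrite diff_coord.
Qed.

Lemma Ck_add k d (U : set 'rV[K]_d) f g : open U ->
  Ck k U f -> Ck k U g -> Ck k U (fun x => f x + g x).
Proof.
move=> oU; elim: k f g => /= [|k IH] f g.
  by move=> a b x Ux; apply: continuousD; [exact: a|exact: b].
move=> [a b] [a' b']; split=> [x Ux|v].
  by apply: differentiableD; [exact: a|exact: a'].
apply: (Ck_eq (g := fun x => 'd f x v + 'd g x v)) => //; last exact: IH.
move=> x Ux; rewrite -[LHS]/('d (f + g) x v) diffD //; [exact: a|exact: a'].
Qed.

Lemma Ck_sum k d (U : set 'rV[K]_d) n (f : 'I_n -> 'rV[K]_d -> K) : open U ->
  (forall i, Ck k U (f i)) -> Ck k U (fun x => \sum_i f i x).
Proof.
move=> oU; elim: n f => [|n IH] f Cf.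
  rewrite (_ : (fun _ => _) = fun=> 0); first exact: Ck_cst.
  by apply/funext => x; rewrite big_ord0.
rewrite (_ : (fun _ => _) =
  fun x => \sum_(i < n) f (widen_ord (leqnSn n) i) x + f ord_max x).
  by apply: Ck_add => //; exact: IH.
by apply/funext => x; rewrite big_ord_recr.
Qed.

Lemma Ck_mul k d (U : set 'rV[K]_d) f g : open U ->
  Ck k U f -> Ck k U g -> Ck k U (fun x => f x * g x).
Proof.
move=> oU; elim: k f g => /= [|k IH] f g.
  by move=> a b x Ux; apply: continuousM; [exact: a|exact: b].
move=> Cf Cg; have [a b] := Cf; have [a' b'] := Cg; split=> [x Ux|v].
  by apply: differentiableM; [exact: a|exact: a'].
apply: (Ck_eq (g := fun x => f x * 'd g x v + g x * 'd f x v)) => //.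
  move=> x Ux; rewrite -[LHS]/('d (f * g) x v) diffM //; [exact: a|exact: a'].
by apply: Ck_add => //; apply: IH => //; exact: Ck_W.
Qed.

Lemma differentiable_row d e (g : 'rV[K]_d -> 'rV[K]_e) x :
  (forall i, differentiable (fun y => g y 0 i) x) -> differentiable g x.
Proof.
move=> H.
have -> : g = \sum_i (fun y => g y 0 i *: delta_mx 0 i).
  by apply/funext => y; rewrite fct_sumE; exact: row_sum_delta.
apply: differentiable_sum => i.
exact: differentiableZl.
Qed.

Lemma diff_row d e (g : 'rV[K]_d -> 'rV[K]_e) x v i : differentiable g x ->
  'd (fun y => g y 0 i) x v = 'd g x v 0 i.
Proof.
move=> dg; pose f := fun N : 'rV[K]_e => N 0 i : K.
rewrite -[LHS]/('d (f \o g) x v) diff_comp //; last exact: differentiable_coord.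
by rewrite /= diff_coord.
Qed.

Lemma Ck_comp k d e (U : set 'rV[K]_d) (V : set 'rV[K]_e)
    (g : 'rV[K]_e -> 'rV[K]_d) f : open V -> (forall y, V y -> U (g y)) ->
  (forall i, Ck k V (fun y => g y 0 i)) -> Ck k U f -> Ck k V (f \o g).
Proof.
move=> oV VU; elim: k f => /= [|k IH] f Cg Cf.
  move=> x Vx; apply: continuous_comp; last exact/Cf/VU.
  move: Cg Vx => {Cf VU oV} Cg Vx.
  move=> A [P Pg PA].
  have : \forall y \near x, forall i, P 0 i (g y 0 i).
    apply: (@filter_forall _ _ (fun i y => P 0 i (g y 0 i)) (nbhs x)) => i.
    exact: (Cg i x Vx (P 0 i) (Pg 0 i)).
  by apply: filterS => y Py; apply: PA => j i; rewrite (ord1 j); exact: Py.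
have dg x : V x -> differentiable g x.
  by move=> Vx; apply: differentiable_row => i; case: (Cg i) => + _; apply.
split=> [x Vx|v].
  by apply: differentiable_comp; [exact: dg|exact/Cf.1/VU].
apply: (Ck_eq (g := fun y => \sum_i ('d (fun y => g y 0 i) y v *
                                ('d f (g y) (delta_mx 0 i))))) => //.
  move=> y Vy; rewrite diff_comp; [|exact: dg|exact/Cf.1/VU].
  rewrite /= [X in 'd f (g y) X = _]row_sum_delta linear_sum.
  by apply: eq_bigr => i _; rewrite linearZ /= diff_row //; exact: dg.
apply: Ck_sum => // i; apply: Ck_mul => //; first exact: (Cg i).2.
apply: (IH (fun z => 'd f z (delta_mx 0 i))); last exact: Cf.2.
by move=> j; exact/Ck_W/Cg.
Qed.

Lemma Cinfty_map_preim d e (V : set 'rV[K]_e) (W : set 'rV[K]_d)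
  (g : 'rV[K]_e -> 'rV[K]_d) : open V -> open W -> Cinfty_map V g ->
  open (V `&` g @^-1` W).
Proof.
move=> oV oW Cg; rewrite openE => y [Vy Wy].
apply: filterI; first exact: open_nbhs_nbhs.
have gc : {for y, continuous g}.
  apply: differentiable_continuous; apply: differentiable_row => j.
  by case: (Cg j 1%N) => + _; apply.
by apply: gc; exact: open_nbhs_nbhs.
Qed.
End Smooth.

(* A plot with domain the open set [U] is represented by a total function, of
   which only the restriction to [U] matters (see [plot_glue]). *)
Record dspace (K : realType) := DSpace {
  dcarrier :> Type;
  plot : forall d, set 'rV[K]_d -> ('rV[K]_d -> dcarrier) -> Prop;
  plot_open : forall d (U : set 'rV[K]_d) p, plot U p -> open U;
  plot_cst : forall d (U : set 'rV[K]_d) x, open U -> plot U (fun=> x);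
  plot_comp : forall d e (U : set 'rV[K]_d) (V : set 'rV[K]_e) p
    (g : 'rV[K]_e -> 'rV[K]_d), plot U p -> open V -> Cinfty_map V g ->
    (forall y, V y -> U (g y)) -> plot V (p \o g);
  plot_glue : forall d (U : set 'rV[K]_d) p, open U ->
    (forall x, U x -> exists V q, [/\ V x, plot V q &
       forall y, V y -> p y = q y]) -> plot U p
}.
Arguments plot {K} d [d0] U p : rename.

Section Spaces.
Variable K : realType.
Local Notation C := (complex K).
Local Notation dspace := (dspace K).

(** The diffeology on [T] whose plots are the maps that become smooth after
    composition with each of the real-valued functions [h i]. *)
Section Initial.
Variables (T I : Type) (h : I -> T -> K).

Definition initial_plot d (U : set 'rV[K]_d) (p : 'rV[K]_d -> T) :=
  open U /\ forall i, Cinfty U (h i \o p).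

Definition initialD : dspace.
Proof.
refine (@DSpace K T initial_plot _ _ _ _).
- by move=> d U p [].
- by move=> d U x oU; split=> // i k; exact: Ck_cst.
- move=> d e U V p g [oU Hp] oV Cg VU; split=> // i k.
  by apply: (Ck_comp (f := h i \o p) oV VU) => [j|]; [exact: Cg|exact: Hp].
- move=> d U p oU H; split=> // i k; apply: Ck_local => x /H[V [q]].
  move=> [Vx [oV Cq] pq]; exists V, (h i \o q); split => //; first exact: (Cq i k).
  by move=> y Vy /=; rewrite pq.
Defined.
End Initial.

Definition ptD : dspace := initialD (fun (i : void) (_ : unit) => 0).
Definition euclidD d : dspace := initialD (fun (i : 'I_d) (x : 'rV[K]_d) => x 0 i).
Definition ReIm (b : bool) (z : C) : K := if b then complex.Re z else complex.Im z.
Definition complexD : dspace := initialD ReIm.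
Definition matrixD m n : dspace :=
  initialD (fun (i : 'I_m * 'I_n * bool) (A : 'M[C]_(m, n)) =>
              ReIm i.2 (A i.1.1 i.1.2)).

Definition prodD (X Y : dspace) : dspace.
Proof.
refine (@DSpace K (X * Y)
  (fun d U p => plot X U (fst \o p) /\ plot Y U (snd \o p)) _ _ _ _).
- by move=> d U p [/plot_open].
- by move=> d U [x y] oU; split; exact: plot_cst.
- move=> d e U V p g [pX pY] oV Cg VU.
  by split; [exact: (plot_comp pX)|exact: (plot_comp pY)].
- move=> d U p oU H; split; apply: plot_glue => // x /H[V [q [Vx [qX qY] pq]]].
  + by exists V, (fst \o q); split => // y Vy /=; rewrite pq.
  + by exists V, (snd \o q); split => // y Vy /=; rewrite pq.
Defined.

Definition subD (X : dspace) (P : set X) : dspace.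
Proof.
refine (@DSpace K {x : X | P x} (fun d U p => plot X U (sval \o p)) _ _ _ _).
- by move=> d U p /plot_open.
- by move=> d U x oU; exact: plot_cst.
- by move=> d e U V p g pX oV Cg VU; exact: (plot_comp pX).
- move=> d U p oU H; apply: plot_glue => // x /H[V [q [Vx qX pq]]].
  by exists V, (sval \o q); split => // y Vy /=; rewrite pq.
Defined.

Definition sumD (I : Type) (X : I -> dspace) : dspace.
Proof.
refine (@DSpace K {i : I & X i} (fun d U p => open U /\
  forall x, U x -> exists V i q, [/\ V x, plot (X i) V q &
     forall y, V y -> p y = existT _ i (q y)]) _ _ _ _).
- by move=> d U p [].
- move=> d U [i a] oU; split=> // x Ux; exists U, i, (fun=> a); split => //.
  exact: plot_cst.
- move=> d e U V p g [oU H] oV Cg VU; split=> // x Vx.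
  have [W [i [q [Wx qX pq]]]] := H _ (VU _ Vx).
  have oW := plot_open qX.
  exists (V `&` g @^-1` W), i, (q \o g); split => //; last by move=> y [_ /pq].
  apply: (plot_comp qX) => [|j k|y []//]; first exact: Cinfty_map_preim.
  by apply: Ck_sub (Cg j k) => y [].
- move=> d U p oU H; split=> // x /H[V [q [Vx [oV Hq] pq]]].
  have [W [i [r [Wx rX qr]]]] := Hq _ Vx.
  exists (V `&` W), i, r; split => //; last by move=> y [Vy Wy]; rewrite pq ?qr.
  apply: (plot_comp (g := id) rX) => [|j k|y []//].
  + by apply: openI => //; exact: plot_open rX.
  + exact: Ck_coord.
Defined.

(** The quotient of [X] by [r]; its points are the subsets [r x]. *)
Section Quotient.
Variables (X : dspace) (r : X -> X -> Prop).

Definition quot := {A : set X | exists x, A = r x}.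
Definition quot_class (x : X) : quot := exist _ (r x) (ex_intro _ x erefl).
Definition quot_repr (a : quot) : X := sval (cid (svalP a)).

Lemma quot_reprK a : quot_class (quot_repr a) = a.
Proof.
case: a => A HA; apply: eq_exist; rewrite /quot_repr /=.
by case: cid.
Qed.

Definition quotD : dspace.
Proof.
refine (@DSpace K quot (fun d U p => open U /\
  forall x, U x -> exists V q, [/\ V x, plot X V q &
     forall y, V y -> p y = quot_class (q y)]) _ _ _ _).
- by move=> d U p [].
- move=> d U a oU; split=> // x Ux; exists U, (fun=> quot_repr a).
  by split => [//||y _]; [exact: plot_cst|rewrite quot_reprK].
- move=> d e U V p g [oU H] oV Cg VU; split=> // x Vx.
  have [W [q [Wx qX pq]]] := H _ (VU _ Vx).
  have oW := plot_open qX.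
  exists (V `&` g @^-1` W), (q \o g); split => //; last by move=> y [_ /pq].
  apply: (plot_comp qX) => [|j k|y []//]; first exact: Cinfty_map_preim.
  by apply: Ck_sub (Cg j k) => y [].
- move=> d U p oU H; split=> // x /H[V [q [Vx [oV Hq] pq]]].
  have [W [s [Wx sX qs]]] := Hq _ Vx.
  exists (V `&` W), s; split => //; last by move=> y [Vy Wy]; rewrite pq ?qs.
  apply: (plot_comp (g := id) sX) => [|j k|y []//].
  + by apply: openI => //; exact: plot_open sX.
  + exact: Ck_coord.
Defined.
End Quotient.
End Spaces.

Section Geometry.
Variable K : realType.
Local Notation C := (complex K).
Local Notation dspace := (dspace K).
Local Notation ptD := (ptD K).
Local Notation euclidD := (euclidD K).
Local Notation complexD := (complexD K).
Local Notation matrixD := (matrixD K).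

(** Smoothness on the subset [P] with its subset diffeology; the values of [f]
    outside [P] are irrelevant. *)
Definition smooth_on (X Y : dspace) (P : set X) (f : X -> Y) :=
  forall d (U : set 'rV[K]_d) p, plot X U p -> (forall x, U x -> P (p x)) ->
  plot Y U (f \o p).

Definition smooth (X Y : dspace) (f : X -> Y) := smooth_on setT f.

(** The D-topology; on a manifold it is the manifold topology. *)
Definition D_open (X : dspace) (A : set X) :=
  forall d (U : set 'rV[K]_d) p, plot X U p -> open (U `&` p @^-1` A).

Definition diffeo_on (X Y : dspace) (P : set X) (Q : set Y) (f : X -> Y) :=
  exists g : Y -> X, [/\ smooth_on P f, smooth_on Q g,
    forall x, P x -> Q (f x) /\ g (f x) = x &
    forall y, Q y -> P (g y) /\ f (g y) = y].

(** Inverse charts: [phi] parametrises an open subset of [X] by [U]. *)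
Definition is_chart (X : dspace) d (U : set 'rV[K]_d) (phi : 'rV[K]_d -> X) :=
  [/\ open U, D_open (phi @` U) & diffeo_on (X := euclidD d) U (phi @` U) phi].

Record is_manifold (X : dspace) : Prop := {
  manifold_hausdorff : forall x y : X, x <> y -> exists A B : set X,
    [/\ D_open A, D_open B, A x, B y & A `&` B = set0];
  manifold_second_countable : exists B : nat -> set X,
    (forall k, D_open (B k)) /\
    (forall A x, D_open A -> A x -> exists k, B k x /\ B k `<=` A);
  manifold_chart : forall x : X, exists d (U : set 'rV[K]_d) phi u,
    [/\ is_chart U phi, U u & phi u = x]
}.

(** In suitable charts [f] is a map [g] whose differential at the given point is
    onto. *)
Definition submersion (X Y : dspace) (f : X -> Y) := forall x : X,
  exists d (U : set 'rV[K]_d) (phi : 'rV[K]_d -> X) u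
         e (V : set 'rV[K]_e) (psi : 'rV[K]_e -> Y) (g : 'rV[K]_d -> 'rV[K]_e),
  [/\ is_chart U phi, U u, phi u = x & is_chart V psi] /\
  [/\ (forall w, U w -> V (g w) /\ f (phi w) = psi (g w)),
      differentiable g u & forall y, exists v, 'd g u v = y].

(** Raw data of a groupoid with space of objects [M].  The product [g h] is
    meaningful when [src g = tgt h], and arbitrary otherwise.  Identities and
    inverses are determined by the product; they appear in [is_lie_groupoid]. *)
Record groupoid (M : dspace) := Groupoid {
  arr :> dspace;
  src : arr -> M;
  tgt : arr -> M;
  mul : arr -> arr -> arr
}.
Arguments Groupoid {M} arr src tgt mul.

Definition is_identity (M : dspace) (G : groupoid M) (m : M) (e : G) :=
  [/\ src e = m, tgt e = m, (forall g, tgt g = m -> mul e g = g) &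
      (forall g, src g = m -> mul g e = g)].

Record is_lie_groupoid (M : dspace) (G : groupoid M) : Prop := {
  lie_objects : is_manifold M;
  lie_arrows : is_manifold G;
  lie_src : smooth (@src M G) /\ submersion (@src M G);
  lie_tgt : smooth (@tgt M G) /\ submersion (@tgt M G);
  lie_mul_src : forall g h : G, src g = tgt h -> src (mul g h) = src h;
  lie_mul_tgt : forall g h : G, src g = tgt h -> tgt (mul g h) = tgt g;
  lie_mulA : forall g h k : G, src g = tgt h -> src h = tgt k ->
    mul g (mul h k) = mul (mul g h) k;
  lie_mul_smooth : smooth_on (X := prodD G G) [set x | src x.1 = tgt x.2]
    (fun x => mul x.1 x.2);
  lie_one : exists one : M -> G, smooth one /\ forall m, is_identity m (one m);
  lie_inv : exists inv : G -> G, smooth inv /\ forall g,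
    [/\ src (inv g) = tgt g, tgt (inv g) = src g,
        is_identity (tgt g) (mul g (inv g)) & is_identity (src g) (mul (inv g) g)]
}.

(** [x] as an element of the subtype, with a default value used only when [x]
    does not satisfy [P]. *)
Definition sub_of T (P : set T) (x0 : {x : T | P x}) (x : T) : {x : T | P x} :=
  if pselect (P x) is left Px then exist _ x Px else x0.

(** The pull-back along [f : N -> M]: arrows are the [(y1, y2, g)] with
    [tgt g = f y1] and [src g = f y2]. *)
Definition pullback_arr (N M : dspace) (f : N -> M) (G : groupoid M) : dspace :=
  @subD K (prodD (prodD N N) G)
    [set x | tgt x.2 = f x.1.1 /\ src x.2 = f x.1.2].

Definition pullback (N M : dspace) (f : N -> M) (G : groupoid M) : groupoid N :=
  Groupoid (pullback_arr f G)
    (fun x => (sval x).1.2) (fun x => (sval x).1.1)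
    (fun x y => sub_of x
       ((sval x).1.1, (sval y).1.2, mul (sval x).2 (sval y).2)).

(** Disjoint unions of open subsets are manifolds only for countable families,
    hence the countable index set. *)
Definition is_open_cover (M : dspace) (I : Type) (U : I -> set M) :=
  [/\ countable [set: I], (forall i, D_open (U i)) &
      (forall m, exists i, U i m)].

Definition cover_space (M : dspace) (I : Type) (U : I -> set M) : dspace :=
  sumD (fun i => subD (U i)).

Definition cover_map (M : dspace) (I : Type) (U : I -> set M)
  (x : cover_space U) : M := sval (projT2 x).

Definition circle : set C := [set z | `|z| = 1].
(** For [0 < n], the group Z/n inside the circle; its subset diffeology is
    discrete. *)
Definition mu (n : nat) : set C := [set z | z ^+ n = 1].
Definition circleD : dspace := @subD K complexD circle.

(** Raw data: the action is indexed by all complex numbers, but only the action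
    of the structure group [A] of [is_central_extension] is meaningful. *)
Record extension (M : dspace) (G : groupoid M) := Extension {
  etot :> groupoid M;
  eproj : etot -> G;
  eact : C -> etot -> etot;
  eproj_src : forall r, src (eproj r) = src r;
  eproj_tgt : forall r, tgt (eproj r) = tgt r
}.
Arguments Extension {M G} etot eproj eact _ _.

Record is_central_extension (A : set C) (M : dspace) (G : groupoid M)
    (E : extension G) : Prop := {
  ext_lie : is_lie_groupoid E;
  ext_proj_smooth : smooth (@eproj M G E);
  ext_proj_mul : forall r s : E, src r = tgt s ->
    eproj (mul r s) = mul (eproj r) (eproj s);
  ext_act_smooth : smooth_on (X := prodD complexD E) [set x | A x.1]
    (fun x => eact x.1 x.2);
  ext_act1 : forall r : E, eact 1 r = r;
  ext_actM : forall a b (r : E), A a -> A b -> eact (a * b) r = eact a (eact b r);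
  ext_act_proj : forall a (r : E), A a -> eproj (eact a r) = eproj r;
  ext_principal : forall g : G, exists (V : set G) (sigma : G -> E),
    [/\ D_open V, V g, smooth_on V sigma,
        (forall h, V h -> eproj (sigma h) = h) &
        diffeo_on (X := prodD complexD G)
          [set x | A x.1 /\ V x.2] [set r | V (eproj r)]
          (fun x => eact x.1 (sigma x.2))];
  ext_central : forall a b (r s : E), A a -> A b -> src r = tgt s ->
    mul (eact a r) (eact b s) = eact (a * b) (mul r s)
}.

Definition ext_isomorphic (M : dspace) (G : groupoid M) (E F : extension G) :=
  exists f : E -> F,
  [/\ diffeo_on setT setT f,
      (forall r, eproj (f r) = eproj r),
      (forall r s, src r = tgt s -> f (mul r s) = mul (f r) (f s)) &
      (forall a r, circle a -> f (eact a r) = eact a (f r))].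

Definition trivial_ext (M : dspace) (G : groupoid M) : extension G :=
  Extension
    (Groupoid (prodD G circleD) (fun x => src x.1) (fun x => tgt x.1)
       (fun x y => (mul x.1 y.1, sub_of x.2 (sval x.2 * sval y.2))))
    fst (fun a x => (x.1, sub_of x.2 (a * sval x.2)))
    (fun=> erefl) (fun=> erefl).

Section PullbackExtension.
Variables (N M : dspace) (f : N -> M) (G : groupoid M) (E : extension G).

Lemma pullback_proj_subproof (x : pullback f E) :
  tgt (eproj (sval x).2) = f (sval x).1.1 /\
  src (eproj (sval x).2) = f (sval x).1.2.
Proof. by rewrite eproj_tgt eproj_src; exact: (svalP x). Qed.

Definition pullback_proj (x : pullback f E) : pullback f G :=
  exist _ ((sval x).1, eproj (sval x).2) (pullback_proj_subproof x).

Definition pullback_ext : extension (pullback f G) :=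
  @Extension _ (pullback f G) (pullback f E) pullback_proj
    (fun a x => sub_of x ((sval x).1, eact a (sval x).2))
    (fun=> erefl) (fun=> erefl).
End PullbackExtension.

(** The tensor product [(E x_G F) / S^1]; operations on classes are computed on
    representatives. *)
Section Tensor.
Variables (M : dspace) (G : groupoid M) (E F : extension G).

Definition tensor_pre : dspace :=
  @subD K (prodD E F) [set x | eproj x.1 = eproj x.2].

Definition tensor_rel (x y : tensor_pre) : Prop := exists a, circle a /\
  sval y = (eact a (sval x).1, eact a^-1 (sval x).2).

Local Notation rep a := (sval (quot_repr (a : quot tensor_rel))).

Definition tensor_groupoid : groupoid M :=
  Groupoid (quotD tensor_rel)
    (fun a => src (rep a).1) (fun a => tgt (rep a).1)
    (fun a b => quot_class tensor_rel (sub_of (quot_repr a)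
       (mul (rep a).1 (rep b).1, mul (rep a).2 (rep b).2))).

Definition tensor : extension G :=
  @Extension _ G tensor_groupoid
    (fun a => eproj (rep a).1)
    (fun c a => quot_class tensor_rel (sub_of (quot_repr a)
       (eact c (rep a).1, (rep a).2)))
    (fun a => eproj_src (rep a).1) (fun a => eproj_tgt (rep a).1).
End Tensor.

(** The tensor power with [k.+1] factors. *)
Fixpoint tensor_succ (M : dspace) (G : groupoid M) (E : extension G) (k : nat) :
  extension G := if k is k'.+1 then tensor (tensor_succ E k') E else E.

(** The extension [E x_{mu_n} S^1] induced by a [mu_n]-extension [E]:
    [(zeta r, l)] is identified with [(r, zeta l)]. *)
Section Induced.
Variables (n : nat) (M : dspace) (G : groupoid M) (E : extension G).

Definition induced_rel (x y : prodD E circleD) : Prop := exists z, mu n z /\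
  (y.1 = eact z x.1 /\ sval y.2 = z^-1 * sval x.2).

Local Notation rep a := (quot_repr (a : quot induced_rel)).

Definition induced_groupoid : groupoid M :=
  Groupoid (quotD induced_rel)
    (fun a => src (rep a).1) (fun a => tgt (rep a).1)
    (fun a b => quot_class induced_rel
       (mul (rep a).1 (rep b).1,
        sub_of (rep a).2 (sval (rep a).2 * sval (rep b).2))).

Definition induced_ext : extension G :=
  @Extension _ G induced_groupoid
    (fun a => eproj (rep a).1)
    (fun c a => quot_class induced_rel
       ((rep a).1, sub_of (rep a).2 (c * sval (rep a).2)))
    (fun a => eproj_src (rep a).1) (fun a => eproj_tgt (rep a).1).
End Induced.

Definition strictly_trivial (M : dspace) (G : groupoid M) (E : extension G) :=
  ext_isomorphic E (trivial_ext G).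

Definition is_trivial (M : dspace) (G : groupoid M) (E : extension G) :=
  exists (I : Type) (U : I -> set M), is_open_cover U /\
    strictly_trivial (pullback_ext (@cover_map M I U) E).

(** Addition is meaningful for two vectors of the same fibre. *)
Record vbundle (M : dspace) := VBundle {
  vtot :> dspace;
  vproj : vtot -> M;
  vadd : vtot -> vtot -> vtot;
  vscale : C -> vtot -> vtot
}.

(** The vector space axioms in the fibres follow from the local
    trivialisations. *)
Record is_vbundle (n : nat) (M : dspace) (E : vbundle M) : Prop := {
  vb_manifold : is_manifold E;
  vb_proj_smooth : smooth (@vproj M E);
  vb_add_proj : forall x y : E, vproj x = vproj y -> vproj (vadd x y) = vproj x;
  vb_scale_proj : forall c (x : E), vproj (vscale c x) = vproj x;
  vb_trivial : forall m : M, exists (V : set M) (phi : E -> matrixD n 1),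
    [/\ D_open V, V m,
        diffeo_on (Y := prodD M (matrixD n 1))
          [set x | V (vproj x)] [set y | V y.1] (fun x => (vproj x, phi x)),
        (forall x y, V (vproj x) -> vproj x = vproj y ->
           phi (vadd x y) = phi x + phi y) &
        (forall c x, V (vproj x) -> phi (vscale c x) = c *: phi x)]
}.

Record is_twisted_action (M : dspace) (G : groupoid M) (R : extension G)
    (E : vbundle M) (act : R -> E -> E) : Prop := {
  tw_smooth : smooth_on (X := prodD R E) [set x | src x.1 = vproj x.2]
    (fun x => act x.1 x.2);
  tw_proj : forall r x, src r = vproj x -> vproj (act r x) = tgt r;
  tw_one : forall r x, is_identity (vproj x) r -> act r x = x;
  tw_mul : forall r s x, src r = tgt s -> src s = vproj x ->
    act (mul r s) x = act r (act s x);
  tw_add : forall r x y, src r = vproj x -> vproj x = vproj y ->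
    act r (vadd x y) = vadd (act r x) (act r y);
  tw_scale : forall r c x, src r = vproj x ->
    act r (vscale c x) = vscale c (act r x);
  tw_twisted : forall a r x, circle a -> src r = vproj x ->
    act (eact a r) x = vscale a (act r x)
}.

Definition has_twisted_vbundle (M : dspace) (G : groupoid M) (R : extension G)
    (n : nat) :=
  exists (E : vbundle M) (act : R -> E -> E),
    is_vbundle n E /\ is_twisted_action act.

Record genhom (M1 M2 : dspace) (G1 : groupoid M1) (G2 : groupoid M2) := GenHom {
  gtot :> dspace;
  gl : gtot -> M1;
  gr : gtot -> M2;
  gactl : G1 -> gtot -> gtot;
  gactr : gtot -> G2 -> gtot
}.

Record is_genhom (M1 M2 : dspace) (G1 : groupoid M1) (G2 : groupoid M2)
    (Z : genhom G1 G2) : Prop := {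
  gh_manifold : is_manifold Z;
  gh_l_smooth : smooth (@gl M1 M2 G1 G2 Z);
  gh_r_smooth : smooth (@gr M1 M2 G1 G2 Z);
  gh_actl_smooth : smooth_on (X := prodD G1 Z) [set x | src x.1 = gl x.2]
    (fun x => gactl x.1 x.2);
  gh_actl_l : forall g (z : Z), src g = gl z -> gl (gactl g z) = tgt g;
  gh_actl_r : forall g (z : Z), src g = gl z -> gr (gactl g z) = gr z;
  gh_actl_one : forall g (z : Z), is_identity (gl z) g -> gactl g z = z;
  gh_actl_mul : forall g h (z : Z), src g = tgt h -> src h = gl z ->
    gactl (mul g h) z = gactl g (gactl h z);
  gh_actr_smooth : smooth_on (X := prodD Z G2) [set x | gr x.1 = tgt x.2]
    (fun x => gactr x.1 x.2);
  gh_actr_l : forall (z : Z) h, gr z = tgt h -> gl (gactr z h) = gl z;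
  gh_actr_r : forall (z : Z) h, gr z = tgt h -> gr (gactr z h) = src h;
  gh_actr_one : forall (z : Z) h, is_identity (gr z) h -> gactr z h = z;
  gh_actr_mul : forall (z : Z) g h, gr z = tgt g -> src g = tgt h ->
    gactr z (mul g h) = gactr (gactr z g) h;
  gh_commute : forall g (z : Z) h, src g = gl z -> gr z = tgt h ->
    gactr (gactl g z) h = gactl g (gactr z h);
  gh_principal : forall m : M1, exists (V : set M1) (sigma : M1 -> Z),
    [/\ D_open V, V m, smooth_on V sigma,
        (forall x, V x -> gl (sigma x) = x) &
        diffeo_on (X := prodD M1 G2)
          [set x | V x.1 /\ gr (sigma x.1) = tgt x.2] [set z | V (gl z)]
          (fun x => gactr (sigma x.1) x.2)]
}.

(** Only the circle actions [act1] and [act2] on the two groupoids enter, not the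
    quotient groupoids; so for [GL_n(C)] it is harmless that the kernel of
    [GL_n(C) -> PGL_n(C)] is [C^*] rather than the circle. *)
Record is_equivariant (M1 M2 : dspace) (G1 : groupoid M1) (G2 : groupoid M2)
    (act1 : C -> G1 -> G1) (act2 : C -> G2 -> G2)
    (Z : genhom G1 G2) (act : C -> Z -> Z) : Prop := {
  eq_smooth : smooth_on (X := prodD complexD Z) [set x | circle x.1]
    (fun x => act x.1 x.2);
  eq_one : forall z, act 1 z = z;
  eq_mul : forall a b z, circle a -> circle b -> act (a * b) z = act a (act b z);
  eq_gl : forall a z, circle a -> gl (act a z) = gl z;
  eq_gr : forall a z, circle a -> gr (act a z) = gr z;
  eq_left : forall a g z h, circle a -> src g = gl z -> gr z = tgt h ->
    gactr (gactl (act1 a g) z) h = gactr (gactl g (act a z)) h;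
  eq_right : forall a g z h, circle a -> src g = gl z -> gr z = tgt h ->
    gactr (gactl g (act a z)) h = gactr (gactl g z) (act2 a h)
}.

Definition GLD (n : nat) : dspace :=
  @subD K (matrixD n n) [set A | A \in unitmx].

Definition GL (n : nat) : groupoid ptD :=
  @Groupoid ptD (GLD n) (fun=> tt) (fun=> tt)
    (fun A B => sub_of A (sval A *m sval B)).

Definition GL_act (n : nat) (a : C) (A : GL n) : GL n := sub_of A (a *: sval A).

Definition has_equivariant_genhom (M : dspace) (G : groupoid M)
    (R : extension G) (n : nat) :=
  exists (Z : genhom R (GL n)) (act : C -> Z -> Z),
    is_genhom Z /\ is_equivariant (@eact M G R) (@GL_act n) act.

Definition has_degree_hom (M : dspace) (G : groupoid M) (R : extension G)
    (n : nat) :=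
  exists (I : Type) (U : I -> set M), is_open_cover U /\
  let RU := pullback_ext (@cover_map M I U) R in
  exists psi : RU -> complexD,
    [/\ smooth psi, (forall r, psi r != 0 :> C),
        (forall r s, src r = tgt s -> psi (mul r s) = (psi r : C) * psi s) &
        (forall a r, circle a -> psi (eact a r) = a ^+ n * (psi r : C))].

Definition has_mu_reduction (M : dspace) (G : groupoid M) (R : extension G)
    (n : nat) :=
  exists (I : Type) (U : I -> set M), is_open_cover U /\
  let f := @cover_map M I U in
  exists R' : extension (pullback f G),
    is_central_extension (mu n) R' /\
    ext_isomorphic (pullback_ext f R) (induced_ext n R').
End Geometry.

(* Main.v *)
(* A twisted bundle E gives the bundle Z of frames C^n -> E_m, on which R acts on
   the left and GL_n on the right; conversely Z gives E = (Z x C^n) / GL_n. Local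
   sections s_i of Z turn R into a GL_n-valued cocycle,
   r . s_j(src r) = s_i(tgt r) . phi(r), and psi = det phi has degree n.

   The diagonal r |-> [r, ..., r] into the n-th tensor power is equivariant of
   degree n and covers the identity of Gamma. Hence a trivialisation of the power
   restricts to a psi of degree n, and conversely lam [r, ..., r] |->
   lam psi(r) / |psi(r)| is a trivialisation.

   Given psi, the elements with psi > 0 form a mu_n-extension R' (local sections
   come from local n-th roots), and R is R' x_{mu_n} S^1. R' is a Lie groupoid
   because it is locally diffeomorphic to Gamma. Conversely [r', l] |-> l^n has
   degree n. *)
From HB Require Import structures.
From mathcomp Require Import all_boot all_order all_algebra.
From mathcomp Require Import ring.
From mathcomp Require Import complex.
From mathcomp Require Import all_classical all_reals topology normedtype landau.
From mathcomp Require Import derive trigo realfun interval_inference.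
Require Import Defs.
Import numFieldNormedType.Exports.
Import Order.TTheory GRing.Theory Num.Theory.
Set Implicit Arguments.
Unset Strict Implicit.
Unset Printing Implicit Defensive.
Local Open Scope classical_set_scope.
Local Open Scope ring_scope.

(** * Smooth functions of one variable *)

Section RealSmooth.
Variable K : realType.
Implicit Types (k d : nat).

(** The obstacle is the charts. Quotients and fibre products exist freely as diffeological spaces,
    but [is_central_extension], [is_vbundle] and [is_genhom] ask for manifolds. Triviality is an
    isomorphism of raw extensions, so tensor powers and pulled-back extensions are treated as
    [weak_extension]s and never receive charts. Charts are built only for the kernel of psi, the
    frame bundle, the associated bundle and the groupoids and spaces under them; each is covered by
    countably many open sets diffeomorphic to open sets of a known manifold, the countability coming
    from a Lindelöf argument. Operations on quotients are computed on representatives chosen without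
    any smoothness. Smoothness is recovered because plots of a quotient lift locally and the
    operations do not depend on the representative. The function psi takes values in C^*, while the
    fibres are circles, hence the passage to psi / |psi|: the modulus is a homomorphism to the
    positive reals that is invariant under the circle, so nothing of the degree is lost. *)

Lemma diff_comp1 d (phi : K -> K) (f : 'rV[K]_d -> K) x (a : K) :
  is_derive (f x : K^o) (1 : K^o) (phi : K^o -> K^o) a -> differentiable f x ->
  differentiable (phi \o f) x /\ forall v, 'd (phi \o f) x v = a * 'd f x v.
Proof.
move=> phia df; have dphi : differentiable phi (f x).
  by apply/derivable1_diffP; exact: ex_derive.
split; first exact: differentiable_comp.
move=> v; rewrite diff_comp //= diff1E // derive1E.
by rewrite derive_val mulrC.
Qed.

(* Induction on [k]: the derivative [phi' (f x) * 'd f x v] is as smooth as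
   [phi \o f] and [f] allow, which gains one order of differentiability. *)
Lemma Ck_comp1 k d (U : set 'rV[K]_d) (phi phi' : K -> K) f : open U ->
  (forall x, U x ->
     is_derive (f x : K^o) (1 : K^o) (phi : K^o -> K^o) (phi' (f x))) ->
  (forall j, Ck j U (phi \o f) -> Ck j U f -> Ck j U (phi' \o f)) ->
  Ck k U f -> Ck k U (phi \o f).
Proof.
move=> oU Hd Hphi; elim: k => [|k IH] Cf.
  move=> x Ux; apply: continuous_comp; first exact: Cf.
  apply: differentiable_continuous; apply/derivable1_diffP.
  exact: (@ex_derive _ _ _ _ _ _ _ (Hd x Ux)).
have [df Cdf] := Cf; have D x (Ux : U x) := diff_comp1 (Hd x Ux) (df x Ux).
split=> [x Ux|v]; first by case: (D x Ux).
apply: (@Ck_eq K k d U _ (fun x => (phi' \o f) x * 'd f x v)) => //.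
  by move=> y Uy; case: (D y Uy) => _ /(_ v).
apply: Ck_mul; [by []| |exact: Cdf].
by apply: Hphi; [apply: IH|]; exact: Ck_W.
Qed.

Lemma Ck_opp k d (U : set 'rV[K]_d) f : open U ->
  Ck k U f -> Ck k U (fun x => - f x).
Proof.
move=> oU Cf; rewrite (_ : (fun _ => _) = fun x => -1 * f x).
  by apply: Ck_mul => //; exact: Ck_cst.
by apply/funext => x; rewrite mulN1r.
Qed.

Lemma Ck_inv k d (U : set 'rV[K]_d) f : open U ->
  (forall x, U x -> f x != 0) -> Ck k U f -> Ck k U (fun x => (f x)^-1).
Proof.
move=> oU f0 Cf; apply: (@Ck_comp1 k d U (fun y => y^-1)
    (fun y => - (y^-1 * y^-1))) => // [x Ux|j Cj _]; last first.
  by apply: Ck_opp => //; apply: Ck_mul.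
have H := @is_deriveV K id (f x) 1 1 (f0 x Ux) (is_derive_id _ _).
apply: is_derive_eq H _.
by rewrite /GRing.scale /= mulr1 -exprVn expr2.
Qed.

Lemma Ck_sqrt k d (U : set 'rV[K]_d) f : open U ->
  (forall x, U x -> 0 < f x) -> Ck k U f -> Ck k U (fun x => Num.sqrt (f x)).
Proof.
move=> oU f0 Cf; apply: (@Ck_comp1 k d U Num.sqrt
    (fun y => (2 * Num.sqrt y)^-1)) => // [x Ux|j Cj _].
  exact/is_derive1_sqrt/f0.
apply: Ck_inv => // [x Ux|].
  by rewrite mulf_neq0 ?pnatr_eq0 // gt_eqF // sqrtr_gt0 f0.
by apply: Ck_mul => //; exact: Ck_cst.
Qed.

Lemma Ck_atan k d (U : set 'rV[K]_d) f : open U ->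
  Ck k U f -> Ck k U (fun x => atan (f x)).
Proof.
move=> oU Cf; apply: (@Ck_comp1 k d U atan
    (fun y => (1 + y ^+ 2)^-1)) => // j _ Cj.
apply: Ck_inv => // [x Ux|].
  by rewrite gt_eqF // ltr_wpDr // sqr_ge0.
by apply: Ck_add => //; [exact: Ck_cst|apply: Ck_mul].
Qed.

(** Each derivative is the other function up to sign, so the induction on the order has to carry
    both at once. *)
Lemma Ck_cos_sin k d (U : set 'rV[K]_d) f : open U -> Ck k U f ->
  Ck k U (fun x => cos (f x)) /\ Ck k U (fun x => sin (f x)).
Proof.
move=> oU; elim: k => [|k IH] Cf.
  by split=> x Ux; apply: continuous_comp; [exact: Cf|exact: continuous_cos|
    exact: Cf|exact: continuous_sin].
have [Cc Cs] := IH (Ck_W Cf); have [df Cdf] := Cf.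
have D x (Ux : U x) := diff_comp1 (is_derive_cos (f x)) (df x Ux).
have D' x (Ux : U x) := diff_comp1 (is_derive_sin (f x)) (df x Ux).
split; split=> [x Ux|v].
- by case: (D x Ux).
- apply: (@Ck_eq K k d U _ (fun x => - sin (f x) * 'd f x v)) => //.
    by move=> y Uy; case: (D y Uy) => _ /(_ v).
  by apply: Ck_mul; [by []|exact: Ck_opp|exact: Cdf].
- by case: (D' x Ux).
- apply: (@Ck_eq K k d U _ (fun x => cos (f x) * 'd f x v)) => //.
    by move=> y Uy; case: (D' y Uy) => _ /(_ v).
  by apply: Ck_mul; [by []|by []|exact: Cdf].
Qed.

Lemma Cinfty_continuous d (U : set 'rV[K]_d) f :
  Cinfty U f -> forall x, U x -> {for x, continuous f}.
Proof. by move=> /(_ 0%N). Qed.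

Lemma Cinfty_open_gt0 d (U : set 'rV[K]_d) f : open U -> Cinfty U f ->
  open (U `&` [set x | 0 < f x]).
Proof.
move=> oU Cf; rewrite openE => x [Ux fx].
apply: filterI; first exact: open_nbhs_nbhs.
have cf : f @ x --> f x := Cinfty_continuous Cf Ux.
apply: (cf [set y | 0 < y]).
exact: (open_nbhs_nbhs (conj (@open_gt K 0) fx)).
Qed.
End RealSmooth.

(** * Diffeological spaces *)

Section Diffeology.
Variable K : realType.
Local Notation C := (complex K).
Local Notation dspace := (dspace K).
Local Notation complexD := (complexD K).
Local Notation matrixD := (matrixD K).
Implicit Types X Y Z : dspace.

(** Only the restriction of a plot to its domain matters. This lets values given through [sub_of], a
    choice or a representative be replaced by a formula that is valid on [U] only. *)
Lemma plot_eq X d (U : set 'rV[K]_d) (p q : 'rV[K]_d -> X) :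
  (forall u, U u -> p u = q u) -> plot X U q -> plot X U p.
Proof.
move=> pq Hq; apply: plot_glue; first exact: plot_open Hq.
by move=> u Uu; exists U, q.
Qed.

Lemma plot_sub X d (U V : set 'rV[K]_d) (p : 'rV[K]_d -> X) :
  open V -> V `<=` U -> plot X U p -> plot X V p.
Proof.
move=> oV VU Hp; apply: (plot_comp (g := id) Hp) => // i k.
exact: Ck_coord.
Qed.

Lemma plot_local X d (U : set 'rV[K]_d) (p : 'rV[K]_d -> X) : open U ->
  (forall u, U u -> exists2 V, V u & plot X V p) -> plot X U p.
Proof.
by move=> oU H; apply: plot_glue => // u /H[V Vu Hp]; exists V, p.
Qed.

Lemma smooth_on_sub X Y (P Q : set X) (f : X -> Y) :
  P `<=` Q -> smooth_on Q f -> smooth_on P f.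
Proof. by move=> PQ Hf d U p Hp HP; apply: Hf => // x /HP /PQ. Qed.

Lemma smooth_onT X Y (P : set X) (f : X -> Y) : smooth f -> smooth_on P f.
Proof. exact: smooth_on_sub. Qed.

Lemma smooth_on_comp X Y Z (P : set X) (Q : set Y) (f : X -> Y) (g : Y -> Z) :
  smooth_on P f -> smooth_on Q g -> (forall x, P x -> Q (f x)) ->
  smooth_on P (g \o f).
Proof.
move=> Hf Hg PQ d U p Hp HP; apply: (Hg d U (f \o p)); first exact: Hf.
by move=> u /HP /PQ.
Qed.

Lemma smooth_on_pair X Y Z (P : set X) (f : X -> Y) (g : X -> Z) :
  smooth_on P f -> smooth_on P g ->
  smooth_on (Y := prodD Y Z) P (fun x => (f x, g x)).
Proof. by move=> Hf Hg d U p Hp HP; split; [exact: Hf|exact: Hg]. Qed.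

Lemma smooth_fst X Y : smooth (X := prodD X Y) (@fst X Y).
Proof. by move=> d U p [Hp _] _. Qed.

Lemma smooth_snd X Y : smooth (X := prodD X Y) (@snd X Y).
Proof. by move=> d U p [_ Hp] _. Qed.

Lemma smooth_cst X Y (P : set X) (y : Y) : smooth_on P (fun=> y).
Proof. by move=> d U p Hp _; apply: plot_cst; exact: plot_open Hp. Qed.

Lemma sub_ofE T (P : set T) x0 x : P x -> sval (@sub_of T P x0 x) = x.
Proof. by rewrite /sub_of; case: pselect. Qed.

Lemma sval_inj T (P : set T) : injective (@sval T P).
Proof. by move=> [x Px] [y Py] /= xy; apply: eq_exist. Qed.

Lemma D_openT X : D_open (X := X) setT.
Proof. by move=> d U p /plot_open; rewrite preimage_setT setIT. Qed.

Lemma D_openI X (A B : set X) : D_open A -> D_open B -> D_open (A `&` B).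
Proof.
move=> oA oB d U p Hp; rewrite preimage_setI -(setIid U) setIACA.
by apply: openI; [exact: oA|exact: oB].
Qed.

Lemma D_open_bigcup X (I : Type) (D : set I) (A : I -> set X) :
  (forall i, D i -> D_open (A i)) -> D_open (\bigcup_(i in D) A i).
Proof.
move=> oA d U p Hp; rewrite preimage_bigcup setI_bigcupr.
by apply: bigcup_open => i Di; exact: oA.
Qed.

Lemma D_open_preim X Y (A : set X) (B : set Y) (f : X -> Y) :
  D_open A -> smooth_on A f -> D_open B -> D_open (A `&` f @^-1` B).
Proof.
move=> oA Hf oB d U p Hp; have oUA := oA d U p Hp.
rewrite preimage_setI setIA; apply: (oB d _ (f \o p)).
by apply: Hf => [|u []//]; apply: plot_sub Hp.
Qed.

Lemma D_open_preimT X Y (B : set Y) (f : X -> Y) :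
  smooth f -> D_open B -> D_open (f @^-1` B).
Proof.
by move=> Hf oB; rewrite -[_ @^-1` _]setTI; apply: D_open_preim => //; exact: D_openT.
Qed.

Lemma open_D_open d (W : set 'rV[K]_d) : open W -> D_open (X := euclidD K d) W.
Proof.
move=> oW e U p [oU Hp]; exact: Cinfty_map_preim.
Qed.

Lemma plot_id d (U : set 'rV[K]_d) : open U -> plot (euclidD K d) U id.
Proof. by move=> oU; split => // i k; exact: Ck_coord. Qed.

(** Turns an inverse chart, which is given as a smooth map, into a plot, so that D-open sets can be
    tested on it. *)
Lemma smooth_on_plot X d (U : set 'rV[K]_d) (p : 'rV[K]_d -> X) :
  open U -> smooth_on (X := euclidD K d) U p <-> plot X U p.
Proof.
move=> oU; split=> [Hp|Hp e V g [oV Hg] VU].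
  by have := Hp d U id (plot_id oU); apply.
exact: (plot_comp Hp).
Qed.

Lemma plot_prod_fst X Y d (U : set 'rV[K]_d) (p : 'rV[K]_d -> prodD X Y) :
  plot (prodD X Y) U p -> plot X U (fun u => (p u).1).
Proof. by case. Qed.

Lemma plot_prod_snd X Y d (U : set 'rV[K]_d) (p : 'rV[K]_d -> prodD X Y) :
  plot (prodD X Y) U p -> plot Y U (fun u => (p u).2).
Proof. by case. Qed.

(** * Smooth operations on complex numbers and matrices *)

Section ComplexPlots.
Variables (d : nat) (U : set 'rV[K]_d).
Implicit Types p q : 'rV[K]_d -> C.

Lemma plot_complexP p : plot complexD U p <->
  [/\ open U, Cinfty U (fun u => complex.Re (p u)) &
      Cinfty U (fun u => complex.Im (p u))].
Proof.
split=> [[oU H]|[oU HR HI]]; first by split=> //; [exact: (H true)|exact: (H false)].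
by split=> // -[].
Qed.

Lemma plot_cadd p q : plot complexD U p -> plot complexD U q ->
  plot complexD U (fun u => p u + q u).
Proof.
move=> /plot_complexP[oU pR pI] /plot_complexP[_ qR qI]; apply/plot_complexP.
have E u : [/\ complex.Re (p u + q u) = complex.Re (p u) + complex.Re (q u) &
             complex.Im (p u + q u) = complex.Im (p u) + complex.Im (q u)].
  by case: (p u) (q u) => [a b] [c e].
split=> // k; [under eq_fun do rewrite (E _).1|under eq_fun do rewrite (E _).2].
all: exact: Ck_add.
Qed.

Lemma plot_cmul p q : plot complexD U p -> plot complexD U q ->
  plot complexD U (fun u => p u * q u).
Proof.
move=> /plot_complexP[oU pR pI] /plot_complexP[_ qR qI]; apply/plot_complexP.
have E u : [/\ complex.Re (p u * q u) = complex.Re (p u) * complex.Re (q u)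
                  + - (complex.Im (p u) * complex.Im (q u)) &
             complex.Im (p u * q u) = complex.Re (p u) * complex.Im (q u)
                  + complex.Im (p u) * complex.Re (q u)].
  by case: (p u) (q u) => [a b] [c e].
split=> // k; [under eq_fun do rewrite (E _).1|under eq_fun do rewrite (E _).2].
all: by apply: Ck_add => //; rewrite -?/(Ck _ _ _); try apply: Ck_opp => //;
  apply: Ck_mul.
Qed.

Lemma plot_ccst (c : C) : open U -> plot complexD U (fun=> c).
Proof. by move=> oU; exact: (@plot_cst _ complexD). Qed.

Lemma plot_csum (I : Type) (s : seq I) (p : I -> 'rV[K]_d -> C) : open U ->
  (forall i, plot complexD U (p i)) ->
  plot complexD U (fun u => \sum_(i <- s) p i u).
Proof.
move=> oU Hp; elim: s => [|i s IH].
  by under eq_fun do rewrite big_nil; exact: plot_ccst.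
by under eq_fun do rewrite big_cons; exact: plot_cadd.
Qed.

Lemma plot_cprod (I : Type) (s : seq I) (p : I -> 'rV[K]_d -> C) : open U ->
  (forall i, plot complexD U (p i)) ->
  plot complexD U (fun u => \prod_(i <- s) p i u).
Proof.
move=> oU Hp; elim: s => [|i s IH].
  by under eq_fun do rewrite big_nil; exact: plot_ccst.
by under eq_fun do rewrite big_cons; exact: plot_cmul.
Qed.

Lemma plot_cexp p k : plot complexD U p -> plot complexD U (fun u => p u ^+ k).
Proof.
move=> Hp; elim: k => [|k IH].
  by under eq_fun do rewrite expr0; apply: plot_ccst; exact: plot_open Hp.
by under eq_fun do rewrite exprS; exact: plot_cmul.
Qed.

Lemma complex_invE (z : C) : z^-1 =
  (complex.Re z / (complex.Re z * complex.Re z + complex.Im z * complex.Im z) +i*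
   - (complex.Im z / (complex.Re z * complex.Re z + complex.Im z * complex.Im z)))%C.
Proof. by case: z => a b; rewrite -!expr2. Qed.

Lemma complex_sqnorm_gt0 (z : C) : z != 0 ->
  0 < complex.Re z * complex.Re z + complex.Im z * complex.Im z.
Proof.
case: z => a b; rewrite eq_complex /= negb_and -!expr2 => H.
rewrite lt_def addr_ge0 ?sqr_ge0 // andbT paddr_eq0 ?sqr_ge0 //.
by rewrite !sqrf_eq0 negb_and.
Qed.

Lemma plot_cinv p : (forall u, U u -> p u != 0) -> plot complexD U p ->
  plot complexD U (fun u => (p u)^-1).
Proof.
move=> p0 /plot_complexP[oU pR pI]; apply/plot_complexP.
have Cn k : Ck k U (fun u => (complex.Re (p u) * complex.Re (p u) +
                        complex.Im (p u) * complex.Im (p u))^-1).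
  apply: Ck_inv => // [x Ux|]; first by rewrite gt_eqF // complex_sqnorm_gt0 // p0.
  by apply: Ck_add => //; apply: Ck_mul.
split=> // k; under eq_fun do rewrite complex_invE.
  exact: Ck_mul.
by apply: Ck_opp => //; exact: Ck_mul.
Qed.

Lemma plot_matrixP m n (p : 'rV[K]_d -> 'M[C]_(m, n)) :
  plot (matrixD m n) U p <->
  open U /\ forall i j, plot complexD U (fun u => p u i j).
Proof.
split=> [[oU H]|[oU H]].
  by split=> // i j; apply/plot_complexP; split=> //;
    [exact: (H (i, j, true))|exact: (H (i, j, false))].
by split=> // -[[i j] b]; have [_ /(_ b)] := H i j.
Qed.

Lemma plot_mulmx m n r (p : 'rV[K]_d -> 'M[C]_(m, n)) (q : 'rV[K]_d -> 'M[C]_(n, r)) :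
  plot (matrixD m n) U p -> plot (matrixD n r) U q ->
  plot (matrixD m r) U (fun u => p u *m q u).
Proof.
move=> /plot_matrixP[oU Hp] /plot_matrixP[_ Hq]; apply/plot_matrixP; split=> // i j.
under eq_fun do rewrite mxE.
by apply: plot_csum => // k; exact: plot_cmul.
Qed.

Lemma plot_det n (p : 'rV[K]_d -> 'M[C]_n) :
  plot (matrixD n n) U p -> plot complexD U (fun u => \det (p u)).
Proof.
move=> /plot_matrixP[oU Hp]; rewrite /determinant; apply: plot_csum => // s.
apply: plot_cmul; first exact: plot_ccst.
exact: plot_cprod.
Qed.
End ComplexPlots.

Lemma D_open_complex_neq0 : D_open (X := complexD) [set z | z != 0].
Proof.
move=> d U p /plot_complexP[oU pR pI].
rewrite (_ : _ `&` _ = U `&` [set u | 0 < complex.Re (p u) * complex.Re (p u) +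
                        complex.Im (p u) * complex.Im (p u)]).
  by apply: Cinfty_open_gt0 => // k; apply: Ck_add => //; apply: Ck_mul.
apply/seteqP; split=> u [Uu /= pu]; split=> //=; first exact: complex_sqnorm_gt0.
by apply: contraTneq pu => -> /=; rewrite mul0r addr0 ltxx.
Qed.

Lemma D_open_complex_Re_gt0 : D_open (X := complexD) [set z | 0 < complex.Re z].
Proof. by move=> d U p /plot_complexP[oU pR pI]; exact: Cinfty_open_gt0. Qed.

Lemma D_open_unitmx n : D_open (X := matrixD n n) [set A | A \in unitmx].
Proof.
rewrite (_ : [set A | _] =
    (fun A : matrixD n n => \det A : complexD) @^-1` [set z | z != 0]).
  apply: D_open_preimT D_open_complex_neq0 => d U p Hp _.
  exact: plot_det.
by apply/seteqP; split=> A /=; rewrite unitmxE unitfE.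
Qed.
End Diffeology.

(** * Charts and manifolds *)

Section Manifolds.
Variable K : realType.
Local Notation dspace := (dspace K).
Local Notation euclidD := (euclidD K).
Implicit Types X Y : dspace.

Definition hausdorff X := forall x y : X, x <> y -> exists A B : set X,
  [/\ D_open A, D_open B, A x, B y & A `&` B = set0].

(** Separating open sets are pulled back along [f]. The map may depend on the pair of points: in a
    bundle the projection serves for points of different fibres, a fibre coordinate for points of
    one fibre. *)
Lemma hausdorff_separated X :
  (forall x y : X, x <> y -> exists (Y : dspace) (A : set X) (f : X -> Y),
     [/\ hausdorff Y, D_open A, smooth_on A f, A x /\ A y & f x <> f y]) ->
  hausdorff X.
Proof.
move=> H x y /H[Y [A [f [hY oA Hf [Ax Ay] /hY[P [Q [oP oQ Px Qy PQ]]]]]]].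
exists (A `&` f @^-1` P), (A `&` f @^-1` Q).
split; [exact: D_open_preim|exact: D_open_preim|by []|by []|].
by rewrite setIACA -preimage_setI PQ preimage_set0 setI0.
Qed.

Lemma hausdorff_euclidD d : hausdorff (euclidD d).
Proof.
move=> x y /eqP xy.
have := @norm_hausdorff K 'rV[K]_d; rewrite open_hausdorff => /(_ x y xy).
move=> [[A B] /= [/set_mem Ax /set_mem By] [oA oB AB]].
exists A, B; split; [exact: open_D_open|exact: open_D_open|by []|by []|exact/eqP].
Qed.

(** [diffeo_on] with the inverse made explicit, so that it can be composed with charts. *)
Definition inverse_on X Y (P : set X) (Q : set Y) (f : X -> Y) (g : Y -> X) :=
  [/\ smooth_on P f, smooth_on Q g,
    forall x, P x -> Q (f x) /\ g (f x) = x &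
    forall y, Q y -> P (g y) /\ f (g y) = y].

(** Charts of [Y] are pulled back to [X] by composing with the inverse [h], on the part of their
    domain that lands in [B]. *)
Lemma chart_transport X Y (A : set X) (B : set Y) (q : X -> Y) (h : Y -> X)
    d (U : set 'rV[K]_d) (phi : 'rV[K]_d -> Y) :
  D_open A -> D_open B -> inverse_on A B q h -> is_chart U phi ->
  is_chart (U `&` phi @^-1` B) (h \o phi).
Proof.
move=> oA oB [Hq Hh AB BA] [oU oV [g [Hphi Hg gphi phig]]].
have oUB : open (U `&` phi @^-1` B) by apply: oB; exact/(smooth_on_plot _ oU).
have E : (h \o phi) @` (U `&` phi @^-1` B) = A `&` q @^-1` (phi @` U).
  apply/seteqP; split=> [x [u [Uu /= Bu] <-]|x [Ax [u Uu qx]]] /=.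
    by have [? ->] := BA _ Bu; split => //; exists u.
  have [Bqx hqx] := AB x Ax.
  by exists u; [split => //; rewrite /= qx|rewrite /= qx].
split => //; first by rewrite E; exact: D_open_preim.
exists (g \o q); split.
- apply: smooth_on_comp Hh _; last by move=> u [].
  by apply: smooth_on_sub Hphi => u [].
- rewrite E; apply: (smooth_on_comp (Q := phi @` U)) Hg _; last by move=> x [].
  by apply: smooth_on_sub Hq => x [].
- move=> u [Uu /= Bu]; split; first by exists u.
  by rewrite /= (BA _ Bu).2; exact: (gphi u Uu).2.
- rewrite E => x [Ax Vx] /=; have [Ug pg] := phig _ Vx.
  have [Bqx hqx] := AB x Ax.
  by rewrite pg hqx; split => //; split => //; rewrite /= pg.
Qed.

Lemma chart_restrict X d (U W : set 'rV[K]_d) (phi : 'rV[K]_d -> X) :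
  open W -> is_chart U phi -> is_chart (U `&` W) phi.
Proof.
move=> oW [oU oV [g [Hphi Hg gphi phig]]].
have E : phi @` (U `&` W) = phi @` U `&` (g : X -> euclidD d) @^-1` W.
  apply/seteqP; split=> [x [u [Uu Wu] <-]|x [[u Uu <-] /=]].
    by split; [exists u|rewrite /= (gphi u Uu).2].
  by rewrite (gphi u Uu).2 => Wu; exists u.
split; first exact: openI.
  by rewrite E; apply: D_open_preim => //; exact: open_D_open.
exists g; split.
- by apply: smooth_on_sub Hphi => u [].
- by apply: smooth_on_sub Hg; rewrite E => x [].
- by move=> u [Uu Wu]; have [_ gu] := gphi u Uu; split => //; exists u.
- move=> x [u [Uu Wu] <-]; have [_ gu] := gphi u Uu.
  by rewrite gu.
Qed.

Record chart X := Chart {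
  chart_dim : nat;
  chart_dom : set 'rV[K]_chart_dim;
  chart_map : 'rV[K]_chart_dim -> X;
  chartP : is_chart chart_dom chart_map
}.
Arguments chart_dom {X} c _.
Arguments chart_map {X} c _.

(** For a Hausdorff space this is equivalent to being a manifold, and it passes to products and
    countable covers without handling a base of the topology. *)
Definition has_countable_atlas X := exists (J : Type) (c : J -> chart X),
  countable [set: J] /\
  forall x, exists j u, chart_dom (c j) u /\ chart_map (c j) u = x.

Lemma rational_ball d (W : set 'rV[K]_d) u : open W -> W u ->
  exists (q : 'rV[rat]_d) (m : nat),
    ball (map_mx ratr q : 'rV[K]_d) m.+1%:R^-1 u /\
    ball (map_mx ratr q : 'rV[K]_d) m.+1%:R^-1 `<=` W.
Proof.
move=> oW Wu; have /nbhs_ballP[e /= e0 eW] := open_nbhs_nbhs (conj oW Wu).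
have e20 : 0 < e / 2 by rewrite divr_gt0.
(* The radius is below half of [e]: a ball of this radius that contains [u] stays inside the
   [e]-ball around [u]. *)
have [m /= Hm] := filter_ex (near_infty_natSinv_lt (PosNum e20)).
set r : K := m.+1%:R^-1; have r0 : 0 < r by rewrite invr_gt0.
have /choice[q Hq] : forall i : 'I_d, exists q : rat, `|ratr q - u 0 i| < r.
  move=> i; have [|q] := @rat_in_itvoo K (u 0 i - r) (u 0 i + r).
    by rewrite ltrBlDr -addrA ltrDl addr_gt0.
  rewrite in_itv /= => /andP[q1 q2]; exists q; rewrite ltr_distl.
  by rewrite q1 q2.
have qu : ball (map_mx ratr (\row_i q i) : 'rV[K]_d) r u.
  by split => // i j; rewrite (ord1 i) !mxE; exact: Hq.
exists (\row_i q i), m; split => // v qv; apply: eW.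
apply: (@le_ball _ _ _ (r + r)); first by rewrite (splitr e) lerD // ltW.
by apply: ball_triangle qv; exact: ball_sym.
Qed.

Lemma manifold_of_atlas X : hausdorff X -> has_countable_atlas X -> is_manifold X.
Proof.
move=> hX [J [c [/countable_injP[f finj] cX]]]; split => //; last first.
  move=> x; have [j [u [Uu ux]]] := cX x.
  exists (chart_dim (c j)), (chart_dom (c j)), (chart_map (c j)), u.
  by split => //; exact: chartP.
pose T := {j : J & (nat * 'rV[rat]_(chart_dim (c j)))%type}.
(* The base must be indexed by [nat]: a chart together with a rational ball in its domain is coded
   by one integer. *)
pose code (t : T) := pickle (f (projT1 t), pickle (projT2 t)).
have code_inj : injective code.
  move=> [j a] [j' a'] /(pcan_inj pickleK) [].
  move=> /(finj j j' (mem_set I) (mem_set I)) jj'; move: jj' a' => <- a'.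
  by move=> /(pcan_inj pickleK) ->.
pose B (t : T) : set X := chart_map (c (projT1 t)) @`
  (chart_dom (c (projT1 t)) `&`
   ball (map_mx ratr (projT2 t).2 : 'rV[K]_(_)) (projT2 t).1.+1%:R^-1).
have oB t : D_open (B t).
  by have [] := chart_restrict (ball_open (map_mx ratr (projT2 t).2 : 'rV[K]_(_))
    (projT2 t).1.+1%:R^-1) (chartP (c (projT1 t))).
(* An integer that is not a code gives the empty union, and a code gives a single set since [code]
   is injective. *)
exists (fun k => \bigcup_(t in [set t | code t = k]) B t); split=> [k|A x oA Ax].
  by apply: D_open_bigcup => t _; exact: oB.
have [j [u [Uu ux]]] := cX x; have [oU _ [g [Hphi _ _ _]]] := chartP (c j).
have oUA : open (chart_dom (c j) `&` chart_map (c j) @^-1` A).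
  by apply: oA; exact/(smooth_on_plot _ oU).
have [|q [m [qu qA]]] := rational_ball (u := u) oUA; first by split; rewrite //= ux.
exists (code (existT _ j (m, q))); split.
  by exists (existT _ j (m, q)) => //; exists u.
by move=> y [t /code_inj -> [v [_ /qA [_ /= Av]] <-]].
Qed.

Lemma countable_sub T (D : set T) : countable D -> countable [set: {x : T | D x}].
Proof.
move=> /countable_injP[f finj]; apply/countable_injP.
exists (fun x => f (sval x)) => x y _ _ fxy; apply: sval_inj.
by apply: finj fxy; apply/mem_set; [exact: (svalP x)|exact: (svalP y)].
Qed.

(** Each member of the countable base that lies in some [V x] selects one such [x]; the selected
    points form [D]. *)
Lemma lindelof X (V : X -> set X) : is_manifold X ->
  (forall x, D_open (V x) /\ V x x) ->
  exists D : set X, countable D /\ forall x, exists2 y, D y & V y x.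
Proof.
move=> [_ [B [oB HB]] _] HV.
have /choice[pick Hpick] : forall k, exists o : option X,
    forall x, B k `<=` V x -> exists2 y, o = Some y & B k `<=` V y.
  move=> k; have [[y Hy]|H] := pselect (exists y, B k `<=` V y).
    by exists (Some y) => x _; exists y.
  by exists None => x Hx; case: H; exists x.
pose D := [set y | exists k, pick k = Some y].
exists D; split.
  apply/countable_injP.
  have /choice[f Hf] : forall y, exists k, D y -> pick k = Some y.
    move=> y; have [[k Hk]|H] := pselect (D y); first by exists k.
    by exists 0%N.
  exists f => y z /set_mem Dy /set_mem Dz fyz.
  by have := Hf y Dy; rewrite fyz (Hf z Dz) => -[].
move=> x; have [oV Vx] := HV x; have [k [Bx BV]] := HB _ _ oV Vx.
have [y ky kV] := Hpick k x BV.
by exists y; [exists k|exact: kV].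
Qed.

Lemma atlas_of_manifold X : is_manifold X -> has_countable_atlas X.
Proof.
move=> mX; have /choice[c Hc] : forall x : X, exists c : chart X,
    exists u, chart_dom c u /\ chart_map c u = x.
  move=> x; have [d [U [phi [u [cU Uu ux]]]]] := manifold_chart mX x.
  by exists (Chart cU), u.
have [x|D [cD Hcov]] := @lindelof X (fun x => chart_map (c x) @` chart_dom (c x)) mX.
  have [_ oc _] := chartP (c x); split => //.
  by have [u [Uu ux]] := Hc x; exists u.
exists {x : X | D x}, (fun x => c (sval x)); split; first exact: countable_sub.
by move=> x; have [y Dy [u Uu ux]] := Hcov x; exists (exist _ y Dy), u.
Qed.

Lemma countable_pair (S T : Type) : countable [set: S] -> countable [set: T] ->
  countable [set: S * T].
Proof. by move=> cS cT; rewrite -setXTT; exact: countableX. Qed.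

(** The maps [q j] pull charts of [Y] back to [X], and countably many pieces give a countable atlas.
    The Hausdorff property is not local and has to be supplied separately. *)
Lemma manifold_cover X Y (J : Type) (A : J -> set X) (B : J -> set Y)
    (q : J -> X -> Y) :
  hausdorff X -> is_manifold Y -> countable [set: J] ->
  (forall j, [/\ D_open (A j), D_open (B j) & diffeo_on (A j) (B j) (q j)]) ->
  (forall x, exists j, A j x) -> is_manifold X.
Proof.
move=> hX /atlas_of_manifold[I [c [cI cY]]] cJ Hq cov.
apply: manifold_of_atlas => //.
have /choice[c' Hc'] : forall ji : J * I, exists c' : chart X, forall x,
    A ji.1 x -> (chart_map (c ji.2) @` chart_dom (c ji.2)) (q ji.1 x) ->
    (chart_map c' @` chart_dom c') x.
  move=> [j i] /=; have [oA oB [h Hh]] := Hq j.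
  exists (Chart (chart_transport oA oB Hh (chartP (c i)))) => x Ax [u Uu ux] /=.
  have [_ _ /(_ x Ax)[Bx hx] _] := Hh.
  by exists u; [split; rewrite //= ux|rewrite /= ux].
exists (J * I)%type, c'; split; first exact: countable_pair.
move=> x; have [j Ax] := cov x; have [i [u [Uu ux]]] := cY (q j x).
have [|v Vv vx] := Hc' (j, i) x Ax; first by exists u.
by exists (j, i), v.
Qed.

Lemma hausdorff_prodD X Y : hausdorff X -> hausdorff Y -> hausdorff (prodD X Y).
Proof.
move=> hX hY; apply: hausdorff_separated => -[x1 y1] [x2 y2] ne.
have [e1|n1] := pselect (x1 = x2).
  exists Y, setT, snd; split=> //; [exact: D_openT|exact: smooth_snd|].
  by move=> /= e2; apply: ne; rewrite e1 e2.
by exists X, setT, fst; split=> //; [exact: D_openT|exact: smooth_fst].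
Qed.

Lemma smooth_lsubmx d e : smooth (X := euclidD (d + e)) (Y := euclidD d) lsubmx.
Proof.
move=> k U p [oU Hp] _; split => // i j.
rewrite (_ : _ \o _ = fun u => p u 0 (lshift e i)); first exact: Hp.
by apply/funext => u /=; rewrite mxE.
Qed.

Lemma smooth_rsubmx d e : smooth (X := euclidD (d + e)) (Y := euclidD e) rsubmx.
Proof.
move=> k U p [oU Hp] _; split => // i j.
rewrite (_ : _ \o _ = fun u => p u 0 (rshift d i)); first exact: Hp.
by apply/funext => u /=; rewrite mxE.
Qed.

Lemma smooth_row_mx d e :
  smooth (X := prodD (euclidD d) (euclidD e)) (Y := euclidD (d + e))
    (fun x => row_mx x.1 x.2).
Proof.
move=> k U p [[oU Hp] [_ Hq]] _; split => // i j.
case: (split_ordP i) => i' ->.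
  rewrite (_ : _ \o _ = fun u => (p u).1 0 i'); first exact: Hp.
  by apply/funext => u /=; rewrite row_mxEl.
rewrite (_ : _ \o _ = fun u => (p u).2 0 i'); first exact: Hq.
by apply/funext => u /=; rewrite row_mxEr.
Qed.

Lemma chart_prodD X Y d e (U : set 'rV[K]_d) (V : set 'rV[K]_e) phi psi :
  is_chart (X := X) U phi -> is_chart (X := Y) V psi ->
  is_chart (X := prodD X Y) [set w : 'rV[K]_(d + e) | U (lsubmx w) /\ V (rsubmx w)]
    (fun w => (phi (lsubmx w), psi (rsubmx w))).
Proof.
move=> [oU oU' [g [Hphi Hg gphi phig]]] [oV oV' [h [Hpsi Hh hpsi psih]]].
set W := [set w | _].
have E : (fun w : 'rV[K]_(d + e) => (phi (lsubmx w), psi (rsubmx w))) @` W =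
    (fst @^-1` (phi @` U)) `&` (snd @^-1` (psi @` V)).
  apply/seteqP; split=> [_ [w [Uw Vw] <-]|[x y] /= [[u Uu <-] [v Vv <-]]].
    by split; [exists (lsubmx w)|exists (rsubmx w)].
  by exists (row_mx u v); rewrite /W /= ?row_mxKl ?row_mxKr.
split.
- have oUV : D_open (X := euclidD (d + e)) W.
    apply: D_openI.
      exact: D_open_preimT (@smooth_lsubmx d e) (open_D_open oU).
    exact: D_open_preimT (@smooth_rsubmx d e) (open_D_open oV).
  by have := oUV _ setT id (plot_id openT); rewrite setTI.
- rewrite E; apply: D_openI; first exact: D_open_preimT (@smooth_fst _ X Y) oU'.
  exact: D_open_preimT (@smooth_snd _ X Y) oV'.
exists (fun x => row_mx (g x.1) (h x.2)); split.
- apply: smooth_on_pair.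
    apply: (@smooth_on_comp K (euclidD (d + e)) (euclidD d) X W U lsubmx phi) => //.
      by apply: smooth_onT; exact: smooth_lsubmx.
    by move=> x [].
  apply: (@smooth_on_comp K (euclidD (d + e)) (euclidD e) Y W V rsubmx psi) => //.
    by apply: smooth_onT; exact: smooth_rsubmx.
  by move=> x [].
- rewrite E => k O p [pX pY] HP.
  apply: (@smooth_row_mx d e k O (fun u => (g (p u).1, h (p u).2))) => //.
  by split; [apply: Hg pX _ => u /HP[]|apply: Hh pY _ => u /HP[]].
- move=> w [Uw Vw]; split; first by exists w.
  by rewrite /= (gphi _ Uw).2 (hpsi _ Vw).2 hsubmxK.
- rewrite E => -[x y] /= [/phig[Ux ex] /psih[Vy ey]] /=.
  by rewrite row_mxKl row_mxKr ex ey; split => //; rewrite /W /= row_mxKl row_mxKr.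
Qed.

Lemma manifold_prodD X Y : is_manifold X -> is_manifold Y -> is_manifold (prodD X Y).
Proof.
move=> mX mY; apply: manifold_of_atlas.
  by apply: hausdorff_prodD; exact: manifold_hausdorff.
have [J [c [cJ cX]]] := atlas_of_manifold mX.
have [I [c' [cI cY]]] := atlas_of_manifold mY.
exists (J * I)%type, (fun ji => Chart (chart_prodD (chartP (c ji.1)) (chartP (c' ji.2)))).
split; first exact: countable_pair.
move=> [x y]; have [j [u [Uu ux]]] := cX x; have [i [v [Vv vy]]] := cY y.
by exists (j, i), (row_mx u v); rewrite /= row_mxKl row_mxKr ux vy.
Qed.

(** The functions [h i], numbered by the enumeration of [I], form one global chart, whose inverse is
    [mk]. It serves for spaces of complex matrices. *)
Lemma manifold_initialD (I : finType) T (h : I -> T -> K) (mk : (I -> K) -> T) :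
  (forall i v, h i (mk v) = v i) -> (forall x, mk (h^~ x) = x) ->
  is_manifold (initialD h).
Proof.
move=> hmk mkh.
pose phi (u : 'rV[K]_#|I|) : initialD h := mk (fun i => u 0 (enum_rank i)).
pose g (x : initialD h) : euclidD #|I| := \row_k h (enum_val k) x.
have Hg : smooth g.
  move=> d U p [oU Hp] _; split => // i k.
  rewrite (_ : _ \o _ = h (enum_val i) \o p); first exact: Hp.
  by apply/funext => u /=; rewrite mxE.
have Hphi : smooth (X := euclidD #|I|) phi.
  move=> d U p [oU Hp] _; split => // i k.
  rewrite (_ : _ \o _ = fun u => p u 0 (enum_rank i)); first exact: Hp.
  by apply/funext => u /=; rewrite hmk.
have gK x : phi (g x) = x.
  rewrite /phi -[RHS]mkh; congr mk; apply/funext => i.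
  by rewrite /g mxE enum_rankK.
have phiK u : g (phi u) = u.
  by apply/rowP => k; rewrite mxE hmk enum_valK.
have phiT : phi @` setT = setT.
  by apply/seteqP; split=> // x _; exists (g x).
have cphi : is_chart setT phi.
  split; [exact: openT|rewrite phiT; exact: D_openT|].
  by exists g; rewrite phiT; split.
apply: manifold_of_atlas.
  apply: hausdorff_separated => x y xy; exists (euclidD #|I|), setT, g.
  split=> //; [exact: hausdorff_euclidD|exact: D_openT|].
  by move=> gxy; apply: xy; rewrite -[x]gK -[y]gK gxy.
exists unit, (fun=> Chart cphi); split; first exact: countableP.
by move=> x; exists tt, (g x).
Qed.

Lemma manifold_matrixD m n : is_manifold (matrixD K m n).
Proof.
apply: (@manifold_initialD ('I_m * 'I_n * bool)%type 'M[complex K]_(m, n) _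
  (fun v => \matrix_(i, j) (v (i, j, true) +i* v (i, j, false))%C)).
  by move=> [[i j] []] v; rewrite mxE.
by move=> A; apply/matrixP => i j; rewrite mxE /=; case: (A i j).
Qed.

Definition local_diffeo X Y (q : X -> Y) := forall x, exists A B h,
  [/\ A x, D_open A, D_open B & inverse_on A B q h].

(** In the square f s = r q both [q] and [f] are local diffeomorphisms, so [s] has in transported
    charts the same coordinate expression [g] as [r]. It is applied to the source and target maps of
    groupoids lying over a known one. *)
Lemma submersion_local_diffeo (X N G M : dspace) (s : X -> N) (q : X -> G)
    (f : N -> M) (r : G -> M) :
  smooth s -> local_diffeo q -> local_diffeo f ->
  (forall x, f (s x) = r (q x)) -> submersion r -> submersion s.
Proof.
move=> Hs lq lf fs sr x.
have [A [B [h [Ax oA oB Hh]]]] := lq x.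
have [A' [B' [h' [Ax' oA' oB' Hh']]]] := lf (s x).
have [d [U [phi [u [e [V [psi [g [[cphi Uu ux cpsi] [Hg dg sg]]]]]]]]]] := sr (q x).
have [Hq Hsh AB BA] := Hh; have [_ _ AB' BA'] := Hh'.
have cphi' := chart_transport oA oB Hh cphi.
(* The domain is cut down a second time, to the points that [s] sends into [A'], where [f] has the
   inverse [h']. *)
have oS : D_open (s @^-1` A') by exact: D_open_preimT.
have [oU' _ [_ [Hphi' _ _ _]]] := cphi'.
have oU'' := oS _ _ _ ((smooth_on_plot (X := X) (h \o phi) oU').1 Hphi').
pose U' := U `&` phi @^-1` B.
have cphi'' : is_chart (U' `&` (U' `&` (h \o phi) @^-1` (s @^-1` A'))) (h \o phi).
  exact: chart_restrict.
have [Bqx hqx] := AB x Ax.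
exists d, (U' `&` (U' `&` (h \o phi) @^-1` (s @^-1` A'))).
exists (h \o phi), u, e, (V `&` psi @^-1` B'), (h' \o psi), g; split.
  split; [exact: cphi''| | |exact: (chart_transport oA' oB' Hh' cpsi)].
    by rewrite /U' /= ux hqx.
  by rewrite /= ux hqx.
split=> // w [[Uw Bw] [_ sw]]; have [Vgw rw] := Hg w Uw.
have [Ahw qhw] := BA _ Bw; have [B'w h'w] := AB' _ sw.
have E : psi (g w) = f (s (h (phi w))) by rewrite fs qhw rw.
by split; [split=> //=; rewrite E|rewrite /= E h'w].
Qed.
End Manifolds.

(** * Pull-backs and tensor products of extensions *)

Section Extensions.
Variable K : realType.
Local Notation C := (complex K).
Local Notation dspace := (dspace K).
Local Notation complexD := (complexD K).
Local Notation circle := (@circle K).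
Implicit Types (M N : dspace).

Lemma circle1 : circle 1. Proof. by rewrite /circle /= normr1. Qed.

Lemma circleM a b : circle a -> circle b -> circle (a * b).
Proof. by rewrite /circle /= normrM => -> ->; rewrite mulr1. Qed.

Lemma circleV a : circle a -> circle a^-1.
Proof. by rewrite /circle /= normfV => ->; rewrite invr1. Qed.

Lemma circleX a k : circle a -> circle (a ^+ k).
Proof. by rewrite /circle /= normrX => ->; rewrite expr1n. Qed.

Lemma circle_neq0 a : circle a -> a != 0.
Proof. by rewrite /circle /= => a1; rewrite -normr_gt0 a1. Qed.

(** The radial retraction of C^* onto the circle. *)
Definition normalize (z : C) : C := z / `|z|.

Lemma normalizeM z w : normalize (z * w) = normalize z * normalize w.
Proof. by rewrite /normalize normrM invfM mulrACA. Qed.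

Lemma normalize_circle z : z != 0 -> circle (normalize z).
Proof.
by move=> z0; rewrite /circle /normalize /= normf_div normr_id divff // normr_eq0.
Qed.

Lemma normalize_id z : circle z -> normalize z = z.
Proof. by rewrite /circle /normalize /= => ->; rewrite divr1. Qed.

Lemma plot_normalize d (U : set 'rV[K]_d) (p : 'rV[K]_d -> C) :
  (forall u, U u -> p u != 0) -> plot complexD U p ->
  plot complexD U (fun u => normalize (p u)).
Proof.
move=> p0 Hp; apply: plot_cmul => //; apply: plot_cinv.
  by move=> u Uu; rewrite normr_eq0 p0.
have [oU pR pI] := (plot_complexP _ _).1 Hp.
apply/plot_complexP; split=> // k; last first.
  rewrite (_ : (fun _ => _) = fun=> 0); first exact: Ck_cst.
  by apply/funext => u; case: (p u).
rewrite (_ : (fun _ => _) = fun u => Num.sqrt (complex.Re (p u) * complex.Re (p u) +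
    complex.Im (p u) * complex.Im (p u))).
  apply: Ck_sqrt => // [u Uu|]; first exact/complex_sqnorm_gt0/p0.
  by apply: Ck_add => //; apply: Ck_mul.
by apply/funext => u; case: (p u).
Qed.

(** The division map of a principal bundle: the unique group element carrying [r] to [s] in the same
    fibre. Together with local sections its smoothness is equivalent to local triviality. Values on
    pairs from different fibres are arbitrary. *)
Record is_division (A : set C) M (G : groupoid M) (E : extension G)
    (dv : E -> E -> C) : Prop := {
  dv_in : forall r s, eproj r = eproj s -> A (dv r s);
  dv_act : forall r s, eproj r = eproj s -> eact (dv r s) r = s;
  dv_uniq : forall a r, A a -> dv r (eact a r) = a;
  dv_smooth : smooth_on (X := prodD E E) (Y := complexD)
    [set x | eproj x.1 = eproj x.2] (fun x => dv x.1 x.2)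
}.

(** A central extension without the manifold conditions. The principal bundle
    condition is expressed by local sections and a smooth division, which makes
    it easier to transport through pull-backs and tensor products. *)
Record weak_extension (A : set C) M (G : groupoid M) (E : extension G) : Prop := {
  wx_proj_smooth : smooth (@eproj K M G E);
  wx_proj_mul : forall r s : E, src r = tgt s ->
    eproj (mul r s) = mul (eproj r) (eproj s);
  wx_act_smooth : smooth_on (X := prodD complexD E) [set x | A x.1]
    (fun x => eact x.1 x.2);
  wx_act1 : forall r : E, eact 1 r = r;
  wx_actM : forall a b (r : E), A a -> A b -> eact (a * b) r = eact a (eact b r);
  wx_act_proj : forall a (r : E), A a -> eproj (eact a r) = eproj r;
  wx_central : forall a b (r s : E), A a -> A b -> src r = tgt s ->
    mul (eact a r) (eact b s) = eact (a * b) (mul r s);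
  wx_section : forall g : G, exists (V : set G) (sigma : G -> E),
    [/\ D_open V, V g, smooth_on V sigma & forall h, V h -> eproj (sigma h) = h];
  wx_div : exists dv, is_division A (E := E) dv
}.

(** Let [h] be the inverse of the trivialisation given by a local section. Then (h s).1 / (h r).1
    carries [r] to [s], so the action is transitive on fibres and the division is smooth;
    injectivity of the trivialisation gives uniqueness. *)
Lemma weak_of_central M (G : groupoid M) (E : extension G) :
  is_central_extension circle E -> weak_extension circle E.
Proof.
move=> cE; have [_ Hproj Hmul Hact act1 actM actp Hpr Hc] := cE.
split=> // [g|].
  by have [V [s [oV Vg sV ps _]]] := Hpr g; exists V, s.
have trans (r s : E) : eproj r = eproj s -> exists2 a, circle a & eact a r = s.
  move=> rs; have [V [sg [oV Vg sV ps [h [_ _ _ hV]]]]] := Hpr (eproj r).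
  have [[/= cr Vr] er] := hV r Vg; have [|[/= cs Vs] es] := hV s; first by rewrite /= -rs.
  have pr : eproj r = (h r).2 by rewrite -{1}er actp // ps.
  have pes : eproj s = (h s).2 by rewrite -{1}es actp // ps.
  have c := circleM cs (circleV cr).
  exists ((h s).1 / (h r).1) => //.
  rewrite -[RHS]es -[X in eact _ X = _]er -actM // mulfVK ?circle_neq0 //.
  by rewrite -pr rs pes.
have free a b (r : E) : circle a -> circle b -> eact a r = eact b r -> a = b.
  move=> ca cb ab; have [V [sg [oV Vg sV ps [h [_ _ h1 h2]]]]] := Hpr (eproj r).
  have [[/= cr Vr] er] := h2 r Vg.
  have ha := h1 (a * (h r).1, (h r).2); have hb := h1 (b * (h r).1, (h r).2).
  have [|_ ea] := ha; first by split => //; exact: circleM.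
  have [|_ eb] := hb; first by split => //; exact: circleM.
  have : (a * (h r).1, (h r).2) = (b * (h r).1, (h r).2).
    by rewrite -ea -eb /= !actM // er ab.
  by case=> /mulIf; apply; exact: circle_neq0.
have /choice[dv' Hdv'] : forall x : E * E, exists a, eproj x.1 = eproj x.2 ->
    circle a /\ eact a x.1 = x.2.
  move=> [r s] /=; have [rs|] := pselect (eproj r = eproj s); last by exists 0.
  by have [a ca ar] := trans r s rs; exists a.
exists (fun r s => dv' (r, s)); split=> [r s|r s|a r ca|].
- by move=> /(Hdv' (r, s))[].
- by move=> /(Hdv' (r, s))[].
- have /= := Hdv' (r, eact a r); rewrite actp // => /(_ erefl) [cd].
  exact: free.
move=> d U p [pE pF] HP; apply: plot_local; first exact: plot_open pE.
move=> u Uu; have [V [sg [oV Vg sV ps [h [_ hs h1 h2]]]]] := Hpr (eproj (p u).1).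
have oU' : open (U `&` (fun v => eproj (p v).1) @^-1` V).
  by apply: oV; apply: (Hproj d U (fst \o p)).
exists (U `&` (fun v => eproj (p v).1) @^-1` V) => //.
apply: (@plot_eq _ complexD _ _ _ (fun v => (h (p v).2).1 * ((h (p v).1).1)^-1)).
  move=> v [Uv /= Vv]; have pv := HP v Uv; have [/= cd ed] := Hdv' _ pv.
  have [[/= cr Vr] er] := h2 _ Vv.
  have [|[/= cs Vs] es] := h2 (p v).2; first by rewrite /= -pv.
  have pr : eproj (p v).1 = (h (p v).1).2 by rewrite -{1}er actp // ps.
  have pes : eproj (p v).2 = (h (p v).2).2 by rewrite -{1}es actp // ps.
  rewrite -surjective_pairing; apply: (free _ _ (p v).1) => //.
    by apply: circleM => //; exact: circleV.
  rewrite ed -[X in _ = eact _ X]er -actM //;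
    last by apply: circleM => //; exact: circleV.
  by rewrite mulfVK ?circle_neq0 // -pr pv pes es.
apply: plot_cmul.
  apply: plot_prod_fst; apply: hs => [|v [Uv /= Vv]]; last by rewrite /= -(HP v Uv).
  by apply: plot_sub pF => // v [].
apply: plot_cinv => [v [Uv Vv]|].
  by apply: circle_neq0; have [[]] := h2 _ Vv.
apply: plot_prod_fst; apply: hs => [|v [Uv /= Vv] //].
by apply: plot_sub pE => // v [].
Qed.

(** The inverse of the trivialisation (a, h) -> a s(h) is obtained by dividing a point by the value
    of the section over the same arrow. *)
Lemma central_of_weak (A : set C) M (G : groupoid M) (E : extension G) :
  is_lie_groupoid E -> weak_extension A E -> is_central_extension A E.
Proof.
move=> lE [Hproj Hmul Hact act1 actM actp Hc Hs [dv [dvA dva dvu dvs]]].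
split=> // g; have [V [s [oV Vg sV ps]]] := Hs g; exists V, s; split=> //.
exists (fun r => (dv (s (eproj r)) r, eproj r)); split.
- move=> d U p [pC pG] HP; apply: (Hact d U (fun u => ((p u).1, s (p u).2))).
    by split=> //; apply: sV => // u /HP[].
  by move=> u /HP[].
- move=> d U p pE HP; have pG : plot G U (@eproj K M G E \o p) by exact: Hproj.
  split=> //; apply: (dvs d U (fun u => (s (eproj (p u)), p u))).
    by split => //; apply: sV.
  by move=> u Uu; rewrite /= ps //; exact: HP.
- move=> [a h] [/= Aa Vh]; rewrite actp // ps //.
  by rewrite dvu.
- move=> r Vr /=; have e : eproj (s (eproj r)) = eproj r by rewrite ps.
  by split; [split => //; exact: dvA|exact: dva].
Qed.

(** The typing of composites is what keeps them inside the subtypes, so that [sub_of] in a pull-back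
    groupoid returns the intended value. *)
Definition mul_typed M (G : groupoid M) := forall g h : G, src g = tgt h ->
  src (mul g h) = src h /\ tgt (mul g h) = tgt g.

Lemma lie_mul_typed M (G : groupoid M) : is_lie_groupoid G -> mul_typed G.
Proof. by move=> lG g h gh; split; [exact: lie_mul_src|exact: lie_mul_tgt]. Qed.

Lemma ext_mul_typed A M (G : groupoid M) (E : extension G) :
  mul_typed G -> weak_extension A E -> mul_typed E.
Proof.
move=> mG wE r s rs; rewrite -!eproj_src -!eproj_tgt (wx_proj_mul wE) //.
by apply: mG; rewrite eproj_src eproj_tgt.
Qed.

Lemma pullback_mulE (N M : dspace) (f : N -> M) (G : groupoid M)
    (x y : pullback f G) : mul_typed G -> src x = tgt y ->
  sval (mul x y) = ((sval x).1.1, (sval y).1.2, mul (sval x).2 (sval y).2).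
Proof.
move=> mG xy; apply: sub_ofE => /=.
have [x1 x2] := svalP x; have [y1 y2] := svalP y.
have [|-> ->] := mG (sval x).2 (sval y).2; last by rewrite x1 y2.
by rewrite x2 y1; congr f; exact: xy.
Qed.

Section Pullback.
Variables (N M : dspace) (f : N -> M) (G : groupoid M).

Lemma pullback_mul_typed : mul_typed G -> mul_typed (pullback f G).
Proof. by move=> mG x y xy; rewrite /src /tgt /= pullback_mulE. Qed.

Lemma pullback_actE A (E : extension G) a (x : pullback_ext f E) :
  weak_extension A E -> A a ->
  sval (eact a x) = ((sval x).1, eact a (sval x).2).
Proof.
move=> wE Aa; apply: sub_ofE => /=; have [x1 x2] := svalP x.
by rewrite -eproj_tgt -eproj_src (wx_act_proj wE) // eproj_tgt eproj_src.
Qed.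

(** All structure sits in the component in [E]: section and division are those of [E], and the two
    end points are carried along. *)
Lemma weak_pullback (E : extension G) : mul_typed G ->
  weak_extension circle E -> weak_extension circle (pullback_ext f E).
Proof.
move=> mG wE; have mE := ext_mul_typed mG wE.
have [dv [dvA dva dvu dvs]] := wx_div wE.
have actE := fun a (x : pullback_ext f E) => @pullback_actE circle E a x wE.
have proj2 (r s : pullback_ext f E) : eproj r = eproj s ->
    eproj (sval r).2 = eproj (sval s).2.
  by move=> /(congr1 (fun x => (sval x).2)).
split.
- move=> d U p [pN pE] _; split => //=.
  exact: (wx_proj_smooth wE pE).
- move=> r s rs; apply: sval_inj; have E1 := @pullback_mulE N M f E r s mE rs.
  rewrite pullback_mulE // -[LHS]/((sval (mul r s)).1, eproj (sval (mul r s)).2).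
  rewrite E1 /= (wx_proj_mul wE) //.
  have [_ e] := svalP r; have [e' _] := svalP s.
  by rewrite e e'; congr f; exact: rs.
- move=> d U p [pC pE] HP.
  apply: (@plot_eq _ (prodD (prodD N N) E) _ _ _
    (fun u => ((sval (p u).2).1, eact (p u).1 (sval (p u).2).2))).
    by move=> u /HP Au; exact: actE.
  split; first exact: pE.1.
  apply: (wx_act_smooth wE (p := fun u => ((p u).1, (sval (p u).2).2))) HP.
  by split => //; exact: pE.2.
- move=> r; apply: sval_inj; rewrite actE; last exact: circle1.
  by rewrite (wx_act1 wE) -surjective_pairing.
- move=> a b r ca cb; apply: sval_inj; rewrite !actE //; last exact: circleM.
  by rewrite /= (wx_actM wE).
- move=> a r ca; apply: sval_inj; rewrite /= actE //=.
  by rewrite (wx_act_proj wE).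
- move=> a b r s ca cb rs; apply: sval_inj.
  have ars : src (eact a r) = tgt (eact b s) by rewrite /src /tgt /= !actE.
  rewrite (pullback_mulE (x := eact a r)) // !actE //; last exact: circleM.
  rewrite (pullback_mulE (x := r)) //= (wx_central wE) //.
  have [_ e] := svalP r; have [e' _] := svalP s.
  by rewrite e e'; congr f; exact: rs.
- move=> g; have [V [s [oV Vg sV ps]]] := wx_section wE (sval g).2.
  have ok (x : pullback f G) : V (sval x).2 ->
      tgt (s (sval x).2) = f (sval x).1.1 /\ src (s (sval x).2) = f (sval x).1.2.
    by move=> Vx; rewrite -eproj_tgt -eproj_src ps //; exact: (svalP x).
  pose x0 : pullback_ext f E := exist _ ((sval g).1, s (sval g).2) (ok g Vg).
  pose s' (x : pullback f G) : pullback_ext f E := sub_of x0 ((sval x).1, s (sval x).2).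
  have s'E (x : pullback f G) : V (sval x).2 -> sval (s' x) = ((sval x).1, s (sval x).2).
    by move=> Vx; apply: sub_ofE; apply: (ok x Vx).
  exists [set x | V (sval x).2], s'; split => //.
  + apply: (@D_open_preimT _ (pullback f G) G) oV => d U p pp _.
    exact: plot_prod_snd pp.
  + move=> d U p pp HP; apply: (@plot_eq _ (prodD (prodD N N) E) _ _ _
      (fun u => ((sval (p u)).1, s (sval (p u)).2))).
      by move=> u /HP; exact: s'E.
    split; first exact: pp.1.
    by apply: sV HP; exact: pp.2.
  + move=> x Vx; apply: sval_inj; rewrite /= s'E //= ps //.
    by rewrite -surjective_pairing.
- exists (fun r s => dv (sval r).2 (sval s).2); split.
  + by move=> r s /proj2 /dvA.
  + move=> r s rs; have c := dvA _ _ (proj2 _ _ rs).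
    apply: sval_inj; rewrite actE // dva; last exact: proj2.
    have /(congr1 (fun x => (sval x).1)) /= -> := rs.
    by rewrite -surjective_pairing.
  + by move=> a r ca; rewrite actE //= dvu.
  + move=> d U p [[_ pE] [_ pF]] HP.
    apply: (dvs d U (fun u => ((sval (p u).1).2, (sval (p u).2).2))) => // u /HP.
    exact: proj2.
Qed.
End Pullback.

Lemma quot_classP (X : dspace) (r : X -> X -> Prop) x y :
  (forall x, r x x) -> (forall x y, r x y -> r y x) ->
  (forall x y z, r x y -> r y z -> r x z) ->
  quot_class r x = quot_class r y <-> r x y.
Proof.
move=> rr rs rt; split=> [/(congr1 (@proj1_sig _ _)) /= ->|xy]; first exact: rr.
apply: eq_exist; apply/funext => z; apply/propext.
by split=> h; [apply: rt h; exact: rs|apply: rt xy h].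
Qed.

(** The scalar (dv r s) b / a carries a r to b (dv r s) r = b s, and the division is unique. *)
Lemma division_act M (G : groupoid M) (E : extension G) dv a b (r s : E) :
  weak_extension circle E -> is_division circle dv ->
  circle a -> circle b -> eproj r = eproj s ->
  dv (eact a r) (eact b s) = dv r s * (b / a).
Proof.
move=> wE dE ca cb rs; have cV := circleV ca; have a0 := circle_neq0 ca.
have c := circleM (dv_in dE rs) (circleM cb cV).
rewrite -(dv_uniq dE (eact a r) c); congr dv; rewrite -(wx_actM wE) //.
rewrite -[in LHS](dv_act dE rs) -(wx_actM wE) //; last exact: dv_in.
by congr eact; field.
Qed.

Section Tensor.
Variables (M : dspace) (G : groupoid M) (E F : extension G).
Hypothesis mG : mul_typed G.
Hypothesis wE : weak_extension circle E.
Hypothesis wF : weak_extension circle F.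
Let mE := ext_mul_typed mG wE.
Let mF := ext_mul_typed mG wF.

(** The elementary tensor of [e] and [f]. The operations of [tensor] use chosen representatives; the
    lemmas below compute them on arbitrary ones. *)
Definition tensor_pair (e : E) (f : F) (ef : eproj e = eproj f) : tensor E F :=
  quot_class (@tensor_rel K M G E F) (exist _ (e, f) ef).

Lemma tensor_pairE (x0 : tensor_pre E F) e f (ef : eproj e = eproj f) :
  quot_class (@tensor_rel K M G E F) (sub_of x0 (e, f)) = tensor_pair ef.
Proof. by congr quot_class; apply: sval_inj; rewrite sub_ofE. Qed.

Lemma tensor_pairP e f ef e' f' ef' :
  @tensor_pair e f ef = @tensor_pair e' f' ef' <->
  exists a, [/\ circle a, e' = eact a e & f' = eact a^-1 f].
Proof.
rewrite /tensor_pair quot_classP.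
- split=> [[a [ca /= [e1 e2]]]|[a [ca e1 e2]]]; exists a => //.
  by split => //=; rewrite -e1 -e2.
- move=> x; exists 1; split; first exact: circle1.
  by rewrite invr1 (wx_act1 wE) (wx_act1 wF) -surjective_pairing.
- move=> x y [a [ca yx]]; exists a^-1; split; first exact: circleV.
  have cV := circleV ca; have a0 := circle_neq0 ca.
  rewrite yx /= invrK -(wx_actM wE) // -(wx_actM wF) // mulVf // mulfV //.
  by rewrite (wx_act1 wE) (wx_act1 wF) -surjective_pairing.
- move=> x y z [a [ca yx]] [b [cb zy]]; exists (b * a); split; first exact: circleM.
  have cV := circleV ca; have cW := circleV cb.
  by rewrite zy yx /= -(wx_actM wE) // -(wx_actM wF) // invfM.
Qed.

Lemma tensor_surj (t : tensor E F) : exists e f ef, t = @tensor_pair e f ef.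
Proof.
rewrite -[t](quot_reprK (r := @tensor_rel K M G E F)).
by case: (quot_repr _) => -[e f] ef; exists e, f, ef.
Qed.

Lemma tensor_repr e f ef : exists a, circle a /\
  sval (quot_repr (@tensor_pair e f ef : quot (@tensor_rel K M G E F))) =
  (eact a e, eact a^-1 f).
Proof.
set x := quot_repr _; have := quot_reprK (@tensor_pair e f ef : quot _).
rewrite -/x; case: x => -[e' f'] ef' /= /esym /tensor_pairP[a [ca -> ->]].
by exists a.
Qed.

Lemma tensor_eproj e f ef : eproj (@tensor_pair e f ef) = eproj e.
Proof.
have [a [ca]] := tensor_repr ef; rewrite /eproj /= => -> /=.
exact: (wx_act_proj wE).
Qed.

Lemma tensor_src e f ef : src (@tensor_pair e f ef) = src e.
Proof. by rewrite -eproj_src tensor_eproj eproj_src. Qed.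

Lemma tensor_tgt e f ef : tgt (@tensor_pair e f ef) = tgt e.
Proof. by rewrite -eproj_tgt tensor_eproj eproj_tgt. Qed.

Lemma tensor_actE c e f ef (H : eproj (eact c e) = eproj f) : circle c ->
  eact c (@tensor_pair e f ef) = tensor_pair H.
Proof.
move=> cc; have [a [ca Ea]] := tensor_repr ef.
have cV := circleV ca.
rewrite /eact /= Ea /=.
(* The scalar acts on the first factor only: (c a e, a^-1 f) is related to (c e, f) through a^-1. *)
have H' : eproj (eact c (eact a e)) = eproj (eact a^-1 f).
  by rewrite !(wx_act_proj wE) // (wx_act_proj wF).
rewrite (tensor_pairE _ H').
apply/tensor_pairP; exists a^-1; split => //.
  rewrite -!(wx_actM wE) //; try exact: circleM.
  by rewrite mulrAC mulVf ?mul1r // circle_neq0.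
by rewrite invrK -(wx_actM wF) // mulfV ?circle_neq0 // (wx_act1 wF).
Qed.

Lemma tensor_mulE e f ef e' f' ef' (H : eproj (mul e e') = eproj (mul f f')) :
  src e = tgt e' ->
  mul (@tensor_pair e f ef) (@tensor_pair e' f' ef') = tensor_pair H.
Proof.
move=> ee'; have [a [ca Ea]] := tensor_repr ef; have [b [cb Eb]] := tensor_repr ef'.
have ff' : src f = tgt f' by rewrite -eproj_src -eproj_tgt -ef -ef' eproj_src eproj_tgt.
have cV := circleV ca; have cW := circleV cb; have cc := circleM ca cb.
rewrite /mul /= Ea Eb /= !(wx_central wE) // !(wx_central wF) // -invfM.
have H' : eproj (eact (a * b) (mul e e')) = eproj (eact (a * b)^-1 (mul f f')).
  by rewrite (wx_act_proj wE) // (wx_act_proj wF) //; exact: circleV.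
rewrite (tensor_pairE _ H').
have a0 := circle_neq0 cc; have cZ := circleV cc.
apply/tensor_pairP; exists (a * b)^-1; split => //.
  by rewrite -(wx_actM wE) // mulVf // (wx_act1 wE).
by rewrite invrK -(wx_actM wF) // mulfV // (wx_act1 wF).
Qed.

Lemma tensor_mul_proj (e e' : E) (f f' : F) : eproj e = eproj f ->
  eproj e' = eproj f' -> src e = tgt e' -> eproj (mul e e') = eproj (mul f f').
Proof.
move=> ef ef' ee'; rewrite (wx_proj_mul wE) // (wx_proj_mul wF) ?ef ?ef' //.
by rewrite -eproj_src -eproj_tgt -ef -ef' eproj_src eproj_tgt.
Qed.

Lemma plot_tensor d (U : set 'rV[K]_d) (e : 'rV[K]_d -> E) (f : 'rV[K]_d -> F)
    (p : 'rV[K]_d -> tensor E F) : plot E U e -> plot F U f ->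
  (forall u, U u -> exists ef, p u = @tensor_pair (e u) (f u) ef) ->
  plot (tensor E F) U p.
Proof.
move=> pE pF H; split; first exact: plot_open pE.
move=> u Uu; have [ef0 _] := H u Uu.
pose x0 : tensor_pre E F := exist _ (e u, f u) ef0.
have qE v : U v -> sval (sub_of x0 (e v, f v)) = (e v, f v).
  by move=> Uv; apply: sub_ofE; have [] := H v Uv.
exists U, (fun v => sub_of x0 (e v, f v)); split => // [|v Uv].
  by apply: (@plot_eq _ (prodD E F) _ _ _ (fun v => (e v, f v))).
by have [ef ->] := H v Uv; rewrite tensor_pairE.
Qed.

(** This is the quotient diffeology: smoothness of a map out of the tensor product is tested on
    local lifts. *)
Lemma tensor_plot_lift d (U : set 'rV[K]_d) (p : 'rV[K]_d -> tensor E F) u :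
  plot (tensor E F) U p -> U u -> exists V e f,
  [/\ V u, plot E V e, plot F V f &
     forall v, V v -> exists ef, p v = @tensor_pair (e v) (f v) ef].
Proof.
move=> [oU H] Uu; have [V [q [Vu [qE qF] pq]]] := H u Uu.
exists V, (fun v => (sval (q v)).1), (fun v => (sval (q v)).2); split => //.
move=> v Vv; exists (svalP (q v)); rewrite pq //; congr quot_class.
by apply: sval_inj; rewrite /= -surjective_pairing.
Qed.

Lemma weak_tensor : weak_extension circle (tensor E F).
Proof.
have [dE [dEA dEa dEu dEs]] := wx_div wE; have [dF [dFA dFa dFu dFs]] := wx_div wF.
split.
- move=> d U p pt _; apply: plot_local; first exact: plot_open pt.
  move=> u Uu; have [V [e [f [Vu pe pf H]]]] := tensor_plot_lift pt Uu.
  exists V => //; apply: (@plot_eq _ G _ _ _ (fun v => eproj (e v))).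
    by move=> v /H[ef /= ->]; exact: tensor_eproj.
  exact: (wx_proj_smooth wE pe).
- move=> t s; have [e [f [ef ->]]] := tensor_surj t.
  have [e' [f' [ef' ->]]] := tensor_surj s.
  rewrite tensor_src tensor_tgt => ee'.
  rewrite (tensor_mulE _ _ (tensor_mul_proj ef ef' ee')) // !tensor_eproj.
  exact: (wx_proj_mul wE).
- move=> d U p [pC pt] HP; apply: plot_local; first exact: plot_open pC.
  move=> u Uu; have [V [e [f [Vu pe pf H]]]] := tensor_plot_lift pt Uu.
  have oUV : open (U `&` V) by apply: openI; [exact: plot_open pC|exact: plot_open pe].
  exists (U `&` V) => //.
  apply: (@plot_tensor d _ (fun v => eact (p v).1 (e v)) f).
  + apply: (wx_act_smooth wE (p := fun v => ((p v).1, e v))) => [|v [Uv _]]; last exact: HP.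
    by split; [apply: plot_sub pC => // v []|apply: plot_sub pe => // v []].
  + by apply: plot_sub pf => // v [].
  + move=> v [Uv /H[ef /= ev]].
    have H' : eproj (eact (p v).1 (e v)) = eproj (f v).
      by rewrite (wx_act_proj wE) //; exact: HP.
    by exists H'; rewrite ev; apply: tensor_actE; exact: HP.
- move=> t; have [e [f [ef ->]]] := tensor_surj t.
  have H : eproj (eact 1 e) = eproj f by rewrite (wx_act1 wE).
  rewrite (tensor_actE ef H); last exact: circle1.
  apply/tensor_pairP; exists 1; rewrite invr1 (wx_act1 wF) !(wx_act1 wE).
  by split=> //; exact: circle1.
- move=> a b t ca cb; have [e [f [ef ->]]] := tensor_surj t.
  have cab := circleM ca cb.
  have H1 : eproj (eact (a * b) e) = eproj f by rewrite (wx_act_proj wE).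
  have H2 : eproj (eact b e) = eproj f by rewrite (wx_act_proj wE).
  have H3 : eproj (eact a (eact b e)) = eproj f by rewrite !(wx_act_proj wE).
  rewrite (tensor_actE ef H1) // (tensor_actE ef H2) // (tensor_actE H2 H3) //.
  apply/tensor_pairP; exists 1.
  by rewrite invr1 (wx_act1 wF) (wx_act1 wE) (wx_actM wE) //; split=> //; exact: circle1.
- move=> a t ca; have [e [f [ef ->]]] := tensor_surj t.
  have H : eproj (eact a e) = eproj f by rewrite (wx_act_proj wE).
  by rewrite (tensor_actE ef H) // !tensor_eproj (wx_act_proj wE).
- move=> a b t s ca cb; have [e [f [ef ->]]] := tensor_surj t.
  have [e' [f' [ef' ->]]] := tensor_surj s.
  rewrite tensor_src tensor_tgt => ee'.
  have H : eproj (eact a e) = eproj f by rewrite (wx_act_proj wE).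
  have H' : eproj (eact b e') = eproj f' by rewrite (wx_act_proj wE).
  have aee' : src (eact a e) = tgt (eact b e').
    by rewrite -eproj_src -eproj_tgt !(wx_act_proj wE) // eproj_src eproj_tgt.
  have cab := circleM ca cb.
  have H3 := tensor_mul_proj ef ef' ee'.
  have H4 : eproj (eact (a * b) (mul e e')) = eproj (mul f f') by rewrite (wx_act_proj wE).
  rewrite (tensor_actE ef H) // (tensor_actE ef' H') //.
  rewrite (tensor_mulE H H' (tensor_mul_proj H H' aee')) // (tensor_mulE ef ef' H3) //.
  rewrite (tensor_actE H3 H4) //; apply/tensor_pairP; exists 1.
  rewrite invr1 (wx_act1 wF) (wx_act1 wE) (wx_central wE) //.
  by split=> //; exact: circle1.
- move=> g; have [V [s [oV Vg sV ps]]] := wx_section wE g.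
  have [W [s' [oW Wg sW ps']]] := wx_section wF g.
  have ef0 : eproj (s g) = eproj (s' g) by rewrite ps // ps'.
  pose x0 : tensor_pre E F := exist _ (s g, s' g) ef0.
  have qE h : V h -> W h -> exists ef, quot_class (@tensor_rel K M G E F)
      (sub_of x0 (s h, s' h)) = @tensor_pair (s h) (s' h) ef.
    move=> Vh Wh; have ef : eproj (s h) = eproj (s' h) by rewrite ps // ps'.
    by exists ef; exact: tensor_pairE.
  exists (V `&` W), (fun h => quot_class (@tensor_rel K M G E F) (sub_of x0 (s h, s' h))).
  split => //; first exact: D_openI.
    move=> d U p pG HP; apply: (@plot_tensor d _ (s \o p) (s' \o p)).
    + by apply: sV => // u /HP[].
    + by apply: sW => // u /HP[].
    + by move=> u /HP[]; exact: qE.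
  by move=> h [Vh Wh]; have [ef ->] := qE h Vh Wh; rewrite tensor_eproj ps.
(* Replacing the representatives (e, f) and (e', f') by (a e, a^-1 f) and (b e', b^-1 f') multiplies
   the first division by b / a and the second by a / b, so the product is well defined. *)
- pose dv (t s : tensor E F) :=
    dE (sval (quot_repr (t : quot (@tensor_rel K M G E F)))).1
       (sval (quot_repr (s : quot (@tensor_rel K M G E F)))).1 *
    dF (sval (quot_repr (t : quot (@tensor_rel K M G E F)))).2
       (sval (quot_repr (s : quot (@tensor_rel K M G E F)))).2.
  have dvE e f ef e' f' ef' : eproj e = eproj e' ->
      dv (@tensor_pair e f ef) (@tensor_pair e' f' ef') = dE e e' * dF f f'.
    move=> ee'; have ff' : eproj f = eproj f' by rewrite -ef -ef'.
    have [a [ca Ea]] := tensor_repr ef; have [b [cb Eb]] := tensor_repr ef'.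
    rewrite /dv Ea Eb /= (division_act wE) // (division_act wF) //; try exact: circleV.
    have a0 := circle_neq0 ca; have b0 := circle_neq0 cb.
    by field; rewrite a0 b0.
  exists dv; split.
  + move=> t s; have [e [f [ef ->]]] := tensor_surj t.
    have [e' [f' [ef' ->]]] := tensor_surj s; rewrite !tensor_eproj => ee'.
    rewrite dvE //; apply: circleM; [exact: dEA|apply: dFA].
    by rewrite -ef -ef'.
  + move=> t s; have [e [f [ef ->]]] := tensor_surj t.
    have [e' [f' [ef' ->]]] := tensor_surj s; rewrite !tensor_eproj => ee'.
    have ff' : eproj f = eproj f' by rewrite -ef -ef'.
    have c1 := dEA _ _ ee'; have c2 := dFA _ _ ff'; have c := circleM c1 c2.
    have H : eproj (eact (dE e e' * dF f f') e) = eproj f by rewrite (wx_act_proj wE).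
    rewrite dvE // (tensor_actE ef H) //; apply/tensor_pairP.
    exists (dF f f')^-1; split; first exact: circleV.
      rewrite -(wx_actM wE) //; last exact: circleV.
      by rewrite mulrCA mulVf ?mulr1 ?dEa // circle_neq0.
    by rewrite invrK dFa.
  + move=> a t ca; have [e [f [ef ->]]] := tensor_surj t.
    have H : eproj (eact a e) = eproj f by rewrite (wx_act_proj wE).
    rewrite (tensor_actE ef H) // dvE ?(wx_act_proj wE) // dEu //.
    by rewrite -[X in dF f X](wx_act1 wF) dFu ?mulr1 //; exact: circle1.
  + move=> d U p [pt ps] HP; apply: plot_local; first exact: plot_open pt.
    move=> u Uu; have [V [e [f [Vu pe pf H]]]] := tensor_plot_lift pt Uu.
    have [W [e' [f' [Wu pe' pf' H']]]] := tensor_plot_lift ps Uu.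
    have oUVW : open (U `&` (V `&` W)).
      apply: openI; first exact: plot_open pt.
      by apply: openI; [exact: plot_open pe|exact: plot_open pe'].
    exists (U `&` (V `&` W)) => //.
    have ee' v : (U `&` (V `&` W)) v -> eproj (e v) = eproj (e' v).
      move=> [Uv [/H[ef /= Et] /H'[ef' /= Es]]].
      have : eproj (p v).1 = eproj (p v).2 := HP v Uv.
      by rewrite Et Es !tensor_eproj.
    have ff' v : (U `&` (V `&` W)) v -> eproj (f v) = eproj (f' v).
      move=> Hv; have := ee' v Hv; case: Hv => [_ [/H[ef _] /H'[ef' _]]].
      by rewrite ef ef'.
    apply: (@plot_eq _ complexD _ _ _ (fun v => dE (e v) (e' v) * dF (f v) (f' v))).
      move=> v Hv; have e0 := ee' v Hv; case: Hv => [_ [/H[ef /= Et] /H'[ef' /= Es]]].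
      by rewrite /= Et Es dvE.
    apply: plot_cmul.
      apply: (dEs d _ (fun v => (e v, e' v))) => //; split.
        by apply: plot_sub pe => // v [_ []].
      by apply: plot_sub pe' => // v [_ []].
    apply: (dFs d _ (fun v => (f v, f' v))) => //; split.
      by apply: plot_sub pf => // v [_ []].
    by apply: plot_sub pf' => // v [_ []].
Qed.
End Tensor.
End Extensions.
Arguments circle1 {K}.

(** * Tensor powers *)

Section Power.
Variable K : realType.
Local Notation C := (complex K).
Local Notation dspace := (dspace K).
Local Notation complexD := (complexD K).
Local Notation circle := (@circle K).

(** The properties of the diagonal map that are used later. Isolating them allows [T] to be the
    pull-back of a tensor power. *)
Record is_power_map M (G : groupoid M) (E T : extension G) (n : nat)
    (P : E -> T) : Prop := {
  pm_smooth : smooth P;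
  pm_proj : forall r, eproj (P r) = eproj r;
  pm_mul : forall r s, src r = tgt s -> P (mul r s) = mul (P r) (P s);
  pm_act : forall a r, circle a -> P (eact a r) = eact (a ^+ n) (P r)
}.

Lemma tensor_succ_power M (G : groupoid M) (E : extension G) k :
  mul_typed G -> weak_extension circle E ->
  weak_extension circle (tensor_succ E k) /\
  exists P : E -> tensor_succ E k, is_power_map k.+1 P.
Proof.
move=> mG wE; elim: k => [|k [wT [P [Psm Pp PM Pa]]]].
  by split => //; exists id; split => // d U p.
split; first exact: weak_tensor.
(* The diagonal of the next power is P(r) tensor r. *)
exists (fun r => tensor_pair (Pp r)); split.
- move=> d U p pE _; apply: (plot_tensor (e := P \o p) (f := p)) => //.
    exact: Psm.
  by move=> u _; exists (Pp (p u)).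
- by move=> r; rewrite (tensor_eproj wT wE).
- move=> r s rs; have rs' : src (P r) = tgt (P s).
    by rewrite -eproj_src -eproj_tgt !Pp eproj_src eproj_tgt.
  have H : eproj (mul (P r) (P s)) = eproj (mul r s) by rewrite -PM.
  rewrite (tensor_mulE wT wE _ _ H) //; apply/(tensor_pairP wT wE).
  exists 1; rewrite invr1 (wx_act1 wT) (wx_act1 wE) PM //.
  by split=> //; exact: circle1.
- move=> a r ca; have c := circleX k.+2 ca; have c' := circleX k.+1 ca.
  have H : eproj (eact (a ^+ k.+2) (P r)) = eproj r by rewrite (wx_act_proj wT).
  rewrite (tensor_actE wT wE _ H) //; apply/(tensor_pairP wT wE).
  (* Moves [a] from the second factor to the first, which raises the exponent from k+1 to k+2. *)
  exists a; split => //; first by rewrite Pa // -(wx_actM wT) // -exprS.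
  by rewrite -(wx_actM wE) ?mulVf ?circle_neq0 ?(wx_act1 wE) //; exact: circleV.
Qed.

Lemma power_map_pullback (M N : dspace) (f : N -> M) (G : groupoid M) (E T : extension G) n
    (P : E -> T) : mul_typed G -> weak_extension circle E ->
  weak_extension circle T -> is_power_map n P ->
  exists P' : pullback_ext f E -> pullback_ext f T, is_power_map n P'.
Proof.
move=> mG wE wT [Psm Pp PM Pa].
have ok (x : pullback_ext f E) :
    tgt (P (sval x).2) = f (sval x).1.1 /\ src (P (sval x).2) = f (sval x).1.2.
  by rewrite -eproj_tgt -eproj_src Pp eproj_tgt eproj_src; exact: (svalP x).
exists (fun x => exist _ ((sval x).1, P (sval x).2) (ok x)); split.
- move=> d U p [pN pE] _; split; first exact: pN.
  exact: (Psm _ _ _ pE).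
- by move=> r; apply: sval_inj; rewrite /= Pp.
- move=> r s rs; apply: sval_inj.
  have mE := ext_mul_typed mG wE; have mT := ext_mul_typed mG wT.
  rewrite (pullback_mulE (G := T)) //= pullback_mulE //= PM //.
  have [_ e] := svalP r; have [e' _] := svalP s.
  by rewrite e e'; congr f; exact: rs.
- move=> a r ca; apply: sval_inj; have c := circleX n ca.
  rewrite (pullback_actE _ wT) //= (pullback_actE _ wE) //=.
  by rewrite Pa.
Qed.

Definition is_degree_hom M (G : groupoid M) (E : extension G) n (psi : E -> complexD) :=
  [/\ smooth psi, (forall r, psi r != 0 :> C),
      (forall r s, src r = tgt s -> psi (mul r s) = (psi r : C) * psi s) &
      (forall a r, circle a -> psi (eact a r) = a ^+ n * (psi r : C))].

Section Trivial.
Variables (M : dspace) (G : groupoid M) (E T : extension G) (n : nat) (P : E -> T).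
Hypothesis mG : mul_typed G.
Hypothesis wE : weak_extension circle E.
Hypothesis wT : weak_extension circle T.
Hypothesis Ppow : is_power_map n P.

(** The circle coordinate of the trivialisation is an equivariant homomorphism on [T]; composing it
    with [P] turns degree 1 into degree [n]. *)
Lemma trivial_degree_hom : strictly_trivial T ->
  exists psi : E -> complexD, is_degree_hom n psi.
Proof.
move=> [f [[g [fsm _ _ _]] fp fM fa]]; have [Psm Pp PM Pa] := Ppow.
have cf r : circle (sval (f r).2) by exact: (svalP (f r).2).
exists (fun r => sval (f (P r)).2); split.
- move=> d U p pE HP; have pT := Psm d U p pE HP.
  by have [_ ] := fsm d U _ pT HP.
- by move=> r; apply: circle_neq0.
- move=> r s rs; rewrite PM // fM; last first.
    by rewrite -eproj_src -eproj_tgt !Pp eproj_src eproj_tgt.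
  by rewrite /= sub_ofE //; exact: circleM.
- move=> a r ca; have c := circleX n ca.
  rewrite Pa // fa //= sub_ofE //; exact: circleM.
Qed.

(* Over [eproj r], every point of [T] is [lam P(r)] for a unique [lam] in the
   circle; then [lam psi(r)], normalised, does not depend on [r]. *)
Lemma degree_hom_trivial (psi : E -> complexD) :
  is_degree_hom n psi -> strictly_trivial T.
Proof.
move=> [psm psi0 psiM psia]; have [Psm Pp PM Pa] := Ppow.
have [dT HdT] := wx_div wT; have [dTA dTa dTu dTs] := HdT.
have [dE HdE] := wx_div wE; have [dEA dEa dEu dEs] := HdE.
(* The lifts are chosen without smoothness. Since [L] below does not depend on the lift, local
   smooth sections replace it when smoothness is checked. *)
have /choice[lift liftP] : forall g : G, exists r : E, eproj r = g.
  by move=> g; have [V [s [_ Vg _ ps]]] := wx_section wE g; exists (s g); exact: ps.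
pose u r : C := normalize (psi r).
have cu r : circle (u r) by exact/normalize_circle/psi0.
have ua a r : circle a -> u (eact a r) = a ^+ n * u r.
  by move=> ca; rewrite /u psia // normalizeM normalize_id //; exact: circleX.
have uM r s : src r = tgt s -> u (mul r s) = u r * u s.
  by move=> rs; rewrite /u psiM // normalizeM.
(* For t = lam P(r) this is lam u(r). Passing from r to a r divides lam by a^n and multiplies u(r)
   by a^n. *)
pose L (t : T) (r : E) : C := dT (P r) t * u r.
have Lact t a r : circle a -> eproj r = eproj t -> L t (eact a r) = L t r.
  move=> ca rt; have cn := circleX n ca; have a0 := circle_neq0 cn.
  have Prt : eproj (P r) = eproj t by rewrite Pp.
  have := division_act wT HdT cn circle1 Prt.
  by rewrite (wx_act1 wT) /L Pa // ua // => ->; field.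
have Lr t r s : eproj r = eproj t -> eproj s = eproj t -> L t r = L t s.
  move=> rt st; have rs : eproj r = eproj s by rewrite rt.
  by rewrite -(dEa _ _ rs) Lact //; exact: dEA.
have La t a r : circle a -> eproj r = eproj t -> L (eact a t) r = a * L t r.
  move=> ca rt; have Prt : eproj (P r) = eproj t by rewrite Pp.
  have := division_act wT HdT circle1 ca Prt.
  by rewrite (wx_act1 wT) /L divr1 => ->; rewrite mulrAC mulrC.
have cL t r : eproj r = eproj t -> circle (L t r).
  by move=> rt; apply: circleM => //; apply: dTA; rewrite Pp.
have LM t t' r r' : eproj r = eproj t -> eproj r' = eproj t' -> src t = tgt t' ->
    L (mul t t') (mul r r') = L t r * L t' r'.
  move=> rt rt' tt'; have Prt : eproj (P r) = eproj t by rewrite Pp.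
  have Prt' : eproj (P r') = eproj t' by rewrite Pp.
  have rr' : src r = tgt r' by rewrite -eproj_src -eproj_tgt rt rt' eproj_src eproj_tgt.
  have Prr' : src (P r) = tgt (P r').
    by rewrite -eproj_src -eproj_tgt !Pp eproj_src eproj_tgt.
  have c1 := dTA _ _ Prt; have c2 := dTA _ _ Prt'; have c := circleM c1 c2.
  have E1 : mul t t' = eact (dT (P r) t * dT (P r') t') (P (mul r r')).
    by rewrite PM // -(wx_central wT) // !dTa.
  by rewrite /L E1 dTu // uM // mulrACA.
pose x1 : circleD K := exist _ 1 circle1.
pose f (t : T) : trivial_ext G := (eproj t, sub_of x1 (L t (lift (eproj t)))).
have fE t r : eproj r = eproj t -> f t = (eproj t, sub_of x1 (L t r)).
  by move=> rt; rewrite /f (Lr _ _ r) // liftP.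
(* The inverse of [f]: over an arrow lifted by r, the point with circle coordinate z is lam P(r)
   with lam = z / u(r). *)
pose h (x : trivial_ext G) : T := eact (sval x.2 / u (lift x.1)) (P (lift x.1)).
have hE (x : trivial_ext G) r : eproj r = x.1 -> h x = eact (sval x.2 / u r) (P r).
  move=> rx; have rl : eproj r = eproj (lift x.1) by rewrite liftP.
  have c := dEA _ _ rl; have cn := circleX n c.
  have cV := circleV (cu (lift x.1)); have cx := circleM (svalP x.2) cV.
  rewrite /h -(dEa _ _ rl) Pa // -(wx_actM wT) // ?ua //.
    congr eact; have := circle_neq0 cn; have := circle_neq0 (cu r) => n1 n2.
    by field; rewrite n1 n2.
  by rewrite -ua // dEa.
exists f; split => //.
- exists h; split => //.
  + move=> d U p pT HP; have pG := wx_proj_smooth wT pT HP.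
    apply: plot_local; first exact: plot_open pT.
    move=> v Uv; have [V [s [oV Vv sV ps]]] := wx_section wE (eproj (p v)).
    have oUV : open (U `&` (eproj (e := T) \o p) @^-1` V) by exact: oV.
    exists (U `&` (eproj (e := T) \o p) @^-1` V) => //.
    have pG' := plot_sub oUV (@subIsetl _ _ _) pG.
    have pT' := plot_sub oUV (@subIsetl _ _ _) pT.
    have pE' : plot E (U `&` (eproj (e := T) \o p) @^-1` V) (s \o (eproj (e := T) \o p)).
      by apply: sV pG' _ => w [].
    split; first exact: pG'.
    apply: (@plot_eq _ complexD _ _ _ (fun w => L (p w) (s (eproj (p w))))).
      move=> w [Uw Vw]; have e : eproj (s (eproj (p w))) = eproj (p w) by exact: ps.
      by rewrite -[LHS]/(sval (f (p w)).2) (fE _ _ e) sub_ofE //; exact: cL.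
    apply: plot_cmul.
      apply: (dTs d _ (fun w => (P (s (eproj (p w))), p w))).
        by split => //; apply: (Psm _ _ _ pE').
      by move=> w [Uw Vw] /=; rewrite Pp ps.
    by apply: plot_normalize => [w _|]; [exact: psi0|exact: (psm _ _ _ pE')].
  + move=> d U p [pG pC] HP; apply: plot_local; first exact: plot_open pG.
    move=> v Uv; have [V [s [oV Vv sV ps]]] := wx_section wE (p v).1.
    have oUV : open (U `&` (fst \o p) @^-1` V) by exact: oV.
    exists (U `&` (fst \o p) @^-1` V) => //.
    have pG' := plot_sub oUV (@subIsetl _ _ _) pG.
    have pC' : plot complexD _ _ := plot_sub oUV (@subIsetl _ _ _) pC.
    have pE' : plot E (U `&` (fst \o p) @^-1` V) (s \o (fst \o p)).
      by apply: sV pG' _ => w [].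
    apply: (@plot_eq _ T _ _ _
      (fun w => eact (sval (p w).2 / u (s (p w).1)) (P (s (p w).1)))).
      by move=> w [Uw Vw]; rewrite /= (hE _ (s (p w).1)) //; exact: ps.
    apply: (wx_act_smooth wT
      (p := fun w => (sval (p w).2 / u (s (p w).1), P (s (p w).1)))).
      split; last exact: (Psm _ _ _ pE').
      apply: plot_cmul => //; apply: plot_cinv => [w _|]; first exact: circle_neq0.
      by apply: plot_normalize => [w _|]; [exact: psi0|exact: (psm _ _ _ pE')].
    by move=> w _ /=; apply: circleM; [exact: (svalP (p w).2)|exact: circleV].
  + move=> t _; split => //; have lt := liftP (eproj t).
    rewrite (hE _ (lift (eproj t))) // /f /= sub_ofE; last exact: cL.
    rewrite /L mulfK ?circle_neq0 //; apply: dTa.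
    by rewrite Pp.
  + move=> [g z] _; split => //; have cz := svalP z.
    have c := circleM cz (circleV (cu (lift g))).
    have e : eproj (h (g, z)) = g by rewrite /h (wx_act_proj wT) // Pp liftP.
    rewrite (fE _ (lift g)) ?liftP ?e //; congr pair; apply: sval_inj.
    by rewrite sub_ofE ?cL ?e ?liftP // /L /h dTu //= mulfVK // circle_neq0.
- move=> t t' tt'; have lt := liftP (eproj t); have lt' := liftP (eproj t').
  have rr' : src (lift (eproj t)) = tgt (lift (eproj t')).
    by rewrite -eproj_src -eproj_tgt lt lt' eproj_src eproj_tgt.
  have e : eproj (mul (lift (eproj t)) (lift (eproj t'))) = eproj (mul t t').
    by rewrite (wx_proj_mul wE) // (wx_proj_mul wT) // lt lt'.
  rewrite (fE _ _ e) LM // (wx_proj_mul wT) //.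
  congr pair; apply: sval_inj; have c := circleM (cL _ _ lt) (cL _ _ lt').
  by rewrite /= !sub_ofE //; exact: cL.
- move=> a t ca; have lt := liftP (eproj t); have c := circleM ca (cL _ _ lt).
  have e : eproj (lift (eproj t)) = eproj (eact a t) by rewrite (wx_act_proj wT).
  rewrite (fE _ _ e) La //.
  congr pair; first exact: (wx_act_proj wT).
  apply: sval_inj; have cl := cL _ _ lt.
  by rewrite /= !sub_ofE //.
Qed.
End Trivial.

(** Triviality concerns the pull-back of the power, not the power of the pull-back. The diagonal is
    therefore built over [G] and then pulled back, and the same cover serves in both directions. *)
Lemma degree_hom_iff_trivial (M : dspace) (G : groupoid M) (R : extension G) n :
  (0 < n)%N -> mul_typed G -> weak_extension circle R ->
  has_degree_hom R n <-> is_trivial (tensor_succ R n.-1).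
Proof.
move=> n0 mG wR; have [wT [P HP]] := tensor_succ_power n.-1 mG wR.
rewrite prednK // in HP.
split=> -[I [U [cU]]].
  move=> [psi Hpsi]; exists I, U; split => //.
  have [P' HP'] := power_map_pullback (@cover_map K M I U) mG wR wT HP.
  by apply: (degree_hom_trivial _ _ HP' Hpsi); apply: weak_pullback.
move=> tr; exists I, U; split => //.
have [P' HP'] := power_map_pullback (@cover_map K M I U) mG wR wT HP.
exact: (trivial_degree_hom HP' tr).
Qed.
End Power.

(** * Reduction to the roots of unity *)

Section Roots.
Variable K : realType.
Local Notation C := (complex K).
Local Notation complexD := (complexD K).
Local Notation circle := (@circle K).

Definition cis (t : K) : C := (cos t +i* sin t)%C.

Lemma cis_circle t : circle (cis t).
Proof. by rewrite /circle /= normc_def /= cos2Dsin2 sqrtr1. Qed.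

Lemma cisX t k : cis t ^+ k = cis (t *+ k).
Proof.
elim: k => [|k IH]; first by rewrite expr0 mulr0n /cis cos0 sin0.
rewrite exprS IH mulrS /cis cosD sinD; apply/eqP; rewrite eq_complex /=.
by rewrite eqxx /= addrC.
Qed.

(** On the right half-plane the argument is the arctangent of Im / Re, an explicit smooth branch. *)
Lemma normalize_cis_atan (z : C) : 0 < complex.Re z ->
  normalize z = cis (atan (complex.Im z / complex.Re z)).
Proof.
case: z => x y /= x0; set t := atan _.
have c0 : 0 < cos t by rewrite cos_atan invr_gt0 sqrtr_gt0 ltr_pwDl // sqr_ge0.
have r0 : 0 < x / cos t by rewrite divr_gt0.
have cn0 : cos t != 0 by rewrite gt_eqF.
have xn0 : x != 0 by rewrite gt_eqF.
have -> : (x +i* y)%C = (x / cos t)%:C%C * cis t.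
  apply/eqP; rewrite eq_complex /= !mul0r subr0 addr0 divfK // eqxx /=.
  rewrite -mulrA [_^-1 * _]mulrC -/(tan t) /t atanK mulrC divfK //.
rewrite normalizeM (normalize_id (cis_circle t)) /normalize.
rewrite normc_def /= expr0n /= addr0 sqrtr_sqr (gtr0_norm r0) divff ?mul1r //.
by rewrite eq_complex /= negb_and gt_eqF.
Qed.

Lemma smooth_cis_atan n :
  smooth_on (X := complexD) (Y := complexD) [set z | 0 < complex.Re z]
    (fun z => cis (atan (complex.Im z / complex.Re z) / n%:R)).
Proof.
move=> d U p /plot_complexP[oU pR pI] HP.
have Ct k : Ck k U (fun u => atan (complex.Im (p u) / complex.Re (p u)) / n%:R).
  apply: Ck_mul => //; last exact: Ck_cst.
  apply: Ck_atan => //; apply: Ck_mul => //; apply: Ck_inv => // u /HP /= p0.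
  by rewrite gt_eqF.
by apply/plot_complexP; split => // k; have [] := Ck_cos_sin oU (Ct k).
Qed.

Lemma circle_root n (z : C) : (0 < n)%N -> circle z ->
  exists2 c, circle c & c ^+ n = z.
Proof.
move=> n0 cz; exists (n.-root z); last exact: rootCK.
rewrite /circle /=; apply/eqP.
by rewrite -(@pexpr_eq1 _ _ n) // -normrX rootCK // cz.
Qed.

(** The quotient z / z0 stays in the right half-plane for z near z0. There its argument is smooth
    and can be divided by [n]; the result is multiplied by a fixed root [c] at z0. *)
Lemma smooth_local_root n (z0 : C) : (0 < n)%N -> z0 != 0 ->
  exists (O : set C) (rho : C -> C),
  [/\ D_open (X := complexD) O, O z0,
      smooth_on (X := complexD) (Y := complexD) O rho &
      forall z, O z -> circle (rho z) /\ rho z ^+ n = normalize z].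
Proof.
move=> n0 z00; have [c cc cn] := circle_root n0 (normalize_circle z00).
have Hdiv : smooth (X := complexD) (Y := complexD) (fun z => z / z0).
  move=> d U p Hp _; apply: plot_cmul => //.
  by apply: plot_ccst; exact: plot_open Hp.
exists [set z | 0 < complex.Re (z / z0)].
exists (fun z => c * cis (atan (complex.Im (z / z0) / complex.Re (z / z0)) / n%:R)).
split.
- exact: (D_open_preimT Hdiv (@D_open_complex_Re_gt0 K)).
- by rewrite /= divff.
- move=> d U p Hp HP; apply: plot_cmul.
    by apply: plot_ccst; exact: plot_open Hp.
  apply: (smooth_cis_atan n (p := fun u => p u / z0)) => //.
  exact: Hdiv.
- move=> z /= z1; split; first by apply: circleM => //; exact: cis_circle.
  rewrite exprMn cn cisX -[X in cis X]mulr_natr divfK; last first.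
    by rewrite pnatr_eq0 -lt0n.
  by rewrite -normalize_cis_atan // -normalizeM mulrC divfK.
Qed.
End Roots.

(** * The extension by roots of unity cut out by a function of degree n *)

Section Reduction.
Variable K : realType.
Local Notation C := (complex K).
Local Notation dspace := (dspace K).
Local Notation complexD := (complexD K).
Local Notation circleD := (circleD K).
Local Notation circle := (@circle K).
Variables (n : nat) (M : dspace) (G : groupoid M) (E : extension G).
Variable psi : E -> complexD.
Hypothesis n0 : (0 < n)%N.
Hypothesis mG : mul_typed G.
Hypothesis wE : weak_extension circle E.
Hypothesis Hpsi : is_degree_hom n psi.

Let u (r : E) : C := normalize (psi r).

(** The condition [u r = 1] says that psi(r) is a positive real; in this form it is the kernel of a
    homomorphism to the circle. *)
Definition kernel : set E := [set r | u r = 1].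

Definition kernel_groupoid : groupoid M :=
  @Groupoid K M (subD kernel) (fun x => src (sval x)) (fun x => tgt (sval x))
    (fun x y => sub_of x (mul (sval x) (sval y))).

Definition kernel_ext : extension G :=
  @Extension K M G kernel_groupoid (fun x => eproj (sval x))
    (fun a x => sub_of x (eact a (sval x)))
    (fun x => eproj_src (sval x)) (fun x => eproj_tgt (sval x)).

Lemma mu_circle (a : C) : mu n a -> circle a.
Proof.
by move=> an; apply/eqP; rewrite -(@pexpr_eq1 _ _ n) // -normrX an normr1.
Qed.

Let cu r : circle (u r).
Proof. by apply: normalize_circle; case: Hpsi. Qed.

Let ua a r : circle a -> u (eact a r) = a ^+ n * u r.
Proof.
move=> ca; have [_ _ _ psia] := Hpsi.
by rewrite /u psia // normalizeM normalize_id //; exact: circleX.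
Qed.

Let uM r s : src r = tgt s -> u (mul r s) = u r * u s.
Proof. by move=> rs; have [_ _ psiM _] := Hpsi; rewrite /u psiM // normalizeM. Qed.

Lemma kernel_mulE (x y : kernel_ext) : src x = tgt y ->
  sval (mul x y) = mul (sval x) (sval y).
Proof.
move=> xy; apply: sub_ofE; rewrite /kernel /= uM //.
by rewrite (svalP x) (svalP y) mulr1.
Qed.

Lemma kernel_actE a (x : kernel_ext) : mu n a ->
  sval (eact a x) = eact a (sval x).
Proof.
move=> an; apply: sub_ofE; rewrite /kernel /= ua; last exact: mu_circle.
by rewrite an (svalP x) mulr1.
Qed.

Lemma mu1 : mu n (1 : C). Proof. by rewrite /mu /= expr1n. Qed.
Lemma muM (a b : C) : mu n a -> mu n b -> mu n (a * b).
Proof. by rewrite /mu /= exprMn => -> ->; rewrite mulr1. Qed.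
Lemma muV (a : C) : mu n a -> mu n a^-1.
Proof. by rewrite /mu /= exprVn => ->; rewrite invr1. Qed.

Lemma weak_kernel : weak_extension (mu n) kernel_ext.
Proof.
have [dv [dvA dva dvu dvs]] := wx_div wE.
split.
- by move=> d U p pE HP; exact: (wx_proj_smooth wE pE).
- move=> x y xy; rewrite -[LHS]/(eproj (sval (mul x y))) kernel_mulE //.
  exact: (wx_proj_mul wE).
- move=> d U p [pC pE] HP; apply: (@plot_eq _ E _ _ _ (fun v => eact (p v).1 (sval (p v).2))).
    by move=> v /HP /= mv; exact: kernel_actE.
  apply: (wx_act_smooth wE (p := fun v => ((p v).1, sval (p v).2))) => // v /HP.
  exact: mu_circle.
- by move=> x; apply: sval_inj; rewrite kernel_actE ?(wx_act1 wE) //; exact: mu1.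
- move=> a b x ma mb; apply: sval_inj; have mab := muM ma mb.
  by rewrite !kernel_actE // (wx_actM wE) //; exact: mu_circle.
- move=> a x ma; rewrite -[LHS]/(eproj (sval (eact a x))) kernel_actE //.
  by rewrite (wx_act_proj wE) //; exact: mu_circle.
- move=> a b x y ma mb xy; apply: sval_inj; have mab := muM ma mb.
  have ca := mu_circle ma; have cb := mu_circle mb.
  have axby : src (eact a x) = tgt (eact b y).
    rewrite -[LHS]/(src (sval (eact a x))) -[RHS]/(tgt (sval (eact b y))).
    rewrite !kernel_actE // -eproj_src -eproj_tgt !(wx_act_proj wE) //.
    by rewrite eproj_src eproj_tgt.
  by rewrite (kernel_mulE axby) !kernel_actE // kernel_mulE // (wx_central wE).
- move=> g; have [V [s [oV Vg sV ps]]] := wx_section wE g.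
  have [psm psi0 _ _] := Hpsi.
  have [W [rho [oO Oz rsm Hrho]]] := smooth_local_root n0 (psi0 (s g)).
  (* The section is divided by a local n-th root of u(s h). As u has degree [n], the corrected
     section satisfies u = 1. *)
  pose s' h := eact (rho (psi (s h)))^-1 (s h).
  have sker h : W (psi (s h)) -> u (s' h) = 1.
    move=> /Hrho[cr rn]; rewrite /s' ua; last exact: circleV.
    by rewrite exprVn rn mulVf // circle_neq0 //; exact: cu.
  pose x0 : kernel_ext := exist _ (s' g) (sker g Oz).
  have smps : smooth_on (Y := complexD) V (psi \o s).
    by move=> d U p pG HP; apply: psm => //; exact: sV.
  exists (V `&` (psi \o s) @^-1` W), (fun h => sub_of x0 (s' h)); split => //.
  + exact: D_open_preim.
  + move=> d U p pG HP; apply: (@plot_eq _ E _ _ _ (s' \o p)).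
      by move=> v /HP[_ Ov]; apply: sub_ofE; apply: (sker _ Ov).
    have pV v : U v -> V (p v) by move=> /HP[].
    have pO v : U v -> W (psi (s (p v))) by move=> /HP[].
    apply: (wx_act_smooth wE (p := fun v => ((rho (psi (s (p v))))^-1, s (p v)))).
      split; last exact: sV.
      apply: plot_cinv => [v /pO /Hrho[/circle_neq0]//|].
      by apply: rsm => //; exact: smps.
    by move=> v /pO /Hrho[cr _] /=; exact: circleV.
  + move=> h [Vh Oh]; rewrite -[LHS]/(eproj (sval (sub_of x0 (s' h)))).
    rewrite sub_ofE; last by apply: (sker _ Oh).
    have [cr _] := Hrho _ Oh.
    by rewrite /s' (wx_act_proj wE) ?ps //; exact: circleV.
(* If a carries x to y and u equals 1 at both, then a^n = 1; so the division of [E] restricts. *)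
- have dvmu (x y : kernel_ext) : eproj x = eproj y -> mu n (dv (sval x) (sval y)).
    move=> xy; have := ua (sval x) (dvA _ _ xy); rewrite dva //.
    by rewrite (svalP x) (svalP y) mulr1.
  exists (fun x y => dv (sval x) (sval y)); split => //.
  + move=> x y xy; apply: sval_inj; rewrite kernel_actE; last exact: dvmu.
    exact: dva.
  + by move=> a x ma; rewrite kernel_actE // dvu //; exact: mu_circle.
  + move=> d U p [pE pF] HP.
    by apply: (dvs d U (fun v => (sval (p v).1, sval (p v).2))).
Qed.

Local Notation irel := (@induced_rel K n M G kernel_ext).
Local Notation irep a := (quot_repr (a : quot irel)).

(** The map [x, l] -> l x, computed on the chosen representative; [J_class] shows that any
    representative may be used. *)
Let J (t : induced_ext n kernel_ext) : E := eact (sval (irep t).2) (sval (irep t).1).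

Let induced_classP (x y : prodD kernel_ext circleD) :
  quot_class irel x = quot_class irel y <-> irel x y.
Proof.
apply: quot_classP.
- move=> z; exists 1; split; first exact: mu1.
  by rewrite invr1 mul1r (wx_act1 weak_kernel).
- move=> z w [a [ma [e1 e2]]]; exists a^-1; split; first exact: muV.
  have mV := muV ma; have a0 := circle_neq0 (mu_circle ma).
  by rewrite e1 e2 -(wx_actM weak_kernel) // mulVf // (wx_act1 weak_kernel) invrK mulVKf.
- move=> z w v [a [ma [e1 e2]]] [b [mb [e3 e4]]]; exists (b * a); split; first exact: muM.
  by rewrite e3 e1 e4 e2 (wx_actM weak_kernel) // mulrA -invfM.
Qed.

Let J_class x l : J (quot_class irel (x, l)) = eact (sval l) (sval x).
Proof.
have := quot_reprK (quot_class irel (x, l)); rewrite /J.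
case: (quot_repr _) => x' l' /induced_classP[a [ma [/= e1 e2]]].
have ca := mu_circle ma; have c := circleM (circleV ca) (svalP l').
rewrite e1 e2 kernel_actE // -(wx_actM wE) //.
by rewrite mulrAC mulVf ?mul1r // circle_neq0.
Qed.

Let induced_surj (t : induced_ext n kernel_ext) : exists x l, t = quot_class irel (x, l).
Proof.
by rewrite -[t](quot_reprK (r := irel)); case: (quot_repr _) => x l; exists x, l.
Qed.

(** From l x = l' x' follows x' = (l / l') x, and applying u gives (l / l')^n = 1, so the two pairs
    are related by a root of unity. *)
Let J_inj : injective J.
Proof.
move=> t t'; have [x [l ->]] := induced_surj t; have [x' [l' ->]] := induced_surj t'.
rewrite !J_class => e; apply/induced_classP.
have cl := svalP l; have cl' := svalP l'; have cV := circleV cl'.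
have l0 := circle_neq0 cl; have l0' := circle_neq0 cl'; have c := circleM cV cl.
have e' : sval x' = eact ((sval l')^-1 * sval l) (sval x).
  by rewrite (wx_actM wE) // e -(wx_actM wE) // mulVf // (wx_act1 wE).
have m : mu n ((sval l')^-1 * sval l).
  by have := ua (sval x) c; rewrite -e' (svalP x) (svalP x') mulr1.
exists ((sval l')^-1 * sval l); split => //; split => /=.
  by apply: sval_inj; rewrite kernel_actE.
by rewrite invfM invrK mulfVK.
Qed.

Let J_proj t : eproj (J t) = eproj t.
Proof. by rewrite /J (wx_act_proj wE) //; exact: (svalP (irep t).2). Qed.

Let J_mul t s : src t = tgt s -> J (mul t s) = mul (J t) (J s).
Proof.
move=> ts; have c := circleM (svalP (irep t).2) (svalP (irep s).2).
have ts' : src (irep t).1 = tgt (irep s).1 := ts.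
have ts'' : src (sval (irep t).1) = tgt (sval (irep s).1) := ts.
rewrite [mul t s]/(quot_class _ _) J_class sub_ofE // kernel_mulE //.
by rewrite -(wx_central wE) //; [exact: (svalP (irep t).2)|exact: (svalP (irep s).2)].
Qed.

Let J_act a t : circle a -> J (eact a t) = eact a (J t).
Proof.
move=> ca; have c := circleM ca (svalP (irep t).2).
rewrite [eact a t]/(quot_class _ _) J_class sub_ofE // (wx_actM wE) //.
exact: (svalP (irep t).2).
Qed.

(* The isomorphism sends [r] to the class of [(r / lam, lam)], where [lam] is
   any [n]-th root of [psi r / |psi r|]; [J] is its inverse. *)
Lemma kernel_induced_isomorphic : ext_isomorphic E (induced_ext n kernel_ext).
Proof.
have kernelV r c : circle c -> c ^+ n = u r -> kernel (eact c^-1 r).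
  move=> cc cn; rewrite /kernel /= ua; last exact: circleV.
  by rewrite exprVn cn mulVf // circle_neq0 //; exact: cu.
have J_root r c (cc : circle c) (cn : c ^+ n = u r) :
    J (quot_class irel (exist _ _ (kernelV r c cc cn), exist _ c cc)) = r.
  rewrite J_class /= -(wx_actM wE) // ?mulfV ?(wx_act1 wE) ?circle_neq0 //.
  exact: circleV.
(* The global root is chosen without continuity. Algebraic properties of [F] are transferred from
   [J] by injectivity, and its smoothness uses the local roots [rho], which give the same class. *)
have /choice[F JF] : forall r, exists t, J t = r.
  by move=> r; have [c cc cn] := circle_root n0 (cu r); eexists; exact: (J_root r c cc cn).
have FJ t : F (J t) = t by apply: J_inj; rewrite JF.
exists F; split.
- exists J; split => //.
  + move=> d U p pE HP; split; first exact: plot_open pE.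
    move=> v Uv; have [psm psi0 _ _] := Hpsi.
    have [W [rho [oO Oz rsm Hrho]]] := smooth_local_root n0 (psi0 (p v)).
    have pC : plot complexD U (psi \o p) by exact: psm.
    have oV := oO _ _ _ pC; set V := U `&` _ in oV.
    have [cv nv] := Hrho _ Oz.
    pose x0 : kernel_ext := exist _ _ (kernelV _ _ cv nv).
    pose l0 : circleD := exist _ _ cv.
    have pV := plot_sub oV (@subIsetl _ _ _) pC.
    have rV : plot complexD V (fun w => rho (psi (p w))).
      by apply: rsm pV _ => w [].
    exists V, (fun w => (sub_of x0 (eact (rho (psi (p w)))^-1 (p w)),
                         sub_of l0 (rho (psi (p w))))).
    split; first by split.
      split.
        apply: (@plot_eq _ E _ _ _ (fun w => eact (rho (psi (p w)))^-1 (p w))).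
          by move=> w [Uw /Hrho[cw nw]] /=; apply: sub_ofE; apply: (kernelV _ _ cw nw).
        apply: (wx_act_smooth wE (p := fun w => ((rho (psi (p w)))^-1, p w))).
          split; last by apply: plot_sub pE => // w [].
          by apply: plot_cinv => // w [_ /Hrho[/circle_neq0]].
        by move=> w [_ /Hrho[cw _]] /=; exact: circleV.
      apply: (@plot_eq _ complexD _ _ _ (fun w => rho (psi (p w)))) => //.
      by move=> w [Uw /Hrho[cw nw]] /=; apply: sub_ofE.
    move=> w [Uw /Hrho[cw nw]]; apply: J_inj; rewrite JF J_class.
    rewrite sub_ofE // sub_ofE; last by apply: (kernelV _ _ cw nw).
    rewrite -(wx_actM wE) // ?mulfV ?(wx_act1 wE) ?circle_neq0 //.
    exact: circleV.
  + move=> d U p [oU pt] HP; apply: plot_local => // v Uv.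
    have [V [q [Vv [qE qC] pq]]] := pt v Uv.
    exists V => //; apply: (@plot_eq _ E _ _ _ (fun w => eact (sval (q w).2) (sval (q w).1))).
      by move=> w /pq /= ->; rewrite [q w]surjective_pairing J_class.
    apply: (wx_act_smooth wE (p := fun w => (sval (q w).2, sval (q w).1))) => // w _.
    exact: (svalP (q w).2).
- by move=> r; rewrite -[in RHS](JF r) J_proj.
- move=> r s rs; apply: J_inj; rewrite JF J_mul ?JF //.
  by rewrite -eproj_src -eproj_tgt -!J_proj !JF eproj_src eproj_tgt.
- by move=> a r ca; apply: J_inj; rewrite JF J_act // JF.
Qed.
End Reduction.

(** * The function of degree n on an induced extension *)

Section InducedDegree.
Variable K : realType.
Local Notation dspace := (dspace K).

Lemma degree_hom_of_induced n (M : dspace) (G : groupoid M) (E : extension G)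
    (E' : extension G) : (0 < n)%N ->
  is_central_extension (@mu K n) E' -> ext_isomorphic E (induced_ext n E') ->
  exists psi : E -> complexD K, is_degree_hom n psi.
Proof.
move=> n0 cE' [f [[g [fsm _ _ _]] fp fM fa]].
pose irel := @induced_rel K n M G E'.
pose rep (a : induced_ext n E') := quot_repr (a : quot irel).
pose chi (t : induced_ext n E') : complex K := sval (rep t).2 ^+ n.
have chi_class x l : chi (quot_class irel (x, l)) = sval l ^+ n.
  have /(congr1 (@proj1_sig _ _)) /= e := quot_reprK (quot_class irel (x, l)).
  (* Classes are sets of related points: reflexivity puts the representative in its own class, which
     by [e] is the set of points related to (x, l). *)
  have : irel (rep (quot_class irel (x, l))) (rep (quot_class irel (x, l))).
    exists 1; split; first exact: mu1.
    by rewrite invr1 mul1r (ext_act1 cE').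
  rewrite -/(rep _) in e; rewrite e => -[z [mz [_ /= e2]]].
  by rewrite /chi e2 exprMn exprVn mz invr1 mul1r.
have cn r : circle (sval (rep (f r)).2 : complex K) by exact: (svalP (rep (f r)).2).
exists (fun r => chi (f r)); split.
- move=> d U p pE HP; have [oU pt] := fsm d U p pE HP.
  apply: plot_local => // v Uv; have [V [q [Vv [qE qC] pq]]] := pt v Uv.
  exists V => //; apply: (@plot_eq _ (complexD K) _ _ _ (fun w => sval (q w).2 ^+ n)).
    by move=> w /pq /= ->; rewrite [q w]surjective_pairing chi_class.
  exact: plot_cexp.
- by move=> r; rewrite expf_neq0 // circle_neq0.
- move=> r s rs; rewrite fM // [mul (f r) (f s)]/(quot_class _ _) chi_class.
  by rewrite sub_ofE ?exprMn //; apply: circleM; exact: cn.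
- move=> a r ca; rewrite fa // [eact a (f r)]/(quot_class _ _) chi_class.
  by rewrite sub_ofE ?exprMn //; apply: circleM.
Qed.
End InducedDegree.

(** * The pull-back groupoid of an open cover *)

Section CoverSpace.
Variable K : realType.
Local Notation dspace := (dspace K).
Variables (M : dspace) (I : Type) (U : I -> set M).
Hypothesis cU : is_open_cover U.
Local Notation N := (cover_space U).
Local Notation f := (@cover_map K M I U).

Lemma smooth_cover_map : smooth f.
Proof.
move=> d W p [oW H] _; apply: plot_local => // u Wu.
have [V [i [q [Vu pq pE]]]] := H u Wu.
by exists V => //; apply: (@plot_eq _ M _ _ _ (fun v => sval (q v))) => // v /pE /= ->.
Qed.

(** A plot of a disjoint union stays locally in one summand. *)
Lemma cover_piece_D_open i : D_open (X := N) [set x | projT1 x = i].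
Proof.
move=> d W p [oW H]; rewrite openE => u [Wu /= ui].
have [V [j [q [Vu pq pE]]]] := H u Wu; have oV := plot_open pq.
have ij : j = i by rewrite -ui pE.
apply: filterS (open_nbhs_nbhs (conj (openI oW oV) (conj Wu Vu))) => v [Wv Vv].
by split => //=; rewrite pE.
Qed.

Lemma cover_piece_inverse i : exists h : M -> N,
  inverse_on (X := N) [set x | projT1 x = i] (U i) f h.
Proof.
have [_ oU cov] := cU.
(* The inverse must be defined on all of [M]; outside [U i] it is an arbitrary lift, which exists
   because the sets cover. *)
have /choice[h Hh] : forall m, exists x : N, forall H : U i m,
    x = existT (fun i => subD (U i)) i (exist _ m H).
  move=> m; have [H|H] := pselect (U i m).
    by exists (existT _ i (exist _ m H)) => H'; congr existT; exact: eq_exist.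
  by have [j Hj] := cov m; exists (existT _ j (exist _ m Hj)).
exists h; split.
- exact: smooth_onT smooth_cover_map.
- move=> d W p pM HP; split; first exact: plot_open pM.
  move=> u Wu; pose x0 : subD (U i) := exist _ (p u) (HP u Wu).
  exists W, i, (fun v => sub_of x0 (p v)); split => // [|v Wv].
    by apply: (@plot_eq _ M _ _ _ p) => // v Wv /=; apply: sub_ofE; apply: (HP v Wv).
  rewrite /= (Hh _ (HP v Wv)); congr existT.
  by apply: sval_inj; rewrite sub_ofE //; apply: (HP v Wv).
- move=> [j [m Hm]] /= ij; subst j; split; first exact: Hm.
  exact: (Hh m Hm).
- by move=> m Hm; rewrite (Hh m Hm).
Qed.

Lemma local_diffeo_cover_map : local_diffeo f.
Proof.
move=> x; have [h Hh] := cover_piece_inverse (projT1 x); have [_ oU _] := cU.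
exists [set y | projT1 y = projT1 x], (U (projT1 x)), h.
by split => //; exact: cover_piece_D_open.
Qed.

(** Points with different images are separated in [M]. Distinct points with the same image lie in
    different pieces, since the cover map is injective on each piece, and the pieces are open and
    disjoint. *)
Lemma hausdorff_cover_space : hausdorff M -> hausdorff N.
Proof.
move=> hM x y xy; have [e|ne] := pselect (f x = f y); last first.
  have [A [B [oA oB Ax By AB]]] := hM _ _ ne.
  exists (f @^-1` A), (f @^-1` B); split => //.
  - exact: D_open_preimT smooth_cover_map oA.
  - exact: D_open_preimT smooth_cover_map oB.
  - by rewrite -preimage_setI AB preimage_set0.
exists [set z | projT1 z = projT1 x], [set z | projT1 z = projT1 y].
split; [exact: cover_piece_D_open|exact: cover_piece_D_open|by []|by []|].
apply/seteqP; split => // z [/= -> ne]; apply: xy.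
have [h [_ _ fh _]] := cover_piece_inverse (projT1 y).
by have [_ <-] := fh x ne; have [_ <-] := fh y erefl; rewrite e.
Qed.

Lemma manifold_cover_space : is_manifold M -> is_manifold N.
Proof.
move=> mM; have [cI oU _] := cU.
apply: (@manifold_cover _ N M I (fun i => [set x | projT1 x = i]) U (fun=> f)) => //.
- by apply: hausdorff_cover_space; exact: manifold_hausdorff.
- by move=> i; split; [exact: cover_piece_D_open|exact: oU|exact: cover_piece_inverse].
- by move=> x; exists (projT1 x).
Qed.

Variable G : groupoid M.
Hypothesis lG : is_lie_groupoid G.
Local Notation H := (pullback f G).
Let q (x : H) : G := (sval x).2.

(** Once the pieces of the two end points are fixed, the end points are determined by the arrow, so
    an arrow of the pull-back amounts to an arrow of [G] from [U j] to [U i]. *)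
Lemma pullback_piece i j :
  let A := [set x : H | projT1 (sval x).1.1 = i /\ projT1 (sval x).1.2 = j] in
  let B := [set g : G | U i (tgt g) /\ U j (src g)] in
  [/\ D_open A, D_open B & diffeo_on A B q].
Proof.
move=> A B; have [_ oU cov] := cU; have [ssm _] := lie_src lG; have [tsm _] := lie_tgt lG.
have [hi [_ hism fhi hfi]] := cover_piece_inverse i.
have [hj [_ hjsm fhj hfj]] := cover_piece_inverse j.
have /choice[h Hh] : forall g : G, exists x : H, B g -> sval x = (hi (tgt g), hj (src g), g).
  move=> g; have [Bg|nBg] := pselect (B g).
    have ok : tgt g = f (hi (tgt g)) /\ src g = f (hj (src g)).
      by case: Bg => /hfi[_ ->] /hfj[_ ->].
    by exists (exist _ (hi (tgt g), hj (src g), g) ok).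
  have [i' Hi'] := cov (tgt g); have [j' Hj'] := cov (src g).
  pose y1 : N := existT _ i' (exist _ _ Hi'); pose y2 : N := existT _ j' (exist _ _ Hj').
  by exists (exist _ (y1, y2, g) (conj erefl erefl)).
split.
- apply: D_openI.
    apply: (@D_open_preimT _ H N _ (fun x => (sval x).1.1)) (@cover_piece_D_open i).
    by move=> d W p [[p1 _] _] _; exact: p1.
  apply: (@D_open_preimT _ H N _ (fun x => (sval x).1.2)) (@cover_piece_D_open j).
  by move=> d W p [[_ p1] _] _; exact: p1.
- by apply: D_openI; apply: D_open_preimT.
exists h; split.
- by move=> d W p [_ pG] _; exact: pG.
- move=> d W p pG HP.
  apply: (@plot_eq _ (prodD (prodD N N) G) _ _ _
    (fun u => (hi (tgt (p u)), hj (src (p u)), p u))).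
    by move=> u /HP Bu; exact: Hh.
  split => //; split.
    by apply: (hism d W (tgt (g := G) \o p)) => [|u /HP[]//]; exact: tsm.
  by apply: (hjsm d W (src (g := G) \o p)) => [|u /HP[]//]; exact: ssm.
- move=> [[[y1 y2] g] [/= t1 s2]] [/= y1i y2j].
  have [Uy1 h1] := fhi y1 y1i; have [Uy2 h2] := fhj y2 y2j.
  have Bg : B g by rewrite /B /= t1 s2.
  have E3 : (hi (tgt g), hj (src g), g) = (y1, y2, g) by rewrite t1 s2 h1 h2.
  by split => //; apply: sval_inj; rewrite Hh.
- move=> g Bg; have [Ui Uj] := Bg; rewrite /A /q /= Hh //=; split => //; split.
    by have [] := hfi _ Ui.
  by have [] := hfj _ Uj.
Qed.

Lemma local_diffeo_pullback : local_diffeo q.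
Proof.
move=> x; have [oA oB [h Hh]] := pullback_piece (projT1 (sval x).1.1) (projT1 (sval x).1.2).
by do 3 eexists; split; [|exact: oA|exact: oB|exact: Hh].
Qed.

Lemma manifold_pullback : is_manifold H.
Proof.
have mM := lie_objects lG; have mG := lie_arrows lG; have [cI _ _] := cU.
have hN : hausdorff N by apply: hausdorff_cover_space; exact: manifold_hausdorff.
apply: (@manifold_cover _ H G (I * I)%type
  (fun ij => [set x : H | projT1 (sval x).1.1 = ij.1 /\ projT1 (sval x).1.2 = ij.2])
  (fun ij => [set g : G | U ij.1 (tgt g) /\ U ij.2 (src g)]) (fun=> q)) => //.
- apply: hausdorff_separated => x y xy.
  exists (prodD (prodD N N) G), setT, sval; split => //.
  + apply: hausdorff_prodD; first exact: hausdorff_prodD.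
    exact: manifold_hausdorff.
  + exact: D_openT.
  + by move=> /sval_inj.
- exact: countable_pair.
- by move=> [i j]; exact: pullback_piece.
- by move=> x; exists (projT1 (sval x).1.1, projT1 (sval x).1.2).
Qed.

Lemma submersion_pullback : submersion (@src K N H) /\ submersion (@tgt K N H).
Proof.
have [_ ssub] := lie_src lG; have [_ tsub] := lie_tgt lG.
split.
  apply: (submersion_local_diffeo (q := q) (f := f) _ local_diffeo_pullback
            local_diffeo_cover_map _ ssub).
    by move=> d W p [[_ p1] _] _; exact: p1.
  by move=> x; have [_ ->] := svalP x.
apply: (submersion_local_diffeo (q := q) (f := f) _ local_diffeo_pullback
            local_diffeo_cover_map _ tsub).
  by move=> d W p [[p1 _] _] _; exact: p1.
by move=> x; have [-> _] := svalP x.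
Qed.

End CoverSpace.

(** * Extensions by roots of unity as coverings *)

Section KernelLie.
Variable K : realType.
Local Notation C := (complex K).
Local Notation dspace := (dspace K).
Local Notation complexD := (complexD K).

Lemma countable_mu n : (0 < n)%N -> countable (@mu K n).
Proof.
move=> n0; apply: finite_set_countable.
apply: contrapT => /(@infinite_set_fset _ _ n.+1)[B BA].
apply/negP; rewrite -leqNgt; apply: max_unity_roots => //; last exact: finmap.fset_uniq.
by apply/allP => z /BA /= zn; apply/unity_rootP.
Qed.

(* An open condition singling out [1] among the [n]-th roots of unity. *)
Lemma mu_eq1 n (z : C) : (0 < n)%N -> mu n z ->
  z = 1 <-> 0 < complex.Re (\sum_(k < n) z ^+ k).
Proof.
move=> n0 zn; split=> [->|].
  under eq_bigr do rewrite expr1n.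
  rewrite sumr_const card_ord raddfMn /= -mulr_natl mulr1.
  by rewrite ltr0n.
have := subrX1 z n; rewrite zn subrr => /esym/eqP.
rewrite mulf_eq0 subr_eq0 => /orP[/eqP//|/eqP ->].
by rewrite ltxx.
Qed.

Section MuExtension.
Variables (n : nat) (M : dspace) (G : groupoid M) (E : extension G).
Hypothesis n0 : (0 < n)%N.
Hypothesis wE : weak_extension (@mu K n) E.
Hypothesis mGm : is_manifold G.

(** The set [A] is the sheet z s(V). It is open because the division takes values in a finite group,
    where being equal to [z] is an open condition by [mu_eq1]. *)
Lemma mu_sheet (V : set G) (s : G -> E) (z : C) : D_open V -> smooth_on V s ->
  (forall h, V h -> eproj (s h) = h) -> mu n z ->
  exists A : set E, [/\ D_open A, diffeo_on A V (@eproj K M G E) &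
    forall r, V (eproj r) -> eact z (s (eproj r)) = r -> A r].
Proof.
move=> oV sV ps mz; have [dv [dvA dva dvu dvs]] := wx_div wE.
have psm := wx_proj_smooth wE.
pose A := [set r : E | V (eproj r) /\ eact z (s (eproj r)) = r].
exists A; split => //; last first.
  exists (fun g => eact z (s g)); split.
  - exact: smooth_onT psm.
  - move=> d U p pG HP.
    apply: (wx_act_smooth wE (p := fun u => (z, s (p u)))) => //.
    by split; [apply: plot_cst; exact: plot_open pG|exact: sV].
  - by move=> r [Vr er].
  - move=> g Vg; have e : eproj (eact z (s g)) = g by rewrite (wx_act_proj wE) // ps.
    by rewrite /A /= e.
(* The division by z s instead of s: a root of unity that equals 1 exactly on the sheet. *)
pose t (r : E) : complexD := z^-1 * dv (s (eproj r)) r.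
have oW : D_open (X := E) (@eproj K M G E @^-1` V) by exact: D_open_preimT.
have z0 : z != 0 by apply: circle_neq0; exact: (mu_circle n0).
have mu_t r : V (eproj r) -> mu n (t r).
  by move=> Vr; apply: muM; [exact: muV|apply: dvA; rewrite ps].
have tsm : smooth_on (@eproj K M G E @^-1` V) (fun r => \sum_(k < n) t r ^+ k : complexD).
  move=> d U p pE HP; apply: plot_csum; first exact: plot_open pE.
  move=> k; apply: plot_cexp; apply: plot_cmul.
    by apply: plot_ccst; exact: plot_open pE.
  apply: (dvs d U (fun u => (s (eproj (p u)), p u))).
    split => //; apply: sV => //; exact: (psm _ _ _ pE).
  by move=> u /HP Vu /=; rewrite ps.
have := D_open_preim oW tsm (@D_open_complex_Re_gt0 K).
rewrite (_ : _ `&` _ = A) //; apply/seteqP; split=> r [Vr /= Hr]; split => //.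
  have /(mu_eq1 n0 (mu_t r Vr)) e := Hr.
  have <- : dv (s (eproj r)) r = z.
    by rewrite -[LHS](mulVKf z0) -[X in z * X]/(t r) e mulr1.
  by apply: dva; rewrite ps.
apply/(mu_eq1 n0 (mu_t r Vr)); rewrite /t -{2}Hr dvu //.
by rewrite mulVf.
Qed.

Lemma local_diffeo_mu : local_diffeo (@eproj K M G E).
Proof.
move=> r; have [V [s [oV Vr sV ps]]] := wx_section wE (eproj r).
have [dv [dvA dva dvu dvs]] := wx_div wE.
have e : eproj (s (eproj r)) = eproj r by rewrite ps.
have [A [oA [h Hh] HA]] := mu_sheet oV sV ps (dvA _ _ e).
by exists A, V, h; split => //; apply: HA => //; exact: dva.
Qed.

(** Countably many trivialising sets suffice by [lindelof], and over each of them there is one sheet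
    for every root of unity, so countably many sheets cover [E]. *)
Lemma manifold_mu : hausdorff E -> is_manifold E.
Proof.
move=> hE.
have /choice[Vs HVs] : forall g : G, exists Vs : set G * (G -> E),
    [/\ D_open Vs.1, Vs.1 g, smooth_on Vs.1 Vs.2 & forall h, Vs.1 h -> eproj (Vs.2 h) = h].
  by move=> g; have [V [s H]] := wx_section wE g; exists (V, s).
have [|D [cD HD]] := @lindelof _ G (fun g => (Vs g).1) mGm.
  by move=> g; have [] := HVs g.
have [dv [dvA dva dvu dvs]] := wx_div wE.
have /choice[A HA] : forall gz : {g | D g} * {z : C | mu n z}, exists A : set E,
   [/\ D_open A, diffeo_on A (Vs (sval gz.1)).1 (@eproj K M G E) &
    forall r, (Vs (sval gz.1)).1 (eproj r) ->
      eact (sval gz.2) ((Vs (sval gz.1)).2 (eproj r)) = r -> A r].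
  by move=> [[g Dg] [z mz]]; have [oV Vg sV ps] := HVs g; exact: mu_sheet.
apply: (@manifold_cover _ E G _ A (fun gz => (Vs (sval gz.1)).1) (fun=> @eproj K M G E)) => //.
- by apply: countable_pair; apply: countable_sub => //; exact: countable_mu.
- by move=> gz; have [oA dA _] := HA gz; split => //; have [] := HVs (sval gz.1).
- move=> r; have [g Dg Vg] := HD (eproj r); have [oV _ sV ps] := HVs g.
  have e : eproj ((Vs g).2 (eproj r)) = eproj r by rewrite ps.
  exists (exist _ g Dg, exist _ _ (dvA _ _ e)); have [_ _] := HA (exist _ g Dg, exist _ _ (dvA _ _ e)).
  by apply => //=; exact: dva.
Qed.
End MuExtension.
End KernelLie.

(** * The kernel over an open cover is a Lie groupoid *)

Section KernelLieGroupoid.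
Variable K : realType.
Local Notation C := (complex K).
Local Notation dspace := (dspace K).
Local Notation complexD := (complexD K).
Variables (n : nat) (M : dspace) (I : Type) (U : I -> set M).
Variables (G : groupoid M) (R : extension G).
Hypothesis n0 : (0 < n)%N.
Hypothesis cU : is_open_cover U.
Hypothesis lG : is_lie_groupoid G.
Hypothesis cR : is_central_extension (@circle K) R.
Local Notation N := (cover_space U).
Local Notation f := (@cover_map K M I U).
Local Notation E := (pullback_ext f R).
Variable psi : E -> complexD.
Hypothesis Hpsi : is_degree_hom n psi.
Local Notation X := (kernel_ext psi).

Let lR : is_lie_groupoid R := ext_lie cR.
Let wR := weak_of_central cR.
Let mG := lie_mul_typed lG.
Let mR := lie_mul_typed lR.
Let mH : mul_typed (pullback f G) := pullback_mul_typed mG.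
Let wE : weak_extension (@circle K) E := weak_pullback f mG wR.
Let wX : weak_extension (@mu K n) X := weak_kernel n0 wE Hpsi.
Let mX : mul_typed X := ext_mul_typed mH wX.

Let vv (x : X) : N * N * R := sval (sval x).

Let vv_inj : injective vv.
Proof. by move=> x y /sval_inj /sval_inj. Qed.

Let vv_mul x y : src x = tgt y ->
  vv (mul x y) = ((vv x).1.1, (vv y).1.2, mul (vv x).2 (vv y).2).
Proof. by move=> xy; rewrite /vv (kernel_mulE Hpsi) // (pullback_mulE (G := R)). Qed.

Let vv_comp x y : src x = tgt y -> src (vv x).2 = tgt (vv y).2.
Proof.
move=> xy; have [_ ->] := svalP (sval x); have [-> _] := svalP (sval y).
by congr f; exact: xy.
Qed.

(** From psi(e)^2 = psi(e) and psi(e) != 0 follows psi(e) = 1; this puts the identities in the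
    kernel. *)
Let idempotent_kernel (e : E) : src e = tgt e -> mul e e = e -> normalize (psi e) = 1.
Proof.
move=> se ee; have [_ psi0 psiM _] := Hpsi.
have := psiM e e se; rewrite ee => /eqP; rewrite -{1}[psi e : C]mul1r.
by rewrite (inj_eq (mulIf (psi0 e))) => /eqP <-; apply: normalize_id; exact: circle1.
Qed.

Let vv_identity (m : N) (e : X) : (vv e).1 = (m, m) -> is_identity (f m) (vv e).2 ->
  is_identity m e.
Proof.
move=> em [es et el er].
have se : src e = m by rewrite -[LHS]/((vv e).1.2) em.
have te : tgt e = m by rewrite -[LHS]/((vv e).1.1) em.
split => // x xm; apply: vv_inj.
  have x1 : (vv x).1.1 = m := xm.
  rewrite vv_mul ?se ?xm // em el; first by rewrite /= -x1; case: (vv x) => -[].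
  by have [-> _] := svalP (sval x); congr f.
have x1 : (vv x).1.2 = m := xm.
rewrite vv_mul ?te ?xm // em er; first by rewrite /= -[in LHS]x1; case: (vv x) => -[].
by have [_ ->] := svalP (sval x); congr f.
Qed.

(** The Hausdorff property comes from the injection [vv] into N x N x R. Product, identities and
    inverses are those of [R] with end points attached, once they are shown to stay in the
    kernel. *)
Lemma kernel_lie_groupoid : is_lie_groupoid X.
Proof.
have mM := lie_objects lG.
have hN : hausdorff N by apply: hausdorff_cover_space => //; exact: manifold_hausdorff.
have hX : hausdorff X.
  apply: hausdorff_separated => x y xy; exists (prodD (prodD N N) R), setT, vv.
  split => //; last by move=> /vv_inj.
    apply: hausdorff_prodD; first exact: hausdorff_prodD.
    by apply: manifold_hausdorff; exact: lie_arrows.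
  exact: D_openT.
have lid : local_diffeo (@id N).
  move=> x; exists setT, setT, id; split => //; try exact: D_openT.
  by split.
have [subs subt] := submersion_pullback cU lG.
have ldX : local_diffeo (@eproj K N (pullback f G) X) := local_diffeo_mu n0 wX.
have svv d (W : set 'rV[K]_d) (p : 'rV[K]_d -> X) : plot X W p -> [/\
    plot N W (fun u => (vv (p u)).1.1), plot N W (fun u => (vv (p u)).1.2) &
    plot R W (fun u => (vv (p u)).2)].
  move=> pX; have [pN pR] : plot (prodD (prodD N N) R) W (fun u => vv (p u)) := pX.
  by have [p1 p2] := pN.
have ssm : smooth (@src K N X) by move=> d W p /svv[].
have tsm : smooth (@tgt K N X) by move=> d W p /svv[].
have [one [onesm oneP]] := lie_one lR; have [inv [invsm invP]] := lie_inv lR.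
split.
- exact: manifold_cover_space.
- exact: (manifold_mu n0 wX (manifold_pullback cU lG) hX).
- split => //; apply: (submersion_local_diffeo (q := @eproj _ _ _ X)
    (f := @id N) ssm ldX lid _ subs).
  by move=> x; rewrite eproj_src.
- split => //; apply: (submersion_local_diffeo (q := @eproj _ _ _ X)
    (f := @id N) tsm ldX lid _ subt).
  by move=> x; rewrite eproj_tgt.
- by move=> x y /mX[].
- by move=> x y /mX[].
- move=> x y z xy yz; apply: vv_inj; have [sxy txy] := mX xy; have [syz tyz] := mX yz.
  have xyz : src x = tgt (mul y z) by rewrite tyz.
  have xyz' : src (mul x y) = tgt z by rewrite sxy.
  rewrite (vv_mul xyz) (vv_mul yz) (vv_mul xyz') (vv_mul xy).
  congr pair; exact: (lie_mulA lR (vv_comp xy) (vv_comp yz)).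
- move=> d W p [/svv[p1 p2 pE] /svv[q1 q2 qE]] HP.
  apply: (@plot_eq _ (prodD (prodD N N) R) _ _ _ (fun u => ((vv (p u).1).1.1, (vv (p u).2).1.2,
     mul (vv (p u).1).2 (vv (p u).2).2))); first by move=> u /HP; exact: vv_mul.
  split; first by split.
  apply: (lie_mul_smooth lR (p := fun u => ((vv (p u).1).2, (vv (p u).2).2))) => // u /HP.
  exact: vv_comp.
- have ok (m : N) : tgt (one (f m)) = f m /\ src (one (f m)) = f m.
    by have [-> ->] := oneP (f m).
  pose e (m : N) : E := exist _ (m, m, one (f m)) (ok m).
  have ke m : kernel psi (e m).
    apply: idempotent_kernel => //; apply: sval_inj.
    by rewrite (pullback_mulE (G := R)) //=; have [s t -> //] := oneP (f m).
  exists (fun m => exist _ (e m) (ke m)); split.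
    move=> d W p pN _; split; first by split.
    by apply: (onesm d W (f \o p)) => //; apply: smooth_cover_map.
  by move=> m; apply: vv_identity => //; exact: oneP.
- have ok (x : E) : tgt (inv (sval x).2) = f (sval x).1.2 /\ src (inv (sval x).2) = f (sval x).1.1.
    have [-> -> _ _] := invP (sval x).2; have [-> ->] := svalP x; by [].
  pose v (x : E) : E := exist _ ((sval x).1.2, (sval x).1.1, inv (sval x).2) (ok x).
  have kv (x : E) : kernel psi x -> kernel psi (v x).
    move=> kx; have xv : src x = tgt (v x) by [].
    have [s t i1 _] := invP (sval x).2.
    have [_ psi0 psiM _] := Hpsi.
    have E1 : sval (mul x (v x)) = ((sval x).1.1, (sval x).1.1, mul (sval x).2 (inv (sval x).2)).
      exact: (pullback_mulE (G := R) (y := v x)).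
    have se : src (mul x (v x)) = tgt (mul x (v x)) by rewrite /src /tgt /= E1.
    have ee : mul (mul x (v x)) (mul x (v x)) = mul x (v x).
      apply: sval_inj; rewrite (pullback_mulE (G := R)) // E1 /=.
      have [ts tt til _] := i1; rewrite til // (lie_mul_tgt lR) //.
    (* The product of x and its inverse is idempotent, so u(x) u(x^-1) = 1, where u(x) = 1 by
       assumption. *)
    have := idempotent_kernel se ee; rewrite psiM // normalizeM.
    by rewrite [normalize (psi x)]kx mul1r.
  exists (fun x => exist _ (v (sval x)) (kv (sval x) (svalP x))); split.
    move=> d W p /svv[p1 p2 pE] _; split; first by split.
    exact: (invsm d W (fun u => (vv (p u)).2)).
  move=> x; set y : X := exist _ _ _; have xy : src x = tgt y by [].
  have yx : src y = tgt x by [].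
  have [s t i1 i2] := invP (vv x).2; have [tx sx] := svalP (sval x).
  split => //; apply: vv_identity.
  + by rewrite vv_mul.
  + by rewrite vv_mul //; move: i1; rewrite tx.
  + by rewrite vv_mul.
  + by rewrite vv_mul //; move: i2; rewrite sx.
Qed.
End KernelLieGroupoid.

Lemma degree_hom_iff_mu_reduction (K : realType) (M : dspace K) (G : groupoid M)
    (R : extension G) (n : nat) :
  (0 < n)%N -> is_lie_groupoid G -> is_central_extension (@circle K) R ->
  has_degree_hom R n <-> has_mu_reduction R n.
Proof.
move=> n0 lG cR; have wR := weak_of_central cR; have mG := lie_mul_typed lG.
split=> -[I [U [cU]]].
  move=> [psi Hpsi]; exists I, U; split => //.
  have wE := weak_pullback (@cover_map K M I U) mG wR.
  exists (kernel_ext psi); split; last exact: (kernel_induced_isomorphic n0 wE Hpsi).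
  apply: central_of_weak; first exact: (kernel_lie_groupoid n0 cU lG cR Hpsi).
  exact: weak_kernel.
move=> [R' [cR' iso]]; exists I, U; split => //.
exact: (degree_hom_of_induced n0 cR' iso).
Qed.

(** * Generalized homomorphisms to the general linear group *)

Section GL.
Variable K : realType.
Local Notation C := (complex K).
Local Notation dspace := (dspace K).
Local Notation complexD := (complexD K).
Local Notation matrixD := (matrixD K).
Local Notation GL := (GL K).

(** The identity matrix is the default for singular arguments, so that matrix-valued maps become
    total maps to [GL n]. *)
Definition GL_of n (A : 'M[C]_n) : GL n :=
  sub_of (exist _ 1%:M (unitmx1 _ n)) A.

Lemma GL_ofE n (A : 'M[C]_n) : A \in unitmx -> sval (GL_of A) = A.
Proof. by move=> uA; exact: (@sub_ofE _ [set B : 'M[C]_n | B \in unitmx] _ A uA). Qed.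

Lemma GL_mulE n (A B : GL n) : sval (mul A B) = sval A *m sval B.
Proof. by apply: sub_ofE; rewrite /= unitmx_mul (svalP A) (svalP B). Qed.

Lemma GL_of_identity n : is_identity (tt : ptD K) (GL_of 1%:M : GL n).
Proof.
by split=> // g _; apply: sval_inj; rewrite GL_mulE GL_ofE ?unitmx1 ?mul1mx ?mulmx1.
Qed.

Lemma GL_act1 n (a : C) : a != 0 -> sval (GL_act a (GL_of 1%:M : GL n)) = a%:M.
Proof.
move=> a0; have e := GL_ofE (unitmx1 C n).
rewrite /GL_act e; have ua : a *: (1%:M : 'M[C]_n) \in unitmx.
  by rewrite unitmxZ ?unitmx1 // unitfE.
by rewrite (@sub_ofE _ [set B : 'M[C]_n | B \in unitmx] _ _ ua) scalemx1.
Qed.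

Lemma manifold_GL n : is_manifold (GL n).
Proof.
apply: (@manifold_cover _ (GL n) (matrixD n n) unit (fun=> setT)
    (fun=> [set A | A \in unitmx]) (fun=> sval)).
- apply: hausdorff_separated => x y xy; exists (matrixD n n), setT, sval.
  split => //; last by move=> /sval_inj.
    exact/manifold_hausdorff/manifold_matrixD.
  exact: D_openT.
- exact: manifold_matrixD.
- exact: countableP.
- move=> _; split; [exact: D_openT|exact: D_open_unitmx|].
  exists (@GL_of n); split => //.
  + move=> d U p Hp HP; apply: (@plot_eq _ (matrixD n n) _ _ _ p) => // u /HP.
    exact: GL_ofE.
  + move=> A _; split; first exact: (svalP A).
    by apply: sval_inj; rewrite GL_ofE //; exact: (svalP A).
  + by move=> A /= uA; rewrite GL_ofE.
- by move=> x; exists tt.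
Qed.
End GL.

(** * The determinant of the cocycle of a generalized homomorphism *)

Section GenhomDegree.
Variable K : realType.
Local Notation C := (complex K).
Local Notation dspace := (dspace K).
Local Notation complexD := (complexD K).
Local Notation GL := (GL K).
Variables (M : dspace) (G : groupoid M) (R : extension G) (n : nat).
Hypothesis lG : is_lie_groupoid G.
Hypothesis cR : is_central_extension (@circle K) R.
Variables (Z : genhom R (GL n)) (act : C -> Z -> Z).
Hypothesis gZ : is_genhom Z.
Hypothesis eZ : is_equivariant (@eact K M G R) (@GL_act K n) act.

Let lR : is_lie_groupoid R := ext_lie cR.

Lemma genhom_gactr1 (z : Z) : gactr z (GL_of 1%:M : GL n) = z.
Proof. by apply: (gh_actr_one gZ); case: (gr z); exact: GL_of_identity. Qed.

(** Equivariance on both sides, applied with the unit matrix on the right, moves the scalar across: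
    (a r).z = r.(a z) = (r.z).a. *)
Lemma genhom_scalar a (r : R) (z : Z) : circle a -> src r = gl z ->
  gactl (eact a r) z = gactr (gactl r z) (GL_act a (GL_of 1%:M : GL n)).
Proof.
move=> ca rz; have e : gr z = tgt (GL_of 1%:M : GL n) by case: (gr z).
rewrite -(eq_right eZ) // -(eq_left eZ) // genhom_gactr1 //.
Qed.

(* In a local section [s] over [V], [s m . A] has coordinates [(m, A)]. *)
Lemma genhom_coord (m : M) : exists (V : set M) (s : M -> Z) (c : Z -> GL n),
  [/\ D_open V /\ V m, smooth_on V s, forall x, V x -> gl (s x) = x,
      smooth_on [set z | V (gl z)] c &
      (forall z, V (gl z) -> gactr (s (gl z)) (c z) = z) /\
      (forall x A, V x -> c (gactr (s x) A) = A)].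
Proof.
have [V [s [oV Vm sV gls [h [_ hsm h1 h2]]]]] := gh_principal gZ m.
exists V, s, (fun z => (h z).2); split => //.
  by move=> d U p pZ HP; apply: plot_prod_snd; exact: hsm.
split=> [z Vz|x A Vx].
  have [[/= Vh _] e] := h2 z Vz; rewrite -[RHS]e; congr (gactr (s _)).
  by rewrite -{1}e (gh_actr_l gZ) ?gls //; case: (gr _).
have xA : [set x | V x.1 /\ gr (s x.1) = tgt x.2] (x, A).
  by split => //=; case: (gr _).
by have [_ ->] := h1 _ xA.
Qed.

Lemma genhom_degree_hom : has_degree_hom R n.
Proof.
have mM := lie_objects lG.
have /choice[t Ht] := genhom_coord.
have /choice[t' Ht'] := Ht.
have /choice[c Hc] := Ht'.
(* Covers are required to be countable, so the trivialising sets [t m] are thinned out. *)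
have [|D [cD HD]] := lindelof (V := t) mM; first by move=> m; have [] := Hc m.
pose I := {m | D m}; pose U (i : I) := t (sval i).
have cU : is_open_cover U.
  split; first exact: countable_sub.
    by move=> i; have [[]] := Hc (sval i).
  by move=> m; have [y Dy ty] := HD m; exists (exist _ y Dy).
exists I, U; split; [exact: cU|move=> RU].
pose f := @cover_map K M I U.
pose idx (y : cover_space U) : M := sval (projT1 y).
have in_t (y : cover_space U) : t (idx y) (f y) by exact: (svalP (projT2 y)).
(* With i and j the pieces of target and source, [z x] is r . s_j, and [phi x] below is its
   coordinate in s_i, the cocycle. *)
pose z (x : RU) : Z := gactl (sval x).2 (t' (idx (sval x).1.2) (f (sval x).1.2)).
have srcz (x : RU) : src (sval x).2 = gl (t' (idx (sval x).1.2) (f (sval x).1.2)).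
  have [_ _ gls _ _] := Hc (idx (sval x).1.2).
  by have [_ ->] := svalP x; rewrite gls //; exact: in_t.
have glz (x : RU) : gl (z x) = f (sval x).1.1.
  by rewrite (gh_actl_l gZ) ?srcz //; have [-> _] := svalP x.
pose phi (x : RU) : GL n := c (idx (sval x).1.1) (z x).
have phiP (x : RU) : gactr (t' (idx (sval x).1.1) (f (sval x).1.1)) (phi x) = z x.
  have [_ _ _ _ [H _]] := Hc (idx (sval x).1.1).
  by rewrite -glz; apply: H; rewrite glz; exact: in_t.
have phiU (x : RU) A :
    gactr (t' (idx (sval x).1.1) (f (sval x).1.1)) A = z x -> phi x = A.
  have [_ _ _ _ [_ H]] := Hc (idx (sval x).1.1).
  by rewrite /phi => <-; apply: H; exact: in_t.
have tr (z' : Z) (A : GL n) : gr z' = tgt A by case: (gr z').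
have mR := lie_mul_typed lR.
exists (fun x => \det (sval (phi x))); split.
- move=> d W p [[p1 p2] pR] _; apply: plot_det.
  rewrite -[plot _ _ _]/(plot (GL n) W (phi \o p)).
  apply: plot_local; first exact: plot_open pR.
  (* Near a given parameter both pieces are constant, so one section and one coordinate map
     suffice. *)
  move=> u Wu; have [_ H1] := p1; have [_ H2] := p2.
  have [V1 [i [q1 [V1u q1p p1E]]]] := H1 u Wu.
  have [V2 [j [q2 [V2u q2p p2E]]]] := H2 u Wu.
  pose V := W `&` (V1 `&` V2).
  have oV : open V.
    apply: openI; first exact: plot_open pR.
    by apply: openI; [exact: plot_open q1p|exact: plot_open q2p].
  exists V => //.
  have [_ sj gls _ _] := Hc (sval j); have [_ _ _ ci _] := Hc (sval i).
  apply: (@plot_eq _ (GL n) _ _ _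
    (fun v => c (sval i) (gactl (sval (p v)).2 (t' (sval j) (sval (q2 v)))))).
    move=> v [Wv [V1v V2v]]; rewrite /= /phi /z.
    by have /= -> := p1E v V1v; have /= -> := p2E v V2v.
  have E v : V v -> gactl (sval (p v)).2 (t' (sval j) (sval (q2 v))) = z (p v).
    by move=> [Wv [V1v V2v]]; rewrite /z; have /= -> := p2E v V2v.
  apply: ci; last first.
    move=> v Vv; rewrite /= E // glz; have [_ [V1v _]] := Vv.
    by have /= -> := p1E v V1v; exact: (svalP (q1 v)).
  apply: (gh_actl_smooth gZ (p := fun v => ((sval (p v)).2, t' (sval j) (sval (q2 v))))).
    split; first by apply: plot_sub pR => // v [].
    apply: sj; last by move=> v [_ [_ V2v]]; exact: (svalP (q2 v)).
    by apply: plot_sub q2p => // v [_ []].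
  move=> v [Wv [V1v V2v]] /=; rewrite gls; last exact: (svalP (q2 v)).
  by have [_ ->] := svalP (p v); have /= -> := p2E v V2v.
- move=> x; have := svalP (phi x); rewrite /= unitmxE unitfE; exact.
(* Uniqueness of coordinates applied to r.r'.s_k = r.s_j.phi(r') = s_i.phi(r).phi(r'). *)
- move=> x y xy; rewrite -det_mulmx -GL_mulE; congr (\det (sval _)); apply: phiU.
  have E1 := pullback_mulE mR xy.
  have xy' : (sval x).1.2 = (sval y).1.1 := xy.
  have rs : src (sval x).2 = tgt (sval y).2.
    by have [_ ->] := svalP x; have [-> _] := svalP y; rewrite xy'.
  rewrite /z E1 /= (gh_actl_mul gZ) //.
  rewrite -[gactl (sval y).2 _]/(z y) -phiP -xy'.
  rewrite -(gh_commute gZ) //.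
  by rewrite -[gactl (sval x).2 _]/(z x) -phiP (gh_actr_mul gZ).
(* Here (a r).s_j = s_i.phi(r).a, and the scalar matrix of size [n] has determinant a^n. *)
- move=> a x ca; have a0 := circle_neq0 ca.
  rewrite -det_scalar mulrC -det_mulmx -(GL_act1 _ a0) -GL_mulE.
  congr (\det (sval _)); apply: phiU.
  have E1 : sval (eact a x) = ((sval x).1, eact a (sval x).2).
    exact: (pullback_actE _ (weak_of_central cR) ca).
  rewrite /z E1 /= genhom_scalar //.
  by rewrite -[gactl (sval x).2 _]/(z x) -phiP (gh_actr_mul gZ).
Qed.
End GenhomDegree.

(** * The frame bundle *)

Section Bundles.
Variable K : realType.
Local Notation dspace := (dspace K).

(** A local trivialisation over [V] with fibre [F]: [e] is the fibre coordinate and [h] the inverse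
    of x -> (pi x, e x). *)
Definition bundle_chart (X M F : dspace) (pi : X -> M) (V : set M)
    (e : X -> F) (h : M * F -> X) :=
  [/\ D_open V, smooth_on [set x | V (pi x)] e,
      smooth_on (X := prodD M F) [set y | V y.1] h,
      forall x, V (pi x) -> h (pi x, e x) = x &
      forall m a, V m -> pi (h (m, a)) = m /\ e (h (m, a)) = a].

(** Distinct points are separated by [pi] or, within a fibre, by the coordinate of one
    trivialisation; countably many trivialisations, each modelled on [M] times [F], then give the
    atlas. *)
Lemma manifold_bundle (X M F : dspace) (pi : X -> M) :
  smooth pi -> is_manifold M -> is_manifold F ->
  (forall m, exists V e h, V m /\ @bundle_chart X M F pi V e h) -> is_manifold X.
Proof.
move=> pism mM mF H.
have hX : hausdorff X.
  apply: hausdorff_separated => x y xy; have [e|ne] := pselect (pi x = pi y); last first.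
    exists M, setT, pi; split => //; [exact: manifold_hausdorff|exact: D_openT].
  have [V [c [h [Vx [oV cV hV hc ch]]]]] := H (pi x).
  exists F, (pi @^-1` V), c; split => //; [exact: manifold_hausdorff|
    exact: D_open_preimT|by rewrite /= -e|].
  by move=> cc; apply: xy; rewrite -(hc x Vx) cc e hc // -e.
have /choice[V HV] := H.
have [|D [cD HD]] := lindelof (V := V) mM.
  by move=> m; have [e [h [Vm []]]] := HV m.
apply: (@manifold_cover _ X (prodD M F) {m | D m} (fun m => pi @^-1` (V (sval m)))
   (fun m => [set y | V (sval m) y.1])
   (fun m x => (pi x, sval (cid (HV (sval m))) x))) => //.
- exact: manifold_prodD.
- exact: countable_sub.
- move=> [m Dm] /=; case: (cid _) => e /= [h [Vm [oV cV hV hc ch]]]; split.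
  + exact: D_open_preimT.
  + exact: D_open_preimT (@smooth_fst _ M F) oV.
  + exists h; split => //.
    * by apply: smooth_on_pair => //; exact: smooth_onT.
    * by move=> x Vx; split => //; exact: hc.
    * by move=> [m' a] /= Vm'; have [E1 E2] := ch m' a Vm'; rewrite /preimage /= E1 E2.
- by move=> x; have [m Dm Vm] := HD (pi x); exists (exist _ m Dm).
Qed.

(** The pointwise diffeology. It suits frames: a linear map from C^n varies smoothly as soon as its
    values on the basis vectors do. *)
Definition funD (S : Type) (X : dspace) : dspace.
Proof.
refine (@DSpace K (S -> X)
  (fun d U p => open U /\ forall s, plot X U (fun u => p u s)) _ _ _ _).
- by move=> d U p [].
- by move=> d U x oU; split => // s; exact: plot_cst.
- by move=> d e U V p g [oU pX] oV Cg VU; split => // s; exact: (plot_comp (pX s)).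
- move=> d U p oU H; split => // s; apply: plot_glue => // x /H[V [q [Vx [oV qX] pq]]].
  by exists V, (fun u => q u s); split => // y Vy; rewrite pq.
Defined.
End Bundles.

Section LinearAlgebra.
Variable F : fieldType.

Lemma linear_mulmxE m n (L : 'cV[F]_n -> 'cV[F]_m) :
  (forall v w, L (v + w) = L v + L w) -> (forall c v, L (c *: v) = c *: L v) ->
  forall v, L v = (\matrix_(i, j) L (delta_mx j 0) i 0) *m v.
Proof.
move=> LD LZ v; have L0 : L 0 = 0 by rewrite -(scale0r 0) LZ scale0r.
rewrite [v in LHS]matrix_sum_delta (big_morph L LD L0).
apply/colP => i; rewrite summxE mxE; apply: eq_bigr => j _.
by rewrite big_ord1 LZ !mxE mulrC.
Qed.

Lemma unitmx_of_inj n (A : 'M[F]_n) :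
  (forall v : 'cV[F]_n, A *m v = 0 -> v = 0) -> A \in unitmx.
Proof.
move=> H; rewrite -unitmx_tr -row_free_unit -kermx_eq0.
apply/rowV0P => v /sub_kermxP vA; apply: trmx_inj; rewrite trmx0; apply: H.
by rewrite -[A]trmxK -trmx_mul vA trmx0.
Qed.
End LinearAlgebra.

Section FrameBundle.
Variable K : realType.
Local Notation C := (complex K).
Local Notation dspace := (dspace K).
Local Notation complexD := (complexD K).
Local Notation matrixD := (matrixD K).
Local Notation GL := (GL K).
Variables (M : dspace) (G : groupoid M) (R : extension G) (n : nat).
Hypothesis cR : is_central_extension (@circle K) R.
Variables (E : vbundle M) (act : R -> E -> E).
Hypothesis vE : is_vbundle n E.
Hypothesis aE : is_twisted_action act.

Let lR : is_lie_groupoid R := ext_lie cR.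

Definition is_frame (m : M) (T : 'cV[C]_n -> E) :=
  [/\ forall v, vproj (T v) = m,
      forall v w, T (v + w) = vadd (T v) (T w),
      forall c v, T (c *: v) = vscale c (T v),
      injective T & forall x, vproj x = m -> exists v, T v = x].

Definition frameD : dspace :=
  @subD K (funD 'cV[C]_n E) [set T | exists m, is_frame m T].

Definition frame_proj (z : frameD) : M := vproj (sval z 0).

Lemma frameP (z : frameD) : is_frame (frame_proj z) (sval z).
Proof. by have [m H] := svalP z; have [p _ _ _ _] := H; rewrite /frame_proj p. Qed.

Lemma frame_vproj (z : frameD) v : vproj (sval z v) = frame_proj z.
Proof. by have [] := frameP z. Qed.

Definition frame_actr (z : frameD) (A : GL n) : frameD :=
  sub_of z (fun v => sval z (sval A *m v)).

Definition frame_actl (r : R) (z : frameD) : frameD :=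
  sub_of z (fun v => act r (sval z v)).

(** The circle acts through scalar matrices on the right; frames being linear, this multiplies their
    values by [a]. *)
Definition frame_scale (a : C) (z : frameD) : frameD :=
  frame_actr z (GL_act a (GL_of 1%:M : GL n)).

Lemma is_frame_actr (z : frameD) (A : GL n) :
  is_frame (frame_proj z) (fun v => sval z (sval A *m v)).
Proof.
have [p add sc inj surj] := frameP z; have uA : sval A \in unitmx := svalP A.
split=> [v|v w|c v|v w|x].
- exact: p.
- by rewrite mulmxDr add.
- by rewrite -scalemxAr sc.
- by move/inj => e; rewrite -[v](mulKmx uA) e mulKmx.
- by move=> /surj[v <-]; exists (invmx (sval A) *m v); rewrite mulKVmx.
Qed.

Lemma frame_actrE (z : frameD) (A : GL n) v :
  sval (frame_actr z A) v = sval z (sval A *m v).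
Proof.
by rewrite /frame_actr sub_ofE //; exists (frame_proj z); exact: is_frame_actr.
Qed.

Lemma frame_actr_proj (z : frameD) (A : GL n) :
  frame_proj (frame_actr z A) = frame_proj z.
Proof. by rewrite /frame_proj frame_actrE !frame_vproj. Qed.

(** Bijectivity onto the new fibre comes from the action of the inverse arrow. *)
Lemma is_frame_actl (r : R) (z : frameD) : src r = frame_proj z ->
  is_frame (tgt r) (fun v => act r (sval z v)).
Proof.
move=> rz; have [p add sc inj surj] := frameP z.
have [inv [_ invP]] := lie_inv lR; have [si ti i1 i2] := invP r.
have pr v : src r = vproj (sval z v) by rewrite p.
split=> [v|v w|c v|v w e|x xr].
- by rewrite (tw_proj aE).
- by rewrite add (tw_add aE) // !p.
- by rewrite sc (tw_scale aE).
- apply: inj; have := congr1 (act (inv r)) e.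
  by rewrite -!(tw_mul aE) // !(tw_one aE) // -?pr.
- have sx : src (inv r) = vproj x by rewrite si xr.
  have [|v Hv] := surj (act (inv r) x); first by rewrite (tw_proj aE) // ti.
  exists v; rewrite Hv -(tw_mul aE) // (tw_one aE) //.
  by rewrite xr.
Qed.

Lemma frame_actlE (r : R) (z : frameD) v : src r = frame_proj z ->
  sval (frame_actl r z) v = act r (sval z v).
Proof.
by move=> rz; rewrite /frame_actl sub_ofE //; exists (tgt r); exact: is_frame_actl.
Qed.

Lemma frame_actl_proj (r : R) (z : frameD) : src r = frame_proj z ->
  frame_proj (frame_actl r z) = tgt r.
Proof.
by move=> rz; rewrite /frame_proj frame_actlE // (tw_proj aE) // frame_vproj.
Qed.

Lemma frame_scaleE a (z : frameD) v : a != 0 ->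
  sval (frame_scale a z) v = sval z (a *: v).
Proof. by move=> a0; rewrite /frame_scale frame_actrE GL_act1 // mul_scalar_mx. Qed.

Lemma frame_eq (z w : frameD) : (forall v, sval z v = sval w v) -> z = w.
Proof. by move=> H; apply: sval_inj; exact/funext. Qed.

Lemma smooth_frame_proj : smooth frame_proj.
Proof. by move=> d U p [oU pE] _; exact: (vb_proj_smooth vE (pE 0)). Qed.

(** A trivialisation of [E] with inverse [psi] gives the local frame v -> psi (x, v), and [mat z] is
    the matrix of [z] in it, read off on basis vectors. The last clause is the joint smoothness of
    (x, v) -> fr x v, whereas a plot of frames is by definition smooth only for each fixed v. *)
Lemma frame_chart (m : M) : exists (V : set M) (mat : frameD -> matrixD n n)
    (fr : M -> frameD),
  [/\ D_open V /\ V m, smooth_on [set z | V (frame_proj z)] mat, smooth_on V fr,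
     forall x, V x -> frame_proj (fr x) = x &
     [/\ forall z, V (frame_proj z) -> mat z \in unitmx,
         forall z v, V (frame_proj z) -> sval z v = sval (fr (frame_proj z)) (mat z *m v) &
         forall x A, V x -> mat (frame_actr (fr x) A) = sval A] /\
     forall d (U : set 'rV[K]_d) (x : 'rV[K]_d -> M) (y : 'rV[K]_d -> matrixD n 1),
       plot M U x -> plot (matrixD n 1) U y -> (forall u, U u -> V (x u)) ->
       plot E U (fun u => sval (fr (x u)) (y u))].
Proof.
have [V [phi [oV Vm [psi [vsm psism h1 h2]] phiD phiZ]]] := vb_trivial vE m.
have phism : smooth_on [set x : E | V (vproj x)] phi.
  by move=> d U p pE HP; have [_] := vsm d U p pE HP.
have is_fr x : V x -> is_frame x (fun v => psi (x, v)).
  move=> Vx; have q v : vproj (psi (x, v)) = x /\ phi (psi (x, v)) = v.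
    by have [_ [-> ->]] := h2 (x, v) Vx.
  have inj (a b : E) : vproj a = x -> vproj b = x -> phi a = phi b -> a = b.
    move=> ax bx ab; have [|_ <-] := h1 a; first by rewrite /= ax.
    by have [|_ <-] := h1 b; [rewrite /= bx|rewrite ax bx ab].
  split=> [v|v w|c v|v w e|y yx].
  - by have [] := q v.
  - have [p1 e1] := q v; have [p2 e2] := q w; have [p3 e3] := q (v + w).
    apply: inj => //; first by rewrite (vb_add_proj vE) // p1.
    by rewrite e3 phiD ?p1 ?p2 // e1 e2.
  - have [p1 e1] := q v; have [p3 e3] := q (c *: v).
    apply: inj => //; first by rewrite (vb_scale_proj vE).
    by rewrite e3 phiZ ?p1 // e1.
  - by have [_ <-] := q v; have [_ <-] := q w; rewrite e.
  - exists (phi y); have [|_] := h1 y; first by rewrite /= yx.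
    by rewrite yx.
pose z0 : frameD := exist _ (fun v => psi (m, v)) (ex_intro _ m (is_fr m Vm)).
pose fr x : frameD := sub_of z0 (fun v => psi (x, v)).
have frE x v : V x -> sval (fr x) v = psi (x, v).
  by move=> Vx; rewrite /fr sub_ofE //; exists x; apply: (is_fr x Vx).
have frp x : V x -> frame_proj (fr x) = x.
  by move=> Vx; rewrite /frame_proj frE //; have [_ [->]] := h2 (x, 0) Vx.
pose mat (z : frameD) : matrixD n n := \matrix_(i, j) phi (sval z (delta_mx j 0)) i 0.
have matE z v : V (frame_proj z) -> phi (sval z v) = mat z *m v.
  move=> Vz; have [p add sc inj surj] := frameP z.
  apply: (linear_mulmxE (L := fun v => phi (sval z v))) => [w w'|c w].
    by rewrite add phiD // !p.
  by rewrite sc phiZ // p.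
have psiE z v : V (frame_proj z) -> sval z v = psi (frame_proj z, mat z *m v).
  move=> Vz; rewrite -matE //; have [|_ /= e] := h1 (sval z v).
    by rewrite /= frame_vproj.
  by rewrite -{1}e frame_vproj.
exists V, mat, fr; split => //.
- move=> d U p [oU pE] HP; apply/plot_matrixP; split => // i j.
  rewrite (_ : (fun _ => _) = fun u => phi (sval (p u) (delta_mx j 0)) i 0).
    have H : plot (matrixD n 1) U (fun u => phi (sval (p u) (delta_mx j 0))).
      by apply: phism (pE _) _ => u /HP /=; rewrite frame_vproj.
    by have [_] := (plot_matrixP _ _).1 H.
  by apply/funext => u; rewrite mxE.
- move=> d U p pM HP; split; first exact: plot_open pM.
  move=> v; apply: (@plot_eq _ E _ _ _ (fun u => psi (p u, v))).
    by move=> u /HP Vu; exact: frE.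
  apply: (psism d U (fun u => (p u, v))) => //; split => //.
  by apply: plot_cst; exact: plot_open pM.
- split.
    split=> [z Vz|z v Vz|x A Vx].
    + apply: unitmx_of_inj => v; rewrite -matE // => e.
      have [p add sc inj surj] := frameP z; apply: inj.
      by rewrite (psiE _ _ Vz) -matE // e (psiE _ 0 Vz) mulmx0.
    + by rewrite frE // -psiE.
    + apply/matrixP => i j; rewrite mxE frame_actrE frE //.
      by have [_ [_ ->]] := h2 (x, sval A *m delta_mx j 0) Vx; rewrite -colE mxE.
  move=> d U x y pM pY HV; apply: (@plot_eq _ E _ _ _ (fun u => psi (x u, y u))).
    by move=> u /HV Vu; exact: frE.
  by apply: (psism d U (fun u => (x u, y u))).
Qed.

(** The vector A v moves with the parameter, while plots of frames are controlled at fixed vectors.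
    Locally the frame is therefore written as a smooth local frame times a matrix. *)
Lemma smooth_frame_actr (P : set (frameD * GL n)) :
  smooth_on (X := prodD frameD (GL n)) P (fun x => frame_actr x.1 x.2).
Proof.
move=> d U p [pZ pA] _; split; first exact: plot_open pA.
move=> v; apply: plot_local; first exact: plot_open pA.
move=> u Uu; have [V [mat [fr [[oV Vu] matsm frsm frp [[_ H _] Hp]]]]] :=
  frame_chart (frame_proj (p u).1).
have pM := smooth_frame_proj pZ (fun _ _ => I).
have oW := oV _ _ _ pM; set W := U `&` _ in oW.
have WU : W `<=` U by move=> w [].
exists W; first by split.
apply: (@plot_eq _ E _ _ _ (fun w => sval (fr (frame_proj (p w).1))
    (mat (p w).1 *m (sval (p w).2 *m v)))).
  by move=> w [Uw Vw]; rewrite /= frame_actrE H.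
apply: Hp; [exact: plot_sub pM| |by move=> w []].
apply: plot_mulmx.
  by apply: (matsm _ _ (fst \o p)); [exact: plot_sub pZ|move=> w []].
apply: plot_mulmx; first exact: (plot_sub oW WU pA).
exact: plot_cst.
Qed.

Lemma smooth_frame_actl :
  smooth_on (X := prodD R frameD) [set x | src x.1 = frame_proj x.2]
    (fun x => frame_actl x.1 x.2).
Proof.
move=> d U p [pR [oU pE]] HP; split => // v.
apply: (@plot_eq _ E _ _ _ (fun u => act (p u).1 (sval (p u).2 v))).
  by move=> u /HP H; exact: frame_actlE.
apply: (tw_smooth aE (p := fun u => ((p u).1, sval (p u).2 v))).
  by split => //; exact: pE.
by move=> u /HP /= ->; rewrite frame_vproj.
Qed.

Lemma manifold_frameD : is_manifold M -> is_manifold frameD.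
Proof.
move=> mM; apply: (manifold_bundle smooth_frame_proj mM (manifold_GL K n)) => m.
have [V [mat [fr [[oV Vm] matsm frsm frp [[matu matE matA] _]]]]] := frame_chart m.
exists V, (fun z => GL_of (mat z)), (fun y => frame_actr (fr y.1) y.2).
split => //; split => //.
- move=> d U p pZ HP; apply: (@plot_eq _ (matrixD n n) _ _ _ (mat \o p)); last exact: matsm.
  by move=> u /HP Vu; apply: GL_ofE; exact: matu.
- move=> d U p [pM pA] HP.
  apply: (@smooth_frame_actr setT d U (fun u => (fr (p u).1, (p u).2))) => //.
  by split => //; exact: frsm.
- move=> z Vz; apply: frame_eq => v; rewrite frame_actrE GL_ofE ?matu //.
  by rewrite -matE.
- move=> x A Vx; rewrite frame_actr_proj frp //; split => //.
  by apply: sval_inj; rewrite GL_ofE ?matA //; exact: (svalP A).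
Qed.

Definition frame_genhom : genhom R (GL n) :=
  GenHom (G1 := R) (G2 := GL n) frame_proj (fun=> tt) frame_actl frame_actr.

Lemma is_genhom_frame : is_genhom frame_genhom.
Proof.
have mM := lie_objects lR.
split => /=.
- exact: manifold_frameD.
- exact: smooth_frame_proj.
- exact: smooth_cst.
- exact: smooth_frame_actl.
- exact: frame_actl_proj.
- by [].
- move=> z g ig; have [sg tg _ _] := ig; apply: frame_eq => v.
  by rewrite frame_actlE // (tw_one aE) // frame_vproj.
- move=> g h z gh hz; have s := lie_mul_src lR gh; apply: frame_eq => v.
  rewrite !frame_actlE ?s // ?(tw_mul aE) ?frame_vproj //.
  by rewrite frame_actl_proj.
- exact: smooth_frame_actr.
- by move=> z h _; exact: frame_actr_proj.
- by move=> z [].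
(* An identity of [GL n] is the unit matrix, as its product with the unit matrix shows. *)
- move=> z h [_ _ + _] => /(_ (GL_of 1%:M) erefl) /(congr1 (@proj1_sig _ _)).
  rewrite GL_mulE GL_ofE ?unitmx1 // mulmx1 => h1.
  by apply: frame_eq => v; rewrite frame_actrE h1 mul1mx.
- move=> z g h _ _; apply: frame_eq => v.
  by rewrite !frame_actrE GL_mulE mulmxA.
- move=> g z h gz _; apply: frame_eq => v.
  by rewrite frame_actrE !frame_actlE ?frame_actr_proj // frame_actrE.
- move=> m.
  have [V [mat [fr [[oV Vm] matsm frsm frp [[matu matE matA] _]]]]] := frame_chart m.
  exists V, fr; split => //; exists (fun z => (frame_proj z, GL_of (mat z))); split.
  + move=> d U p [pM pA] HP.
    apply: (@smooth_frame_actr setT d U (fun u => (fr (p u).1, (p u).2))) => //.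
    by split => //; apply: frsm => // u /HP[].
  + move=> d U p pZ HP; split; first exact: smooth_frame_proj.
    apply: (@plot_eq _ (matrixD n n) _ _ _ (mat \o p)); last exact: matsm.
    by move=> u /HP Vu; apply: GL_ofE; exact: matu.
  + move=> [x A] [/= Vx _]; rewrite frame_actr_proj frp //; split => //.
    by congr pair; apply: sval_inj; rewrite GL_ofE ?matA //; exact: (svalP A).
  + move=> z Vz; split => //=; apply: frame_eq => v.
    by rewrite frame_actrE GL_ofE ?matu // -matE.
Qed.

Lemma is_equivariant_frame :
  is_equivariant (Z := frame_genhom) (@eact K M G R) (@GL_act K n) frame_scale.
Proof.
split => /=.
- move=> d U p [pC pZ] HP; have oU := plot_open pC.
  apply: (@smooth_frame_actr setT d U
    (fun u => ((p u).2, GL_act (p u).1 (GL_of 1%:M : GL n)))) => //; split => //.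
  apply: (@plot_eq _ (matrixD n n) _ _ _ (fun u => ((p u).1)%:M)).
    by move=> u /HP /circle_neq0 a0; exact: GL_act1.
  apply/plot_matrixP; split => // i j.
  rewrite (_ : (fun _ => _) = fun u => (p u).1 * (i == j)%:R).
    by apply: plot_cmul => //; exact: plot_ccst.
  by apply/funext => u; rewrite mxE mulr_natr.
- by move=> z; apply: frame_eq => v; rewrite frame_scaleE ?oner_neq0 // scale1r.
- move=> a b z /circle_neq0 a0 /circle_neq0 b0; apply: frame_eq => v.
  transitivity (sval z (a * b *: v)); first exact: frame_scaleE (mulf_neq0 a0 b0).
  rewrite mulrC -scalerA -(frame_scaleE z (a *: v) b0); apply/esym.
  exact: frame_scaleE a0.
- by move=> a z ca; exact: frame_actr_proj.
- by [].
- move=> a g z h ca gz _; have a0 := circle_neq0 ca; congr frame_actr.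
  have agz : src (eact a g) = frame_proj z.
    by rewrite -eproj_src (ext_act_proj cR) // eproj_src.
  apply: frame_eq => v; rewrite !frame_actlE ?frame_actr_proj // frame_scaleE //.
  (* Linearity takes the scalar out of the frame, and the twisting condition takes it out of the
     arrow. *)
  have [_ _ sc _ _] := frameP z; rewrite sc (tw_twisted aE) // ?frame_vproj //.
  by rewrite (tw_scale aE) // frame_vproj.
- move=> a g z h ca gz _; have a0 := circle_neq0 ca; apply: frame_eq => v.
  have uh : a *: sval h \in unitmx by rewrite unitmxZ ?unitfE // (svalP h).
  rewrite !frame_actrE !frame_actlE ?frame_actr_proj // frame_scaleE //.
  by rewrite (@sub_ofE _ [set B : 'M[C]_n | B \in unitmx] _ _ uh) scalemxAl.
Qed.
End FrameBundle.

(** * The associated vector bundle *)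

Section AssociatedBundle.
Variable K : realType.
Local Notation C := (complex K).
Local Notation dspace := (dspace K).
Local Notation complexD := (complexD K).
Local Notation matrixD := (matrixD K).
Local Notation GL := (GL K).
Variables (M : dspace) (G : groupoid M) (R : extension G) (n : nat).
Hypothesis cR : is_central_extension (@circle K) R.
Variables (Z : genhom R (GL n)) (act : C -> Z -> Z).
Hypothesis gZ : is_genhom Z.
Hypothesis eZ : is_equivariant (@eact K M G R) (@GL_act K n) act.

Let lR : is_lie_groupoid R := ext_lie cR.
Local Notation V := 'cV[C]_n.

(** The relation (z, A v) ~ (z A, v), written without inverting [A]. *)
Definition assoc_rel (x y : prodD Z (matrixD n 1)) : Prop :=
  exists A : GL n, y.1 = gactr x.1 A /\ x.2 = sval A *m y.2.

Definition assocD : dspace := quotD assoc_rel.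

Definition assoc (z : Z) (v : V) : assocD := quot_class assoc_rel (z, v).

Let tr (z : Z) (A : GL n) : gr z = tgt A. Proof. by case: (gr z). Qed.

Let actrM (z : Z) (A B : GL n) : gactr (gactr z A) B = gactr z (mul A B).
Proof. by rewrite (gh_actr_mul gZ). Qed.

Let actr_gl (z : Z) (A : GL n) : gl (gactr z A) = gl z.
Proof. by rewrite (gh_actr_l gZ). Qed.

Let GLV (A : GL n) : exists B : GL n, [/\ mul A B = GL_of 1%:M,
  sval A *m sval B = 1%:M & sval B *m sval A = 1%:M].
Proof.
have uA : sval A \in unitmx := svalP A.
have uV : invmx (sval A) \in unitmx by rewrite unitmx_inv.
pose B : GL n := GL_of (invmx (sval A)); have BE : sval B = invmx (sval A) := GL_ofE uV.
have AB : sval A *m sval B = 1%:M by rewrite BE mulmxV.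
have BA : sval B *m sval A = 1%:M by rewrite BE mulVmx.
exists B; split; [apply: sval_inj|exact: AB|exact: BA].
by rewrite (GL_mulE A B) AB (GL_ofE (unitmx1 C n)).
Qed.

Lemma assoc_eqP (z z' : Z) (v v' : V) : assoc z v = assoc z' v' <->
  exists A : GL n, z' = gactr z A /\ v = sval A *m v'.
Proof.
apply: quot_classP => [x|x y [A [e1 e2]]|x y w [A [e1 e2]] [B [e3 e4]]].
- exists (GL_of 1%:M); rewrite (genhom_gactr1 gZ) (GL_ofE (unitmx1 C n)).
  by rewrite mul1mx.
- have [B [AB _ BA]] := GLV A; exists B; rewrite e1 (actrM x.1 A B) AB.
  by rewrite (genhom_gactr1 gZ) e2 mulmxA BA mul1mx.
- by exists (mul A B); rewrite e3 e1 (actrM x.1 A B) e2 e4 (GL_mulE A B) mulmxA.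
Qed.

Lemma assoc_actr (z : Z) (A : GL n) v : assoc (gactr z A) v = assoc z (sval A *m v).
Proof. by apply/esym/assoc_eqP; exists A. Qed.

Lemma assoc_surj (e : assocD) : exists z v, e = assoc z v.
Proof.
by rewrite -[e](quot_reprK (r := assoc_rel)); case: (quot_repr _) => z v; exists z, v.
Qed.

Lemma assoc_repr (z : Z) (v : V) : exists A : GL n,
  (quot_repr (assoc z v)).1 = gactr z A /\ v = sval A *m (quot_repr (assoc z v)).2.
Proof.
have := quot_reprK (assoc z v); case: (quot_repr _) => z' v' /= /esym.
by move=> /assoc_eqP.
Qed.

Definition assoc_proj (e : assocD) : M := gl (quot_repr e).1.

Lemma assoc_projE z v : assoc_proj (assoc z v) = gl z.
Proof. by rewrite /assoc_proj; have [A [-> _]] := assoc_repr z v; rewrite actr_gl. Qed.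

(** In a local section the coordinate of z . D is c(z) D, and c(z) is invertible. *)
Lemma genhom_free (z : Z) (A B : GL n) : gactr z A = gactr z B -> A = B.
Proof.
have [W [s [c [[_ Wz] _ gls _ [cP cU]]]]] := genhom_coord gZ (gl z).
have e D : gactr z D = gactr (s (gl z)) (mul (c z) D).
  by rewrite -(actrM (s (gl z)) (c z) D) (cP z Wz).
rewrite (e A) (e B) => /(congr1 c).
rewrite (cU _ (mul (c z) A) Wz) (cU _ (mul (c z) B) Wz) => /(congr1 (@proj1_sig _ _)).
rewrite (GL_mulE (c z) A) (GL_mulE (c z) B) => {}e.
have uC : sval (c z) \in unitmx := svalP (c z).
by apply: sval_inj; rewrite -[LHS](mulKmx uC) e (mulKmx uC).
Qed.

Lemma genhom_trans (z z' : Z) : gl z = gl z' -> exists A : GL n, z' = gactr z A.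
Proof.
move=> zz'; have [W [s [c [[_ Wz] _ gls _ [cP cU]]]]] := genhom_coord gZ (gl z).
(* Both z . c(z)^-1 and z' . c(z')^-1 equal the value of the section, so c(z)^-1 c(z') carries z to
   z'. *)
have [D [cD _ _]] := GLV (c z); exists (mul D (c z')).
have Wz' : W (gl z') by rewrite -zz'.
have e : gactr z D = s (gl z).
  by rewrite -[X in gactr X D](cP z Wz) (actrM _ (c z) D) cD (genhom_gactr1 gZ).
by rewrite -(actrM z D (c z')) e zz' (cP z' Wz').
Qed.

Lemma assoc_fibre (z : Z) (e : assocD) : assoc_proj e = gl z -> exists v, e = assoc z v.
Proof.
have [z' [v' ->]] := assoc_surj e; rewrite assoc_projE => /esym /genhom_trans[A ->].
by exists (sval A *m v'); rewrite assoc_actr.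
Qed.

Lemma assoc_inj (z : Z) v v' : assoc z v = assoc z v' -> v = v'.
Proof.
move=> /assoc_eqP[A [zA ->]]; have {}zA : gactr z (GL_of 1%:M : GL n) = gactr z A.
  by rewrite -zA (genhom_gactr1 gZ).
by rewrite -(genhom_free zA) (GL_ofE (unitmx1 C n)) mul1mx.
Qed.

(** A point of [Z] is regarded as a frame v -> [z, v] of the fibre over [gl z]; this is its inverse,
    with default 0 off that fibre. *)
Definition assoc_coord (z : Z) (e : assocD) : V :=
  if pselect (exists v, e = assoc z v) is left H then sval (cid H) else 0.

Lemma assoc_coordK z e : assoc_proj e = gl z -> assoc z (assoc_coord z e) = e.
Proof.
move=> /assoc_fibre H; rewrite /assoc_coord; case: pselect => // H'.
by case: (cid _).
Qed.

Lemma assoc_coordE z v : assoc_coord z (assoc z v) = v.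
Proof. by apply: (@assoc_inj z); rewrite assoc_coordK // assoc_projE. Qed.

Lemma assoc_coord_actr z (A : GL n) v : assoc_coord z (assoc (gactr z A) v) = sval A *m v.
Proof. by rewrite assoc_actr assoc_coordE. Qed.

(** Both vectors are added in the frame of the chosen representative of the first one. *)
Definition assoc_bundle : vbundle M :=
  @VBundle K M assocD assoc_proj
    (fun e e' => let z := (quot_repr e).1 in
       assoc z ((quot_repr e).2 + assoc_coord z e'))
    (fun c e => assoc (quot_repr e).1 (c *: (quot_repr e).2)).

Definition assoc_act (r : R) (e : assoc_bundle) : assoc_bundle :=
  assoc (gactl r (quot_repr e).1) (quot_repr e).2.

(** A change of frame multiplies both coordinate vectors by the same matrix, so the sum can be
    computed in any frame. *)
Lemma assoc_addE z v w :
  vadd (assoc z v : assoc_bundle) (assoc z w) = assoc z (v + w).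
Proof.
rewrite [LHS]/=; have [A []] := assoc_repr z v; set q := quot_repr _ => qz qv.
have [B [_ AB _]] := GLV A.
have -> : assoc z w = assoc q.1 (sval B *m w).
  by rewrite qz assoc_actr mulmxA AB mul1mx.
by rewrite assoc_coordE qz assoc_actr mulmxDr -qv mulmxA AB mul1mx.
Qed.

Lemma assoc_scaleE c z v :
  vscale c (assoc z v : assoc_bundle) = assoc z (c *: v).
Proof.
rewrite [LHS]/=; have [A [-> e]] := assoc_repr z v.
by rewrite assoc_actr -scalemxAr -e.
Qed.

Lemma assoc_actE r z v : src r = gl z -> assoc_act r (assoc z v) = assoc (gactl r z) v.
Proof.
move=> rz; rewrite /assoc_act; have [A [-> e]] := assoc_repr z v.
by rewrite -(gh_commute gZ) // assoc_actr -e.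
Qed.

Lemma assoc_plot_lift d (U : set 'rV[K]_d) (p : 'rV[K]_d -> assocD) u :
  plot assocD U p -> U u -> exists W z v,
  [/\ W u, plot Z W z, plot (matrixD n 1) W v & forall w, W w -> p w = assoc (z w) (v w)].
Proof.
move=> [oU H] Uu; have [W [q [Wu [qZ qV] pq]]] := H u Uu.
exists W, (fst \o q), (snd \o q); split => // w /pq ->.
by rewrite /assoc /= -surjective_pairing.
Qed.

Lemma plot_assoc d (U : set 'rV[K]_d) z v : plot Z U z -> plot (matrixD n 1) U v ->
  plot assocD U (fun u => assoc (z u) (v u)).
Proof.
move=> zP vP; split; first exact: plot_open zP.
by move=> u Uu; exists U, (fun u => (z u, v u)).
Qed.

Lemma smooth_assoc_proj : smooth assoc_proj.
Proof.
move=> d U p pE _; apply: plot_local; first exact: plot_open pE.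
move=> u Uu; have [W [z [v [Wu zP vP pzv]]]] := assoc_plot_lift pE Uu.
exists W => //; apply: (@plot_eq _ M _ _ _ (fun w => gl (z w))).
  by move=> w /pzv /= ->; rewrite assoc_projE.
exact: (gh_l_smooth gZ zP).
Qed.

Lemma assoc_chart (m : M) : exists (W : set M) (s : M -> Z),
  W m /\ bundle_chart (F := matrixD n 1) assoc_proj W
    (fun e => assoc_coord (s (assoc_proj e)) e) (fun y => assoc (s y.1) y.2)
  /\ forall x, W x -> gl (s x) = x.
Proof.
have [W [s [c [[oW Wm] ssm gls csm [cP cU]]]]] := genhom_coord gZ m.
exists W, s; split => //; split => //; split => //.
- move=> d U p pE HP; apply: plot_local; first exact: plot_open pE.
  move=> u Uu; have [W' [z [v [Wu zP vP pzv]]]] := assoc_plot_lift pE Uu.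
  have oUW : open (U `&` W') by apply: openI; [exact: plot_open pE|exact: plot_open zP].
  exists (U `&` W') => //.
  have Wz w : (U `&` W') w -> W (gl (z w)).
    by move=> [Uw W'w]; have := HP w Uw; rewrite /= pzv // assoc_projE.
  (* Along a lift (z, v) the coordinate in the section is c(z) v, because z = s . c(z). *)
  apply: (@plot_eq _ (matrixD n 1) _ _ _ (fun w => sval (c (z w)) *m v w)).
    move=> w Hw; have Ww := Wz w Hw; case: Hw => Uw W'w; rewrite /= pzv // assoc_projE.
    by rewrite -{2}(cP _ Ww) assoc_coord_actr.
  apply: plot_mulmx.
    by apply: (csm _ _ z) => //; apply: plot_sub zP => // w [].
  by apply: plot_sub vP => // w [].
- move=> d U p [pM pV] HP; apply: plot_assoc => //.
  exact: ssm.
- by move=> e We; rewrite assoc_coordK // gls.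
- move=> x v Wx /=; rewrite assoc_projE gls //; split => //.
  by rewrite assoc_coordE.
Qed.

Lemma is_vbundle_assoc : is_vbundle n assoc_bundle.
Proof.
have mM := lie_objects lR.
split.
- apply: (manifold_bundle smooth_assoc_proj mM (manifold_matrixD K n 1)) => m.
  by have [W [s [Wm [H _]]]] := assoc_chart m; do 3 eexists; split; [exact: Wm|exact: H].
- exact: smooth_assoc_proj.
- move=> x y; have [z [v ->]] := assoc_surj x.
  rewrite [vproj _]assoc_projE => /esym /assoc_fibre[w ->].
  by rewrite assoc_addE [LHS]assoc_projE.
- move=> c x; have [z [v ->]] := assoc_surj x.
  by rewrite assoc_scaleE [LHS]assoc_projE [RHS]assoc_projE.
- move=> m; have [W [s [Wm [[oW esm hsm he eh] gls]]]] := assoc_chart m.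
  have co (x : assoc_bundle) : W (vproj x) -> exists2 v, x = assoc (s (vproj x)) v &
      assoc_coord (s (assoc_proj x)) x = v.
    move=> Wx; exists (assoc_coord (s (assoc_proj x)) x) => //.
    by rewrite assoc_coordK // gls.
  exists W, (fun e => assoc_coord (s (assoc_proj e)) e); split => //.
  + exists (fun y => assoc (s y.1) y.2); split => //.
    * by apply: smooth_on_pair => //; apply: smooth_onT; exact: smooth_assoc_proj.
    * by move=> e We; split => //; exact: he.
    * move=> [x v] Wx; have [] := eh x v Wx => /= e1 e2.
      by rewrite e2 e1.
  + move=> x y Wx xy; have Wy : W (vproj y) by rewrite -xy.
    have [v xv cv] := co x Wx; have [w yw cw] := co y Wy.
    rewrite cv cw xv yw -xy assoc_addE assoc_projE gls // assoc_coordE //.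
  + move=> c x Wx; have [v xv cv] := co x Wx.
    by rewrite cv xv assoc_scaleE assoc_projE gls // assoc_coordE.
Qed.

Lemma is_twisted_action_assoc : is_twisted_action (R := R) assoc_act.
Proof.
split.
- move=> d U p [pR pE] HP; apply: plot_local; first exact: plot_open pR.
  move=> u Uu; have [W [z [v [Wu zP vP pzv]]]] := assoc_plot_lift pE Uu.
  have oUW : open (U `&` W) by apply: openI; [exact: plot_open pR|exact: plot_open zP].
  have rz w : (U `&` W) w -> src (p w).1 = gl (z w).
    move=> [Uw Ww]; have := HP w Uw; rewrite /= => ->.
    by have /= -> := pzv w Ww; exact: assoc_projE.
  exists (U `&` W) => //.
  apply: (@plot_eq _ assocD _ _ _ (fun w => assoc (gactl (p w).1 (z w)) (v w))).
    move=> w Hw; have e := rz w Hw; case: Hw => Uw Ww.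
    by rewrite /=; have /= -> := pzv w Ww; exact: assoc_actE.
  apply: plot_assoc; last by apply: plot_sub vP => // w [].
  apply: (gh_actl_smooth gZ (p := fun w => ((p w).1, z w))) => //.
  by split; [apply: plot_sub pR => // w []|apply: plot_sub zP => // w []].
- move=> r x; have [z [v ->]] := assoc_surj x; rewrite [vproj _]assoc_projE => rz.
  by rewrite assoc_actE // [LHS]assoc_projE (gh_actl_l gZ).
- move=> r x; have [z [v ->]] := assoc_surj x; rewrite [vproj _]assoc_projE => ir.
  by have [rz _ _ _] := ir; rewrite assoc_actE // (gh_actl_one gZ).
- move=> r t x; have [z [v ->]] := assoc_surj x; rewrite [vproj _]assoc_projE => rt tz.
  rewrite (assoc_actE _ tz) !assoc_actE ?(lie_mul_src lR) ?(gh_actl_mul gZ) //.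
  by rewrite (gh_actl_l gZ).
- move=> r x y; have [z [v ->]] := assoc_surj x; rewrite [vproj _]assoc_projE => rz.
  move=> /esym /assoc_fibre[w ->].
  by rewrite assoc_addE !assoc_actE // assoc_addE.
- move=> r c x; have [z [v ->]] := assoc_surj x; rewrite [vproj _]assoc_projE => rz.
  by rewrite assoc_scaleE !assoc_actE // assoc_scaleE.
- move=> a r x ca; have [z [v ->]] := assoc_surj x; rewrite [vproj _]assoc_projE => rz.
  have arz : src (eact a r) = gl z by rewrite -eproj_src (ext_act_proj cR) // eproj_src.
  (* The scalar passes through the frame to the vector: (a r).[z, v] = [(r z).a, v] = [r z, a v]. *)
  rewrite !assoc_actE // assoc_scaleE (genhom_scalar gZ eZ) // assoc_actr.
  by rewrite (GL_act1 _ (circle_neq0 ca)) mul_scalar_mx.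
Qed.
End AssociatedBundle.

Theorem proposition5p5 (K : realType) (M : dspace K) (G : groupoid M)
    (R : extension G) (n : nat) :
  (0 < n)%N ->
  is_lie_groupoid G ->
  is_central_extension (@circle K) R ->
  (has_twisted_vbundle R n <-> has_equivariant_genhom R n) /\
  (has_equivariant_genhom R n -> has_degree_hom R n) /\
  (has_degree_hom R n <-> is_trivial (tensor_succ R n.-1)) /\
  (is_trivial (tensor_succ R n.-1) <-> has_mu_reduction R n).
Proof.
move=> n0 lG cR.
have triv := degree_hom_iff_trivial n0 (lie_mul_typed lG) (weak_of_central cR).
have mu := degree_hom_iff_mu_reduction n0 lG cR.
split; last split; last (by split; [exact: triv|rewrite -triv; exact: mu]).
  split=> [[E [act [vE aE]]]|[Z [act [gZ eZ]]]].
    exists (frame_genhom n act), (@frame_scale K M n E).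
    by split; [exact: is_genhom_frame|exact: is_equivariant_frame].
  exists (assoc_bundle Z), (@assoc_act K M G R n Z).
  by split; [exact: is_vbundle_assoc|exact: (is_twisted_action_assoc cR gZ eZ)].
move=> [Z [act [gZ eZ]]]; exact: (genhom_degree_hom lG cR gZ eZ).
Qed.
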